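(* Let $m\ge3$, $\rho=\frac12+\frac1m$ and $\delta>0$ small. Uniformly for $a$ in any compact subset of $\mathbb C^m$, as $\lambda\to\infty$ in the sector $\pi-\frac{4\pi}{m+2}+\delta\le\arg\lambda\le\pi+\frac{4\pi}{m+2}-\delta$, $$\mathcal W_{-1,1}(a,\lambda)=2i\exp\bigl[L(G^{-1}(a),\omega^{-2}\lambda)+L(G(a),\omega^{-m}\lambda)+O(\lambda^{-\rho})\bigr],$$ $$f(0,a,\lambda)=\omega^{\frac12+\mu(G^{-1}(a))}\lambda^{-\frac14}e^{-L(G^{-1}(a),\omega^{-2}\lambda)+O(\lambda^{-\rho})}-i\,\omega^{\frac12+\mu(a)}\lambda^{-\frac14}e^{-L(G(a),\omega^{-m}\lambda)+O(\lambda^{-\rho})},$$ $$f'(0,a,\lambda)=\omega^{\frac12+\mu(G^{-1}(a))}\lambda^{\frac14}e^{-L(G^{-1}(a),\omega^{-2}\lambda)+O(\lambda^{-\rho})}+i\,\omega^{\frac12+\mu(a)}\lambda^{\frac14}e^{-L(G(a),\omega^{-m}\lambda)+O(\lambda^{-\rho})}.$$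
   Context: For $a=(a_1,\dots,a_m)\in\mathbb C^m$ let $P(z)=a_1z^{m-1}+\dots+a_m$; $b_{j,k}(a)$ ($j\ge1$, $1\le k\le j$) is the coefficient of $z^{mk-j}$ in $\binom{1/2}{k}P(z)^k$, $b_j(a)=\sum_{k=1}^jb_{j,k}(a)$, $\nu(a)=0$ for $m$ odd, $\nu(a)=b_{\frac m2+1}(a)$ for $m$ even, $\mu(a)=\frac m4-\nu(a)$, and $F(z,a,\lambda)=\frac{2}{m+2}z^{\frac{m+2}2}+\sum_{1\le j<\frac{m+2}2}\frac{2}{m+2-2j}b_j(a)z^{\frac12(m+2-2j)}$. $f(z,a,\lambda)$ is Sibuya's solution of $-y''+(z^m+P(z)+\lambda)y=0$: entire in $(z,a,\lambda)$, with $f=z^{\mu(a)-\frac m2}(1+O(z^{-1/2}))e^{-F(z,a,\lambda)}$ and $f'=-z^{\mu(a)}(1+O(z^{-1/2}))e^{-F(z,a,\lambda)}$ as $z\to\infty$ in $|\arg z|\le\frac{3\pi}{m+2}-\varepsilon$, every $\varepsilon>0$; $f'=\partial_zf$. $L(a,\lambda)=\int_0^\infty\bigl(\sqrt{x^m+P(x)+\lambda}-x^{m/2}-\sum_{j=1}^{\lfloor(m+1)/2\rfloor}b_j(a)x^{\frac m2-j}-\frac{\nu(a)}{x+1}\bigr)dx$ (principal root), for $|\lambda|$ large with $|\arg\lambda|\le\pi-\delta$. $\omega=e^{2\pi i/(m+2)}$ and $\omega^s:=e^{2\pi is/(m+2)}$ for real $s$; $G^{\ell}(a)=(\omega^{-\ell}a_1,\omega^{-2\ell}a_2,\dots,\omega^{-m\ell}a_m)$,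 $G=G^1$. $f_k(z,a,\lambda)=f(\omega^{-k}z,G^k(a),\omega^{2k}\lambda)$ and $\mathcal W_{j,\ell}=f_jf_\ell'-f_j'f_\ell$ (independent of $z$). In the sector considered, $\omega^{-2}\lambda$ and $\omega^{-m}\lambda$ have arguments in $[-\pi+\delta,\pi-\delta]$ and $L$ is evaluated there; $\lambda^{\pm1/4}=|\lambda|^{\pm1/4}e^{\pm i\arg(\lambda)/4}$ with $\arg\lambda$ taken in the stated interval. *)

(* Defs.v *)
From Stdlib Require Import Reals Lra ZArith List.
From Coquelicot Require Import Coquelicot.
Open Scope R_scope.

Definition Cexpo (z : C) : C :=
  (exp (Re z) * cos (Im z), exp (Re z) * sin (Im z)).

(** Principal argument, in (-PI, PI] (junk value at z = 0). *)
Definition Carg (z : C) : R :=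
  if Rle_dec 0 (Im z) then acos (Re z / Cmod z) else - acos (Re z / Cmod z).

Definition Clog (z : C) : C := (ln (Cmod z), Carg z).
Definition Cpowc (z s : C) : C :=
  if Req_EM_T (Cmod z) 0 then 0%C else Cexpo (s * Clog z)%C.

Definition Csqrtp (z : C) : C := Cpowc z (RtoC (1/2)).

Definition Csum (l : list nat) (g : nat -> C) : C :=
  fold_right Cplus 0%C (map g l).

Definition omega_pow (m : nat) (s : C) : C :=
  Cexpo (Cmult s (0, 2 * PI / (INR m + 2))).

(** Coefficient vector a = (a_1,...,a_m) is represented by a : nat -> C
    (only the entries 1..m are used). P(z) = a_1 z^(m-1) + ... + a_m. *)
Definition Pval (m : nat) (a : nat -> C) (z : C) : C :=
  Csum (seq 1 m) (fun i => (a i * Cpow z (m - i))%C).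

Definition Pcoef (m : nat) (a : nat -> C) (d : nat) : C :=
  if Nat.ltb d m then a (m - d)%nat else 0%C.

Fixpoint Ppow_coef (m : nat) (a : nat -> C) (k d : nat) : C :=
  match k with
  | O => if Nat.eqb d 0 then 1%C else 0%C
  | S k' => Csum (seq 0 (S d)) (fun e => (Pcoef m a e * Ppow_coef m a k' (d - e))%C)
  end.

Fixpoint binom_half (k : nat) : R :=
  match k with
  | O => 1
  | S k' => binom_half k' * (1/2 - INR k') / INR (S k')
  end.

Definition bjk (m : nat) (a : nat -> C) (j k : nat) : C :=
  if Nat.leb j (m * k) then (RtoC (binom_half k) * Ppow_coef m a k (m * k - j))%C
  else 0%C.

Definition bj (m : nat) (a : nat -> C) (j : nat) : C :=
  Csum (seq 1 j) (fun k => bjk m a j k).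

Definition nu (m : nat) (a : nat -> C) : C :=
  if Nat.even m then bj m a (m / 2 + 1) else 0%C.

Definition mu (m : nat) (a : nat -> C) : C :=
  (RtoC (INR m / 4) - nu m a)%C.

(** F(z,a,lambda) (it does not actually depend on lambda):
    2/(m+2) z^((m+2)/2) + sum_{1 <= j < (m+2)/2} 2/(m+2-2j) b_j(a) z^((m+2-2j)/2).
    The indices j with 1 <= j < (m+2)/2 are exactly j = 1 .. (m+1)/2 (floor). *)
Definition Fexp (m : nat) (a : nat -> C) (z : C) : C :=
  (RtoC (2 / (INR m + 2)) * Cpowc z (RtoC ((INR m + 2) / 2))
   + Csum (seq 1 ((m + 1) / 2))
       (fun j => RtoC (2 / (INR m + 2 - 2 * INR j)) * bj m a j
                 * Cpowc z (RtoC ((INR m + 2 - 2 * INR j) / 2))))%C.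

Definition L_integrand (m : nat) (a : nat -> C) (lam : C) (x : R) : C :=
  (Csqrtp (Cpow (RtoC x) m + Pval m a (RtoC x) + lam)
   - RtoC (Rpower x (INR m / 2))
   - Csum (seq 1 ((m + 1) / 2)) (fun j => bj m a j * RtoC (Rpower x (INR m / 2 - INR j)))
   - nu m a / RtoC (x + 1))%C.

Definition Lfun (m : nat) (a : nat -> C) (lam : C) : C :=
  (RInt_gen (fun x => Re (L_integrand m a lam x)) (at_right 0) (Rbar_locally p_infty),
   RInt_gen (fun x => Im (L_integrand m a lam x)) (at_right 0) (Rbar_locally p_infty)).

Definition Gpow (m : nat) (l : Z) (a : nat -> C) : nat -> C :=
  fun i => (omega_pow m (RtoC (- (INR i * IZR l))) * a i)%C.

Definition is_sibuya (m : nat) (f fp : C -> (nat -> C) -> C -> C) : Prop :=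
  forall (a : nat -> C) (lam : C),
    (forall z : C, is_derive (fun w : C => f w a lam) z (fp z a lam)) /\
    (forall z : C, is_derive (fun w : C => fp w a lam) z
                     ((Cpow z m + Pval m a z + lam) * f z a lam)%C) /\
    (forall eps : R, 0 < eps ->
       exists K R0 : R, 0 < R0 /\
         forall z : C, R0 <= Cmod z ->
           Rabs (Carg z) <= 3 * PI / (INR m + 2) - eps ->
           exists h1 h2 : C,
             Cmod h1 <= K * Rpower (Cmod z) (- (1/2)) /\
             Cmod h2 <= K * Rpower (Cmod z) (- (1/2)) /\
             f z a lam = (Cpowc z (mu m a - RtoC (INR m / 2)) * (1 + h1)
                          * Cexpo (- Fexp m a z))%C /\
             fp z a lam = (- (Cpowc z (mu m a) * (1 + h2) * Cexpo (- Fexp m a z)))%C).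

(** f_k(z) = f(omega^{-k} z, G^k(a), omega^{2k} lambda) and its derivative
    f_k'(z) = omega^{-k} f'(omega^{-k} z, G^k(a), omega^{2k} lambda) (chain rule). *)
Definition fk (m : nat) (f : C -> (nat -> C) -> C -> C) (k : Z)
    (z : C) (a : nat -> C) (lam : C) : C :=
  f (omega_pow m (RtoC (- IZR k)) * z)%C (Gpow m k a)
    (omega_pow m (RtoC (2 * IZR k)) * lam)%C.

Definition fk' (m : nat) (fp : C -> (nat -> C) -> C -> C) (k : Z)
    (z : C) (a : nat -> C) (lam : C) : C :=
  (omega_pow m (RtoC (- IZR k)) *
   fp (omega_pow m (RtoC (- IZR k)) * z)%C (Gpow m k a)
      (omega_pow m (RtoC (2 * IZR k)) * lam)%C)%C.

Definition Wr (m : nat) (f fp : C -> (nat -> C) -> C -> C) (j l : Z)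
    (z : C) (a : nat -> C) (lam : C) : C :=
  (fk m f j z a lam * fk' m fp l z a lam - fk' m fp j z a lam * fk m f l z a lam)%C.

(** lambda = r e^{i theta}, with lambda^{s} := r^s e^{i s theta} (theta the chosen argument). *)
Definition polar (r theta : R) : C := Cmult (RtoC r) (Cexpo (0, theta)).
Definition lam_pow (r theta s : R) : C := Cmult (RtoC (Rpower r s)) (Cexpo (0, s * theta)).

(* Main.v *)
Require Import Defs.
From Stdlib Require Import Reals ZArith List Lra Lia Psatz FunctionalExtensionality.
From Coquelicot Require Import Coquelicot.
Open Scope R_scope.

(** On the positive axis put [Q = x^m + P + lambda], [S = int_0^x sqrt Q], and write
[y = A Q^(-1/4) e^(-S) + B Q^(-1/4) e^(-S)] by variation of constants (the growing solution is
normalised by the decaying exponential).  The error density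
[Z = 5 Q'^2 / (16 Q^(5/2)) - Q'' / (4 Q^(3/2))] is [O((x + xi)^(-m/2-2))] with [xi = r^(1/m)],
uniformly in [a], so its integral is [O(xi^(-m/2-1)) = O(r^(-rho))].  Since [A -> e^L] and
[B -> 0] at infinity, [A 0 = e^L (1 + O(r^(-rho)))] and [B 0 = e^L O(r^(-rho))].  This applies to
the rotated solutions [f_{-1}] and [f_1], at [omega^(-2) lambda] and [omega^(-m) lambda], which stay
away from the negative axis, and gives [W_{-1,1}].  The function [f] is recovered from
[W_{-1,1} f = W_{0,1} f_{-1} + W_{-1,0} f_1], where [W_{0,1} = 2 omega^(mu(a))] is read off the
asymptotics on the ray [arg z = PI / (m + 2)]. *)

(** The sector contains the negative axis, where [x^m + lambda] vanishes at a positive [x]: a WKB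
    approximation of [f] itself on the positive axis would run into a turning point. This is why
    only the two rotated solutions are approximated directly. The constants [K] and [R0] in
    [is_sibuya] depend on [a] and [lam], so the hypothesis can do no more than identify the limits
    of the amplitudes at infinity. All uniformity comes from the differential system for [A] and
    [B], whose error density has an explicit majorant depending only on the bound [M], on the
    angular distance to the cut and on [r]. The amplitudes belong to a solution that already exists,
    so no integral equation has to be solved: an a priori bound closes on itself once the total
    error is at most 1/2. Differentiation is carried out along rays through 0, hence in one real
    variable, and all fractional powers of [Q] are exponentials of multiples of one principal
    logarithm, so that no choice of branch has to be followed. Relative errors [1 + h] are moved
    into the exponent by the same logarithm. *)

Ltac ringR := match goal with |- @eq _ ?a ?b => change (@eq R a b); ring end.

(** * Complex exponential and powers of omega *)

Lemma C_eq (z w : C) : Re z = Re w -> Im z = Im w -> z = w.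
Proof. destruct z, w; simpl; intros -> ->; reflexivity. Qed.

Lemma Im_le_Cmod (z : C) : Rabs (Im z) <= Cmod z.
Proof.
  eapply Rle_trans; [ | apply Rmax_Cmod ]. apply Rmax_r.
Qed.

Lemma Cmod_le_ReIm (z : C) : Cmod z <= Rabs (Re z) + Rabs (Im z).
Proof.
  replace z with (RtoC (Re z) + Ci * RtoC (Im z))%C at 1
    by (apply C_eq; simpl; ring).
  eapply Rle_trans; [ apply Cmod_triangle | ].
  rewrite Cmod_mult, Cmod_Ci, !Cmod_R. lra.
Qed.

Lemma Cmod_sqr (z : C) : Cmod z * Cmod z = Re z * Re z + Im z * Im z.
Proof. pose proof (Cmod2_alt z). simpl in H. lra. Qed.

Lemma Cmod_rev_triangle (z w : C) : Cmod z - Cmod w <= Cmod (z + w).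
Proof.
  pose proof (Cmod_triangle (z + w) (- w)) as H. rewrite Cmod_opp in H.
  replace (z + w + - w)%C with z in H by ring. lra.
Qed.

Lemma RtoC_neq0 (x : R) : x <> 0 -> RtoC x <> 0%C.
Proof. intros H E. apply H. apply (f_equal Re) in E. exact E. Qed.

Lemma exp_incr (x y : R) : x <= y -> exp x <= exp y.
Proof.
  intros [ H | -> ]; [ left; apply exp_increasing; exact H | apply Rle_refl ].
Qed.

Lemma Cexpo_plus (z w : C) : Cexpo (z + w) = (Cexpo z * Cexpo w)%C.
Proof.
  destruct z as [ a b ], w as [ c d ]. unfold Cexpo. apply C_eq; simpl;
    rewrite exp_plus, ?cos_plus, ?sin_plus; ring.
Qed.

Lemma Cexpo_R (x : R) : Cexpo (RtoC x) = RtoC (exp x).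
Proof. unfold Cexpo. apply C_eq; simpl; rewrite ?cos_0, ?sin_0; ring. Qed.

Lemma Cexpo_0 : Cexpo 0 = 1%C.
Proof. rewrite Cexpo_R, exp_0. reflexivity. Qed.

Lemma Cmod_Cexpo (z : C) : Cmod (Cexpo z) = exp (Re z).
Proof.
  assert (H : Cmod (Cexpo z) * Cmod (Cexpo z) = exp (Re z) * exp (Re z)).
  { rewrite Cmod_sqr. unfold Cexpo; simpl. pose proof (sin2_cos2 (Im z)) as H.
    unfold Rsqr in H. nra. }
  pose proof (Cmod_ge_0 (Cexpo z)). pose proof (exp_pos (Re z)). nra.
Qed.

Lemma Cexpo_neq0 (z : C) : Cexpo z <> 0%C.
Proof. apply Cmod_gt_0. rewrite Cmod_Cexpo. apply exp_pos. Qed.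

Lemma Cexpo_opp (z : C) : Cexpo (- z) = (/ Cexpo z)%C.
Proof.
  assert (H : (Cexpo (- z) * Cexpo z = 1)%C).
  { rewrite <- Cexpo_plus, <- Cexpo_0. f_equal. ring. }
  rewrite <- (Cmult_1_l (/ Cexpo z)), <- H. field. apply Cexpo_neq0.
Qed.

Lemma Cexpo_nat (n : nat) (z : C) : Cexpo (RtoC (INR n) * z) = Cpow (Cexpo z) n.
Proof.
  induction n as [ | n IH ].
  - simpl. rewrite <- Cexpo_0. f_equal. ring.
  - rewrite S_INR, RtoC_plus, Cpow_S, <- IH, <- Cexpo_plus. f_equal. ring.
Qed.

Lemma omega_pow_plus (m : nat) (s t : C) :
  omega_pow m (s + t) = (omega_pow m s * omega_pow m t)%C.
Proof. unfold omega_pow. rewrite <- Cexpo_plus. f_equal. ring. Qed.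

Lemma omega_pow_0 (m : nat) : omega_pow m 0 = 1%C.
Proof. unfold omega_pow. rewrite <- Cexpo_0. f_equal. ring. Qed.

Lemma Cmod_omega_pow (m : nat) (s : R) : Cmod (omega_pow m (RtoC s)) = 1.
Proof.
  unfold omega_pow. rewrite Cmod_Cexpo. simpl. rewrite <- exp_0. f_equal. ring.
Qed.

Lemma INR_plus2_pos (m : nat) : 0 < INR m + 2.
Proof. pose proof (pos_INR m). lra. Qed.

Lemma omega_pow_half_period (m : nat) : omega_pow m (RtoC ((INR m + 2) / 2)) = (- (1))%C.
Proof.
  pose proof (INR_plus2_pos m).
  unfold omega_pow.
  replace (Cmult (RtoC ((INR m + 2) / 2)) (0, 2 * PI / (INR m + 2))) with ((0, PI) : C)
    by (apply C_eq; simpl; field; lra).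
  unfold Cexpo. apply C_eq; simpl; rewrite exp_0, ?cos_PI, ?sin_PI; ring.
Qed.

Lemma omega_pow_period (m : nat) : omega_pow m (RtoC (INR m + 2)) = 1%C.
Proof.
  replace (RtoC (INR m + 2))
    with (RtoC ((INR m + 2) / 2) + RtoC ((INR m + 2) / 2))%C
    by (rewrite <- RtoC_plus; f_equal; field).
  rewrite omega_pow_plus, omega_pow_half_period. ring.
Qed.

Lemma omega_pow_nat (m n : nat) (s : R) :
  omega_pow m (RtoC (INR n * s)) = Cpow (omega_pow m (RtoC s)) n.
Proof.
  unfold omega_pow. rewrite <- Cexpo_nat. f_equal. rewrite RtoC_mult. ring.
Qed.

(** * The principal logarithm *)

Lemma Carg_Cexpo (w : C) : - PI < Im w < PI -> Carg (Cexpo w) = Im w.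
Proof.
  intros Hw. unfold Carg. rewrite Cmod_Cexpo. unfold Cexpo; simpl.
  pose proof (exp_pos (Re w)) as He.
  replace (exp (Re w) * cos (Im w) / exp (Re w)) with (cos (Im w)) by (field; lra).
  destruct (Rle_dec 0 (exp (Re w) * sin (Im w))) as [ Hs | Hs ].
  - apply acos_cos. destruct (Rle_lt_dec 0 (Im w)) as [ | Hn ]; [ lra | ].
    pose proof (sin_gt_0 (- Im w)). rewrite sin_neg in H. nra.
  - destruct (Rle_lt_dec 0 (Im w)) as [ Hp | Hn ].
    + exfalso. apply Hs. pose proof (sin_ge_0 (Im w)). nra.
    + rewrite <- cos_neg, acos_cos; lra.
Qed.

Lemma Clog_Cexpo (w : C) : - PI < Im w < PI -> Clog (Cexpo w) = w.
Proof.
  intros Hw. unfold Clog. rewrite Carg_Cexpo by assumption.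
  rewrite Cmod_Cexpo, ln_exp. destruct w; reflexivity.
Qed.

Lemma Cexpo_Clog (z : C) : z <> 0%C -> Cexpo (Clog z) = z.
Proof.
  intros Hz. apply Cmod_gt_0 in Hz. unfold Clog, Cexpo; simpl.
  rewrite exp_ln by assumption.
  pose proof (Cmod_sqr z) as Hs.
  assert (Hb : -1 <= Re z / Cmod z <= 1).
  { pose proof (re_le_Cmod z) as H. apply Rabs_le_between in H.
    split; [ apply Rle_div_r | apply Rle_div_l ]; lra. }
  assert (Hq : sqrt (1 - (Re z / Cmod z)²) = Rabs (Im z) / Cmod z).
  { replace (1 - (Re z / Cmod z)²) with ((Rabs (Im z) / Cmod z)²).
    - apply sqrt_Rsqr. apply Rdiv_le_0_compat; [ apply Rabs_pos | assumption ].
    - rewrite !Rsqr_div', <- Rsqr_abs. unfold Rsqr. field_simplify_eq; [ nra | lra ]. }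
  apply C_eq; simpl; unfold Carg; destruct (Rle_dec 0 (Im z)) as [ Hi | Hi ];
    rewrite ?cos_neg, ?sin_neg, ?cos_acos, ?sin_acos, ?Hq by assumption.
  - field; lra.
  - field; lra.
  - rewrite Rabs_pos_eq by assumption. field; lra.
  - rewrite Rabs_left by lra. field; lra.
Qed.

(** [|z| + Re z] vanishes exactly on the closed negative real axis. As a quantity it can be bounded
    below uniformly, and it is the denominator of the half-angle formula for the argument. *)
Definition offcut (z : C) : Prop := 0 < Cmod z + Re z.

Lemma offcut_neq0 (z : C) : offcut z -> z <> 0%C.
Proof. intros H ->. unfold offcut in H. rewrite Cmod_0 in H. simpl in H. lra. Qed.

(** The half-angle formula [tan (arg z / 2) = Im z / (|z| + Re z)]. Unlike the case distinction in
    [Carg] it is one smooth expression on the whole cut plane, which is what makes the logarithm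
    differentiable there. *)
Lemma Cexpo_log_atan (z : C) : offcut z ->
  Cexpo (ln (Cmod z), 2 * atan (Im z / (Cmod z + Re z))) = z.
Proof.
  intros H. pose proof (offcut_neq0 _ H) as Hz. apply Cmod_gt_0 in Hz.
  unfold offcut in H. pose proof (Cmod_sqr z) as Hs.
  unfold Cexpo; simpl. rewrite exp_ln by assumption.
  set (u := Im z / (Cmod z + Re z)).
  rewrite cos_2a, sin_2a.
  assert (Hc : cos (atan u) * cos (atan u) = / (1 + u * u)).
  { rewrite cos_atan. unfold Rsqr. pose proof (Rle_0_sqr u) as Hu. unfold Rsqr in Hu.
    assert (Hq : sqrt (1 + u * u) * sqrt (1 + u * u) = 1 + u * u) by (apply sqrt_sqrt; lra).
    rewrite <- Hq at 3. field.
    intros E. rewrite E in Hq. lra. }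
  assert (Hsn : sin (atan u) = u * cos (atan u)).
  { rewrite sin_atan, cos_atan. unfold Rdiv. ring. }
  rewrite Hsn.
  assert (Hd : 1 + u * u = 2 * Cmod z / (Cmod z + Re z)).
  { unfold u. field_simplify_eq; [ nra | lra ]. }
  apply C_eq; simpl.
  - transitivity (Cmod z * ((1 - u * u) * (cos (atan u) * cos (atan u)))); [ ring | ].
    rewrite Hc, Hd. unfold u. field_simplify_eq; [ nra | lra ].
  - transitivity (Cmod z * (2 * u * (cos (atan u) * cos (atan u)))); [ ring | ].
    rewrite Hc, Hd. unfold u. field. lra.
Qed.

Lemma Clog_atan (z : C) : offcut z ->
  Clog z = (ln (Cmod z), 2 * atan (Im z / (Cmod z + Re z))).
Proof.
  intros H. rewrite <- (Cexpo_log_atan z H) at 1. apply Clog_Cexpo. simpl.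
  pose proof (atan_bound (Im z / (Cmod z + Re z))). lra.
Qed.

Lemma Im_Clog_bound (z : C) : offcut z -> - PI < Im (Clog z) < PI.
Proof.
  intros H. rewrite Clog_atan by assumption. simpl.
  pose proof (atan_bound (Im z / (Cmod z + Re z))). lra.
Qed.

Lemma Rabs_atan_le (x : R) : Rabs (atan x) <= Rabs x.
Proof.
  assert (Hp : forall y, 0 <= y -> 0 <= atan y <= y).
  { intros y Hy. destruct (MVT_gen atan 0 y (fun t => / (1 + t ^ 2))) as [ c [ Hc E ] ].
    - intros t _. apply is_derive_Reals. apply derivable_pt_lim_atan.
    - intros t _. apply derivable_continuous_pt. apply derivable_pt_atan.
    - rewrite atan_0, !Rminus_0_r in E. rewrite E.
      pose proof (pow2_ge_0 c).
      assert (0 < / (1 + c ^ 2) <= 1).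
      { split; [ apply Rinv_0_lt_compat; lra | ].
        rewrite <- Rinv_1. apply Rinv_le_contravar; lra. }
      nra. }
  destruct (Rle_lt_dec 0 x) as [ H | H ].
  - pose proof (Hp x H). rewrite !Rabs_pos_eq; lra.
  - pose proof (Hp (- x)) as H1. rewrite atan_opp in H1.
    rewrite !Rabs_left1; lra.
Qed.

Lemma Rabs_ln_le (x : R) : 1 / 2 <= x -> Rabs (ln x) <= 2 * Rabs (x - 1).
Proof.
  intros H.
  assert (Hu : ln x <= x - 1).
  { rewrite <- (ln_exp (x - 1)). apply ln_le; [ lra | ].
    pose proof (exp_ineq1_le (x - 1)). lra. }
  assert (Hl : 1 - / x <= ln x).
  { assert (ln (/ x) <= / x - 1).
    { rewrite <- (ln_exp (/ x - 1)). apply ln_le; [ apply Rinv_0_lt_compat; lra | ].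
      pose proof (exp_ineq1_le (/ x - 1)). lra. }
    rewrite ln_Rinv in H0 by lra. lra. }
  assert (Hi : 1 - / x = (x - 1) * / x) by (field; lra).
  assert (0 < / x <= 2).
  { split; [ apply Rinv_0_lt_compat; lra | ].
    replace 2 with (/ (1 / 2)) by field. apply Rinv_le_contravar; lra. }
  unfold Rabs; destruct (Rcase_abs (ln x)); destruct (Rcase_abs (x - 1)); nra.
Qed.

(** Turns a relative error into an error inside an exponential. The constant is 2 + 2: twice [|h|]
    for the logarithm of the modulus, which is at least 1/2, and twice [|h|] for the argument, since
    the denominator of the half-angle formula is at least 1. *)
Lemma Clog_1_plus (h : C) : Cmod h <= 1 / 2 ->
  offcut (1 + h) /\ Cexpo (Clog (1 + h)) = (1 + h)%C /\ Cmod (Clog (1 + h)) <= 4 * Cmod h.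
Proof.
  intros H.
  pose proof (re_le_Cmod h) as Hr. pose proof (Im_le_Cmod h) as Hi.
  apply Rabs_le_between in Hr.
  assert (Hl : 1 - Cmod h <= Cmod (1 + h)).
  { pose proof (Cmod_rev_triangle 1 h). rewrite Cmod_1 in H0. lra. }
  assert (Hu : Cmod (1 + h) <= 1 + Cmod h).
  { pose proof (Cmod_triangle 1 h). rewrite Cmod_1 in H0. lra. }
  assert (Hre : Re (1 + h) = 1 + Re h) by reflexivity.
  assert (Him : Im (1 + h) = Im h) by (destruct h; simpl; ring).
  assert (Hc : offcut (1 + h)) by (unfold offcut; rewrite Hre; lra).
  split; [ exact Hc | split; [ apply Cexpo_Clog, offcut_neq0, Hc | ] ].
  rewrite Clog_atan by exact Hc.
  eapply Rle_trans; [ apply Cmod_le_ReIm | ].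
  assert (Rabs (ln (Cmod (1 + h))) <= 2 * Cmod h).
  { eapply Rle_trans; [ apply Rabs_ln_le; lra | ].
    apply Rmult_le_compat_l; [ lra | apply Rabs_le; lra ]. }
  assert (Rabs (2 * atan (Im (1 + h) / (Cmod (1 + h) + Re (1 + h)))) <= 2 * Cmod h).
  { rewrite Rabs_mult, (Rabs_pos_eq 2) by lra.
    apply Rmult_le_compat_l; [ lra | ].
    eapply Rle_trans; [ apply Rabs_atan_le | ].
    rewrite Him, Hre, Rabs_div by lra.
    rewrite (Rabs_pos_eq (_ + _)) by lra.
    apply Rle_div_l; [ lra | ]. pose proof (Cmod_ge_0 h). nra. }
  apply Rle_trans with (2 * Cmod h + 2 * Cmod h); [ | lra ].
  apply Rplus_le_compat; assumption.
Qed.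

(** * Calculus for complex functions of a real variable *)

Definition Cder (g : R -> C) (x : R) (l : C) : Prop :=
  is_derive (fun t => Re (g t)) x (Re l) /\ is_derive (fun t => Im (g t)) x (Im l).

Lemma Cder_eq (g : R -> C) (x : R) (l l' : C) : Cder g x l -> l = l' -> Cder g x l'.
Proof. intros H <-. exact H. Qed.

Lemma Cder_ext_loc (g h : R -> C) (x : R) (l : C) :
  locally x (fun t => g t = h t) -> Cder g x l -> Cder h x l.
Proof.
  intros E [ H1 H2 ]; split; (eapply is_derive_ext_loc; [ | eassumption ]);
    revert E; apply filter_imp; intros t ->; reflexivity.
Qed.

Lemma Cder_ext (g h : R -> C) (x : R) (l : C) :
  (forall t, g t = h t) -> Cder g x l -> Cder h x l.
Proof. intros E. apply Cder_ext_loc. apply filter_forall. exact E. Qed.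

Lemma Cder_const (c : C) (x : R) : Cder (fun _ => c) x 0.
Proof. split; apply @is_derive_const. Qed.

Lemma Cder_RtoC (u : R -> R) (x l : R) : is_derive u x l -> Cder (fun t => RtoC (u t)) x (RtoC l).
Proof. intros H; split; simpl; [ exact H | apply @is_derive_const ]. Qed.

Lemma Cder_plus (g h : R -> C) (x : R) (l k : C) :
  Cder g x l -> Cder h x k -> Cder (fun t => g t + h t)%C x (l + k)%C.
Proof. intros [ H1 H2 ] [ H3 H4 ]; split; simpl; apply @is_derive_plus; assumption. Qed.

Lemma Cder_mult (g h : R -> C) (x : R) (l k : C) :
  Cder g x l -> Cder h x k -> Cder (fun t => g t * h t)%C x (l * h x + g x * k)%C.
Proof.
  intros [ H1 H2 ] [ H3 H4 ]; split; simpl.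
  - eapply is_derive_ext; [ intros; reflexivity | ].
    eapply (eq_ind _ (fun v => is_derive _ x v)).
    + apply @is_derive_minus; apply @is_derive_mult; try eassumption; intros; apply Rmult_comm.
    + unfold minus, plus, opp, mult; simpl. unfold Re, Im. ring.
  - eapply (eq_ind _ (fun v => is_derive _ x v)).
    + apply @is_derive_plus; apply @is_derive_mult; try eassumption; intros; apply Rmult_comm.
    + unfold minus, plus, opp, mult; simpl. unfold Re, Im. ring.
Qed.

Lemma Cder_scal (c : C) (g : R -> C) (x : R) (l : C) :
  Cder g x l -> Cder (fun t => c * g t)%C x (c * l)%C.
Proof.
  intros H. eapply Cder_eq; [ apply Cder_mult; [ apply Cder_const | exact H ] | ].
  cbv beta. ring.
Qed.

Lemma Cder_opp (g : R -> C) (x : R) (l : C) : Cder g x l -> Cder (fun t => - g t)%C x (- l)%C.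
Proof. intros [ H1 H2 ]; split; simpl; apply @is_derive_opp; assumption. Qed.

Lemma Cder_minus (g h : R -> C) (x : R) (l k : C) :
  Cder g x l -> Cder h x k -> Cder (fun t => g t - h t)%C x (l - k)%C.
Proof. intros H1 H2. apply Cder_plus; [ exact H1 | apply Cder_opp, H2 ]. Qed.

Lemma Cder_Cexpo (g : R -> C) (x : R) (l : C) :
  Cder g x l -> Cder (fun t => Cexpo (g t)) x (l * Cexpo (g x))%C.
Proof.
  intros [ H1 H2 ]. unfold Cexpo. split; simpl.
  - eapply (eq_ind _ (fun v => is_derive _ x v)).
    + apply @is_derive_mult; [ | | intros; apply Rmult_comm ].
      * apply (is_derive_comp exp); [ apply is_derive_exp | exact H1 ].
      * apply (is_derive_comp cos); [ apply is_derive_cos | exact H2 ].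
    + unfold scal, mult, plus; simpl. unfold mult; simpl. unfold Re, Im. ring.
  - eapply (eq_ind _ (fun v => is_derive _ x v)).
    + apply @is_derive_mult; [ | | intros; apply Rmult_comm ].
      * apply (is_derive_comp exp); [ apply is_derive_exp | exact H1 ].
      * apply (is_derive_comp sin); [ apply is_derive_sin | exact H2 ].
    + unfold scal, mult, plus; simpl. unfold mult; simpl. unfold Re, Im. ring.
Qed.

Lemma Cder_continuous_Re (g : R -> C) (x : R) (l : C) :
  Cder g x l -> continuous (fun t => Re (g t)) x.
Proof. intros [ H _ ]. apply (ex_derive_continuous (V := R_NormedModule)). eexists; exact H. Qed.

Lemma Cder_continuous_Im (g : R -> C) (x : R) (l : C) :
  Cder g x l -> continuous (fun t => Im (g t)) x.
Proof. intros [ _ H ]. apply (ex_derive_continuous (V := R_NormedModule)). eexists; exact H. Qed.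

Lemma Cmod_sqrt (z : C) : Cmod z = sqrt (Re z * Re z + Im z * Im z).
Proof. unfold Cmod. f_equal. unfold Re, Im. ring. Qed.

Lemma is_derive_norm2 (p q : R -> R) (x lp lq : R) :
  is_derive p x lp -> is_derive q x lq -> 0 < p x * p x + q x * q x ->
  is_derive (fun t => sqrt (p t * p t + q t * q t)) x
    ((p x * lp + q x * lq) / sqrt (p x * p x + q x * q x)).
Proof.
  intros H1 H2 H. auto_derive.
  - repeat split; try (eexists; eassumption); assumption.
  - replace (Derive (fun t => p t) x) with lp by (symmetry; apply is_derive_unique, H1).
    replace (Derive (fun t => q t) x) with lq by (symmetry; apply is_derive_unique, H2).
    field. intros E. apply sqrt_eq_0 in E; lra.
Qed.

(** The derivative of the argument is [Im (g' / g)], with [p], [q], [s] in the roles of real part,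
    imaginary part and modulus. Keeping [s] abstract leaves a rational identity modulo
    [s^2 = p^2 + q^2], so no square root is handled. *)
Lemma is_derive_half_angle (p q s : R -> R) (x lp lq : R) :
  is_derive p x lp -> is_derive q x lq ->
  is_derive s x ((p x * lp + q x * lq) / s x) ->
  0 < s x -> 0 < s x + p x -> s x * s x = p x * p x + q x * q x ->
  is_derive (fun t => 2 * atan (q t / (s t + p t))) x ((p x * lq - q x * lp) / (s x * s x)).
Proof.
  intros H1 H2 H3 Hs Hc Hq. auto_derive.
  - repeat split; try (eexists; eassumption). lra.
  - replace (Derive (fun t => p t) x) with lp by (symmetry; apply is_derive_unique, H1).
    replace (Derive (fun t => q t) x) with lq by (symmetry; apply is_derive_unique, H2).
    replace (Derive (fun t => s t) x) with ((p x * lp + q x * lq) / s x)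
      by (symmetry; apply is_derive_unique, H3).
    set (S := s x) in *. set (P := p x) in *. set (Q := q x) in *.
    assert (Hn : 0 < (S + P) * (S + P) + Q * Q) by nra.
    field_simplify_eq; [ | repeat split; lra ].
    assert (E : Q ^ 2 = S ^ 2 - P ^ 2) by nra.
    ring_simplify. rewrite ?E.
    replace (Q ^ 3) with (Q * Q ^ 2) by ring. rewrite ?E. ring.
Qed.

Lemma Cder_Clog (g : R -> C) (x : R) (l : C) :
  Cder g x l -> offcut (g x) -> Cder (fun t => Clog (g t)) x (l / g x)%C.
Proof.
  intros H Hc. pose proof (offcut_neq0 _ Hc) as Hz. apply Cmod_gt_0 in Hz.
  pose proof (Cder_continuous_Re _ _ _ H) as C1.
  pose proof (Cder_continuous_Im _ _ _ H) as C2.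
  destruct H as [ H1 H2 ].
  assert (D : is_derive (fun t => Cmod (g t)) x
                ((Re (g x) * Re l + Im (g x) * Im l) / Cmod (g x))).
  { eapply is_derive_ext; [ intros t; symmetry; apply Cmod_sqrt | ].
    rewrite Cmod_sqrt. apply is_derive_norm2; try assumption.
    rewrite <- Cmod_sqr; nra. }
  (* The cut plane is open, so near [x] the logarithm may be replaced by its arctangent form. *)
  assert (L : locally x (fun t => offcut (g t))).
  { assert (Cn : continuous (fun t => Cmod (g t) + Re (g t)) x).
    { apply @continuous_plus; [ | exact C1 ].
      apply (ex_derive_continuous (V := R_NormedModule)). eexists; exact D. }
    apply (Cn (fun v => 0 < v)). apply open_gt. exact Hc. }
  apply Cder_ext_loc with
    (g := fun t => (ln (Cmod (g t)), 2 * atan (Im (g t) / (Cmod (g t) + Re (g t)))) : C).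
  { revert L. apply filter_imp. intros t Ht. symmetry. apply Clog_atan, Ht. }
  unfold offcut in Hc.
  pose proof (Cmod_sqr (g x)) as Hs.
  assert (Hn : Re (g x) * Re (g x) + Im (g x) * Im (g x) <> 0) by nra.
  split.
  - change (is_derive (fun t => ln (Cmod (g t))) x (Re (l / g x))).
    eapply (eq_ind _ (fun v => is_derive _ x v)).
    + apply (is_derive_comp ln (fun t => Cmod (g t))); [ | exact D ].
      apply is_derive_Reals, derivable_pt_lim_ln, Hz.
    + unfold Cdiv, Cinv, scal; simpl. unfold mult; simpl.
      fold (Re (g x)) (Im (g x)) (Re l) (Im l).
      rewrite !Rmult_1_r, <- Hs. field. lra.
  - change (is_derive (fun t => 2 * atan (Im (g t) / (Cmod (g t) + Re (g t)))) x (Im (l / g x))).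
    eapply (eq_ind _ (fun v => is_derive _ x v)).
    + apply is_derive_half_angle; eassumption.
    + unfold Cdiv, Cinv; simpl. fold (Re (g x)) (Im (g x)) (Re l) (Im l).
      rewrite !Rmult_1_r, <- Hs. field. lra.
Qed.

Lemma Cder_mean_value (g g' : R -> C) (h h' : R -> R) (x y : R) : x <= y ->
  (forall t, x <= t <= y -> Cder g t (g' t)) ->
  (forall t, x <= t <= y -> is_derive h t (h' t)) ->
  (forall t, x <= t <= y -> Cmod (g' t) <= - h' t) ->
  Cmod (g y - g x) <= h x - h y.
Proof.
  intros Hxy Hg Hh Hb.
  set (w := (g y - g x)%C).
  destruct (Req_dec (Cmod w) 0) as [ E | E ].
  - rewrite E.
    destruct (MVT_gen h x y h') as [ c [ Hc Ec ] ].
    + rewrite Rmin_left, Rmax_right by lra. intros t Ht. apply Hh; lra.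
    + rewrite Rmin_left, Rmax_right by lra. intros t Ht.
      apply derivable_continuous_pt. exists (h' t). apply is_derive_Reals, Hh; lra.
    + rewrite Rmin_left, Rmax_right in Hc by lra.
      pose proof (Hb c Hc). pose proof (Cmod_ge_0 (g' c)). nra.
  - pose proof (Cmod_ge_0 w) as Hw0. assert (Hw : 0 < Cmod w) by lra.
    set (u := fun t => (Re w * Re (g t) + Im w * Im (g t)) / Cmod w + h t).
    assert (Du : forall t, x <= t <= y ->
              is_derive u t ((Re w * Re (g' t) + Im w * Im (g' t)) / Cmod w + h' t)).
    { intros t Ht. destruct (Hg t Ht) as [ D1 D2 ]. pose proof (Hh t Ht) as D3.
      unfold u. apply @is_derive_plus; [ | exact D3 ].
      unfold Rdiv.
      apply (is_derive_ext (fun t => / Cmod w * (Re w * Re (g t) + Im w * Im (g t))));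
        [ intros; ringR | ].
      rewrite Rmult_comm. apply is_derive_scal.
      apply @is_derive_plus; apply is_derive_scal; assumption. }
    destruct (MVT_gen u x y (fun t => (Re w * Re (g' t) + Im w * Im (g' t)) / Cmod w + h' t))
      as [ c [ Hc Ec ] ].
    + rewrite Rmin_left, Rmax_right by lra. intros t Ht. apply Du; lra.
    + rewrite Rmin_left, Rmax_right by lra. intros t Ht.
      apply derivable_continuous_pt. eexists. apply is_derive_Reals, Du; lra.
    + rewrite Rmin_left, Rmax_right in Hc by lra.
      assert (Hle : (Re w * Re (g' c) + Im w * Im (g' c)) / Cmod w <= Cmod (g' c)).
      { apply Rle_div_l; [ exact Hw | ].
        replace (Re w * Re (g' c) + Im w * Im (g' c)) with (Re (Cconj w * g' c))
          by (simpl; unfold Re, Im; ring).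
        eapply Rle_trans; [ apply Rle_abs | ].
        eapply Rle_trans; [ apply re_le_Cmod | ].
        rewrite Cmod_mult, Cmod_conj. lra. }
      pose proof (Hb c Hc).
      assert (Hd : u y - u x <= 0) by (rewrite Ec; nra).
      assert (Eu : u y - u x = Cmod w + h y - h x).
      { assert (Hk : Re w * (Re (g y) - Re (g x)) + Im w * (Im (g y) - Im (g x)) = Cmod w * Cmod w).
        { rewrite Cmod_sqr. unfold w, Cminus, Cplus, Copp, Re, Im; simpl; ring. }
        unfold u. field_simplify_eq; [ nra | exact E ]. }
      lra.
Qed.

Lemma Cder_Cexpo_ray (z : C) (t : R) : Cder (fun t => Cexpo (RtoC t * z)) t (z * Cexpo (RtoC t * z))%C.
Proof.
  eapply Cder_eq.
  - apply Cder_Cexpo. apply Cder_mult; [ apply Cder_RtoC, @is_derive_id | apply Cder_const ].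
  - simpl. change (RtoC one) with (RtoC 1). ring.
Qed.

Lemma Cexpo_sub1_le (z : C) : Cmod z <= 1 -> Cmod (Cexpo z - 1) <= 3 * Cmod z.
Proof.
  intros Hz.
  assert (H : Cmod (Cexpo (RtoC 1 * z) - Cexpo (RtoC 0 * z))
              <= - (3 * Cmod z) * 0 - - (3 * Cmod z) * 1).
  { apply (Cder_mean_value (fun t => Cexpo (RtoC t * z)) (fun t => (z * Cexpo (RtoC t * z))%C)
        (fun t => - (3 * Cmod z) * t) (fun _ => - (3 * Cmod z))); [ lra | | | ].
    - intros t _. apply Cder_Cexpo_ray.
    - intros t _. auto_derive; [ exact I | cbv beta; ring ].
    - intros t Ht. rewrite Cmod_mult, Cmod_Cexpo.
      assert (He : exp (Re (RtoC t * z)) <= 3).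
      { eapply Rle_trans; [ | apply exp_le_3 ].
        apply exp_incr.
        eapply Rle_trans; [ apply Rle_abs | ].
        eapply Rle_trans; [ apply re_le_Cmod | ].
        rewrite Cmod_mult, Cmod_R, Rabs_pos_eq by lra. pose proof (Cmod_ge_0 z). nra. }
      pose proof (Cmod_ge_0 z). nra. }
  replace (RtoC 1 * z)%C with z in H by ring.
  replace (RtoC 0 * z)%C with (RtoC 0) in H by ring.
  rewrite Cexpo_0 in H. lra.
Qed.

Lemma is_derive_of_bound (p : R -> R) (x l : R) :
  (forall eps : posreal, locally x (fun y => Rabs (p y - p x - (y - x) * l) <= eps * Rabs (y - x))) ->
  is_derive p x l.
Proof.
  intros H. split; [ apply is_linear_scal_l | ].
  intros y Hy eps.
  assert (E : y = x) by (symmetry; apply is_filter_lim_locally_unique; exact Hy). subst y.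
  apply H.
Qed.

(** The only passage from complex differentiability to real derivatives: restriction to a ray
    through 0. *)
Lemma is_derive_C_ray (g : C -> C) (u l : C) (t : R) :
  is_derive (K := C_AbsRing) (V := C_NormedModule) g (RtoC t * u)%C l ->
  Cder (fun s => g (RtoC s * u)%C) t (u * l)%C.
Proof.
  intros [ _ H ].
  specialize (H (RtoC t * u)%C (fun P HP => HP)).
  assert (B : forall eps : posreal, locally t (fun s =>
     Cmod (g (RtoC s * u)%C - g (RtoC t * u)%C - RtoC (s - t) * (u * l)) <= eps * Rabs (s - t))).
  { intros eps.
    (* Dividing by [Cmod u + 1] instead of [Cmod u] keeps the quotients meaningful for [u = 0]. *)
    assert (He : 0 < eps / (Cmod u + 1)).
    { apply Rdiv_lt_0_compat; [ apply cond_pos | pose proof (Cmod_ge_0 u); lra ]. }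
    specialize (H (mkposreal _ He)). simpl in H.
    destruct H as [ d Hd ].
    assert (Hd' : 0 < d / (Cmod u + 1)).
    { apply Rdiv_lt_0_compat; [ apply cond_pos | pose proof (Cmod_ge_0 u); lra ]. }
    exists (mkposreal _ Hd'). intros s Hs.
    unfold ball in Hs; simpl in Hs; unfold AbsRing_ball, abs, minus, plus, opp in Hs; simpl in Hs.
    assert (Hs' : Rabs (s - t) * (Cmod u + 1) < d).
    { apply Rlt_div_r; [ pose proof (Cmod_ge_0 u); lra | exact Hs ]. }
    assert (Es : Cmod ((RtoC s * u) - (RtoC t * u)) = Rabs (s - t) * Cmod u).
    { replace ((RtoC s * u) - (RtoC t * u))%C with (RtoC (s - t) * u)%C
        by (rewrite RtoC_minus; ring).
      rewrite Cmod_mult, Cmod_R. reflexivity. }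
    pose proof (Cmod_ge_0 u) as Hu. pose proof (Rabs_pos (s - t)) as Ha.
    assert (Hb : Cmod (g (RtoC s * u)%C - g (RtoC t * u)%C - (RtoC s * u - RtoC t * u) * l)
              <= eps / (Cmod u + 1) * Cmod ((RtoC s * u) - (RtoC t * u))).
    { apply (Hd (RtoC s * u)%C).
      change (Cmod ((RtoC s * u) - (RtoC t * u)) < d). rewrite Es. nra. }
    rewrite Es in Hb.
    replace (RtoC (s - t) * (u * l))%C with ((RtoC s * u - RtoC t * u) * l)%C
      by (rewrite RtoC_minus; ring).
    eapply Rle_trans; [ exact Hb | ].
    apply Rle_trans with (eps / (Cmod u + 1) * (Rabs (s - t) * (Cmod u + 1))).
    - apply Rmult_le_compat_l; nra.
    - right. field. lra. }
  split; apply is_derive_of_bound; intros eps; generalize (B eps); apply filter_imp;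
    intros s Hs; (eapply Rle_trans; [ | exact Hs ]).
  - eapply Rle_trans; [ | apply re_le_Cmod ]. right. f_equal. simpl; unfold Re, Im; ring.
  - eapply Rle_trans; [ | apply Im_le_Cmod ]. right. f_equal. simpl; unfold Re, Im; ring.
Qed.

(** * The a priori bound for the amplitude system *)

Lemma is_derive_continuity_pt (p : R -> R) (x l : R) : is_derive p x l -> continuity_pt p x.
Proof. intros H. apply derivable_continuous_pt. exists l. apply is_derive_Reals, H. Qed.

Lemma Cder_bounded (g g' : R -> C) (X : R) : 0 <= X ->
  (forall x, 0 <= x -> Cder g x (g' x)) ->
  exists K, forall x, 0 <= x <= X -> Cmod (g x) <= K.
Proof.
  intros HX Hg.
  destruct (continuity_ab_maj (fun x => Rabs (Re (g x)) + Rabs (Im (g x))) 0 X HX) as [ M [ HM _ ] ].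
  - intros x Hx. destruct (Hg x) as [ H1 H2 ]; [ lra | ].
    apply (continuity_pt_plus (fun x => Rabs (Re (g x))) (fun x => Rabs (Im (g x))));
      apply (continuity_pt_comp _ Rabs);
      try apply Rcontinuity_abs; eapply is_derive_continuity_pt; eassumption.
  - eexists. intros x Hx. eapply Rle_trans; [ apply Cmod_le_ReIm | apply HM; exact Hx ].
Qed.

Lemma increasing_of_derive (p p' : R -> R) (x y : R) : x <= y ->
  (forall t, x <= t <= y -> is_derive p t (p' t)) ->
  (forall t, x <= t <= y -> 0 <= p' t) -> p x <= p y.
Proof.
  intros Hxy Hp Hp'.
  destruct (MVT_gen p x y p') as [ c [ Hc E ] ];
    rewrite ?Rmin_left, ?Rmax_right in * by lra.
  - intros t Ht. apply Hp; lra.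
  - intros t Ht. eapply is_derive_continuity_pt, Hp; lra.
  - pose proof (Hp' c Hc). nra.
Qed.

(** A bootstrap integrated from infinity. If [|A| + |B| <= K] on the half-line, integrating [A'] and
    [(e^(-2S) B)'] back from infinity bounds both [|A - c|] and [|B|] by [K/2 * H]. The factor
    [e^(-2S)] removes the large term [2 q B], and its modulus is nonincreasing because [Re q >= 0],
    so nothing grows. With [H <= 1/2] the supremum [s] of [|A| + |B|] satisfies [s <= |c| + s/2],
    hence [K = 2 |c|] is admissible. *)
Lemma amplitude_estimate (A B q Z S : R -> C) (H H' : R -> R) (c : C) :
  (forall x, 0 <= x -> Cder A x (RtoC (1/2) * Z x * (A x + B x))%C) ->
  (forall x, 0 <= x -> Cder B x (2 * q x * B x - RtoC (1/2) * Z x * (A x + B x))%C) ->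
  (forall x, 0 <= x -> Cder S x (q x)) ->
  (forall x, 0 <= x -> 0 <= Re (q x)) ->
  (forall x, 0 <= x -> is_derive H x (H' x)) ->
  (forall x, 0 <= x -> Cmod (Z x) <= - H' x) ->
  (forall x, 0 <= x -> 0 <= H x) ->
  H 0 <= 1 / 2 ->
  (forall eps, 0 < eps -> exists X, forall x, X <= x -> Cmod (A x - c) <= eps /\ Cmod (B x) <= eps) ->
  Cmod (A 0 - c) <= Cmod c * H 0 /\ Cmod (B 0) <= Cmod c * H 0.
Proof.
  intros HA HB HS Hq HH HZ HH0 Hh Hlim.
  assert (Hmon : forall x t, 0 <= x <= t -> Re (S x) <= Re (S t)).
  { intros x t Hxt. apply (increasing_of_derive (fun t => Re (S t)) (fun t => Re (q t))); [ lra | | ].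
    - intros s Hs. apply HS; lra.
    - intros s Hs. apply Hq; lra. }
  assert (Hdec : forall x t, 0 <= x <= t -> H t <= H x).
  { intros x t Hxt.
    apply Ropp_le_cancel.
    apply (increasing_of_derive (fun t => - H t) (fun t => - H' t)); [ lra | | ].
    - intros s Hs. apply @is_derive_opp, HH; lra.
    - intros s Hs. pose proof (HZ s). pose proof (Cmod_ge_0 (Z s)). lra. }
  assert (Hstep : forall K, (forall x, 0 <= x -> Cmod (A x) + Cmod (B x) <= K) ->
    forall x, 0 <= x -> Cmod (A x - c) <= K / 2 * H x /\ Cmod (B x) <= K / 2 * H x).
  { intros K HK x Hx.
    assert (K0 : 0 <= K).
    { pose proof (HK x Hx). pose proof (Cmod_ge_0 (A x)). pose proof (Cmod_ge_0 (B x)). lra. }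
    assert (HAB : forall t, 0 <= t ->
              Cmod (RtoC (1/2) * Z t * (A t + B t)) <= K / 2 * - H' t).
    { intros t Ht. rewrite !Cmod_mult, Cmod_R, Rabs_pos_eq by lra.
      pose proof (HK t Ht). pose proof (HZ t Ht). pose proof (Cmod_triangle (A t) (B t)).
      pose proof (Cmod_ge_0 (Z t)). pose proof (Cmod_ge_0 (A t + B t)).
      assert (Cmod (Z t) * Cmod (A t + B t) <= - H' t * K)
        by (apply Rmult_le_compat; lra). lra. }
    split; apply le_epsilon; intros eps Heps; destruct (Hlim eps Heps) as [ X HX ];
      set (T := Rmax x X); assert (HxT : x <= T) by apply Rmax_l;
      destruct (HX T (Rmax_r _ _)) as [ HAT HBT ]; pose proof (HH0 T ltac:(lra)) as HT0.
    - assert (HM : Cmod (A T - A x) <= K / 2 * H x - K / 2 * H T).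
      { apply (Cder_mean_value A (fun t => (RtoC (1/2) * Z t * (A t + B t))%C)
                 (fun t => K / 2 * H t) (fun t => K / 2 * H' t)); [ exact HxT | | | ].
        - intros t Ht. apply HA; lra.
        - intros t Ht. apply is_derive_scal, HH; lra.
        - intros t Ht. pose proof (HAB t ltac:(lra)). lra. }
      replace (A x - c)%C with ((A T - c) + - (A T - A x))%C by ring.
      eapply Rle_trans; [ apply Cmod_triangle | ]. rewrite Cmod_opp. nra.
    (* [E] is the modulus of the integrating factor at the left end [x], where it is largest on
       [[x, T]]; it cancels at the end. *)
    - set (E := exp (- 2 * Re (S x))). pose proof (exp_pos (- 2 * Re (S x))) as HE. fold E in HE.
      assert (HEt : forall t, x <= t -> Cmod (Cexpo (- (2) * S t)) <= E).
      { intros t Ht. rewrite Cmod_Cexpo. apply exp_incr.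
        replace (Re (- (2) * S t)) with (-2 * Re (S t)) by (simpl; unfold Re; ring).
        pose proof (Hmon x t ltac:(lra)). lra. }
      assert (HM : Cmod (Cexpo (- (2) * S T) * B T - Cexpo (- (2) * S x) * B x)
                   <= E * (K / 2) * H x - E * (K / 2) * H T).
      { apply (Cder_mean_value (fun t => Cexpo (- (2) * S t) * B t)%C
                 (fun t => Cexpo (- (2) * S t) * - (RtoC (1/2) * Z t * (A t + B t)))%C
                 (fun t => E * (K / 2) * H t) (fun t => E * (K / 2) * H' t)); [ exact HxT | | | ].
        - intros t Ht. eapply Cder_eq.
          + apply Cder_mult; [ apply Cder_Cexpo, Cder_scal, HS; lra | apply HB; lra ].
          + cbv beta. ring.
        - intros t Ht. apply is_derive_scal, HH; lra.
        - intros t Ht. rewrite Cmod_mult, Cmod_opp.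
          pose proof (HAB t ltac:(lra)). pose proof (HEt t ltac:(lra)).
          pose proof (Cmod_ge_0 (Cexpo (- (2) * S t))).
          pose proof (Cmod_ge_0 (RtoC (1/2) * Z t * (A t + B t))).
          apply Rle_trans with (E * (K / 2 * - H' t)); [ apply Rmult_le_compat; lra | lra ]. }
      assert (HT : Cmod (Cexpo (- (2) * S T) * B T) <= E * eps).
      { rewrite Cmod_mult. apply Rmult_le_compat; try apply Cmod_ge_0; [ apply HEt | ]; lra. }
      assert (Hx' : Cmod (Cexpo (- (2) * S x) * B x) = E * Cmod (B x)).
      { rewrite Cmod_mult, Cmod_Cexpo. unfold E. do 2 f_equal. simpl; unfold Re; ring. }
      assert (Hf : E * Cmod (B x) <= E * (K / 2 * H x + eps)).
      { rewrite <- Hx'.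
        replace (Cexpo (- (2) * S x) * B x)%C with
          (Cexpo (- (2) * S T) * B T + - (Cexpo (- (2) * S T) * B T - Cexpo (- (2) * S x) * B x))%C
          by ring.
        eapply Rle_trans; [ apply Cmod_triangle | ]. rewrite Cmod_opp.
        assert (0 <= E * (K / 2) * H T) by (apply Rmult_le_pos; [ nra | exact HT0 ]). lra. }
      apply Rmult_le_reg_l in Hf; [ exact Hf | exact HE ]. }
  (* The supremum must first be finite: compactness gives a bound up to [X], and the limits give one
     beyond it. *)
  assert (Hbd : exists K, forall x, 0 <= x -> Cmod (A x) + Cmod (B x) <= K).
  { destruct (Hlim 1 Rlt_0_1) as [ X HX ].
    destruct (Cder_bounded A _ (Rmax 0 X) (Rmax_l _ _) HA) as [ KA HKA ].
    destruct (Cder_bounded B _ (Rmax 0 X) (Rmax_l _ _) HB) as [ KB HKB ].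
    exists (Rmax (KA + KB) (Cmod c + 2)). intros x Hx.
    destruct (Rle_lt_dec x (Rmax 0 X)) as [ Hl | Hl ].
    - eapply Rle_trans; [ | apply Rmax_l ].
      pose proof (HKA x ltac:(lra)). pose proof (HKB x ltac:(lra)). lra.
    - eapply Rle_trans; [ | apply Rmax_r ].
      pose proof (Rmax_r 0 X). destruct (HX x ltac:(lra)) as [ H1 H2 ].
      pose proof (Cmod_triangle (A x - c) c) as H3.
      replace (A x - c + c)%C with (A x) in H3 by ring. lra. }
  assert (Hsup : forall x, 0 <= x -> Cmod (A x) + Cmod (B x) <= 2 * Cmod c).
  { destruct Hbd as [ K HK ].
    destruct (completeness (fun v => exists x, 0 <= x /\ v = Cmod (A x) + Cmod (B x))) as [ s [ Hs1 Hs2 ] ].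
    - exists K. intros v [ x [ Hx -> ] ]. apply HK, Hx.
    - exists (Cmod (A 0) + Cmod (B 0)), 0. split; [ lra | reflexivity ].
    - assert (Hb : forall x, 0 <= x -> Cmod (A x) + Cmod (B x) <= s).
      { intros x Hx. apply Hs1. exists x. split; [ exact Hx | reflexivity ]. }
      (* The supremum is itself an admissible [K], so the one-step bound applies to it. *)
      assert (Hs : s <= Cmod c + s / 2).
      { apply Hs2. intros v [ x [ Hx -> ] ].
        destruct (Hstep s Hb x Hx) as [ H1 H2 ].
        pose proof (Cmod_triangle (A x - c) c) as H3.
        replace (A x - c + c)%C with (A x) in H3 by ring.
        pose proof (Hb x Hx). pose proof (Cmod_ge_0 (A x)). pose proof (Cmod_ge_0 (B x)).
        pose proof (Hdec 0 x ltac:(lra)). nra. }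
      intros x Hx. pose proof (Hb x Hx). lra. }
  destruct (Hstep _ Hsup 0 (Rle_refl 0)) as [ H1 H2 ].
  replace (2 * Cmod c / 2) with (Cmod c) in H1, H2 by field. split; assumption.
Qed.

(** * Finite sums *)

Lemma Csum_app (l l' : list nat) (g : nat -> C) : Csum (l ++ l') g = (Csum l g + Csum l' g)%C.
Proof.
  unfold Csum. induction l as [ | i l IH ]; simpl; [ ring | rewrite IH; ring ].
Qed.

Lemma Csum_seq_S (s n : nat) (g : nat -> C) :
  Csum (seq s (S n)) g = (Csum (seq s n) g + g (s + n)%nat)%C.
Proof. rewrite seq_S, Csum_app. unfold Csum at 2; simpl. ring. Qed.

Lemma Csum_ext (l : list nat) (g h : nat -> C) :
  (forall i, In i l -> g i = h i) -> Csum l g = Csum l h.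
Proof.
  unfold Csum. induction l as [ | i l IH ]; intros H; simpl; [ reflexivity | ].
  rewrite H by (left; reflexivity). rewrite IH; [ reflexivity | ].
  intros j Hj. apply H. right; exact Hj.
Qed.

Lemma Csum_zero (l : list nat) (g : nat -> C) :
  (forall i, In i l -> g i = 0%C) -> Csum l g = 0%C.
Proof.
  intros H. rewrite (Csum_ext l g (fun _ => 0%C) H). unfold Csum.
  induction l as [ | i l IH ]; simpl; [ reflexivity | ].
  rewrite IH; [ ring | ]. intros j Hj. apply H. right; exact Hj.
Qed.

Lemma Csum_plus (l : list nat) (g h : nat -> C) :
  Csum l (fun i => g i + h i)%C = (Csum l g + Csum l h)%C.
Proof.
  unfold Csum. induction l as [ | i l IH ]; simpl; [ ring | rewrite IH; ring ].
Qed.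

Lemma Csum_scal (l : list nat) (c : C) (g : nat -> C) :
  Csum l (fun i => c * g i)%C = (c * Csum l g)%C.
Proof.
  unfold Csum. induction l as [ | i l IH ]; simpl; [ ring | rewrite IH; ring ].
Qed.

Lemma Csum_scal_r (l : list nat) (c : C) (g : nat -> C) :
  Csum l (fun i => g i * c)%C = (Csum l g * c)%C.
Proof.
  rewrite Cmult_comm, <- Csum_scal. apply Csum_ext. intros; ring.
Qed.

Lemma Csum_swap (l l' : list nat) (F : nat -> nat -> C) :
  Csum l (fun i => Csum l' (F i)) = Csum l' (fun j => Csum l (fun i => F i j)).
Proof.
  unfold Csum at 1. induction l as [ | i l IH ]; simpl.
  - symmetry. apply Csum_zero. reflexivity.
  - rewrite IH, <- Csum_plus. reflexivity.
Qed.

Lemma Csum_shift (n : nat) (g : nat -> C) :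
  Csum (seq 1 n) g = Csum (seq 0 n) (fun i => g (S i)).
Proof. unfold Csum. rewrite <- seq_shift, map_map. reflexivity. Qed.

Lemma Csum_seq_first (n : nat) (g : nat -> C) :
  Csum (seq 0 (S n)) g = (g 0%nat + Csum (seq 1 n) g)%C.
Proof. reflexivity. Qed.

Lemma Csum_rev (n : nat) (g : nat -> C) :
  Csum (seq 0 n) g = Csum (seq 0 n) (fun i => g (n - 1 - i)%nat).
Proof.
  revert g. induction n as [ | n IH ]; intros g; [ reflexivity | ].
  rewrite Csum_seq_S, Csum_seq_first, Csum_shift, IH, Cplus_comm.
  f_equal; [ f_equal; simpl; lia | ].
  apply Csum_ext. intros i Hi. apply in_seq in Hi. f_equal. simpl. lia.
Qed.

Lemma Csum_split (k n : nat) (g : nat -> C) : (k <= n)%nat ->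
  Csum (seq 0 n) g = (Csum (seq 0 k) g + Csum (seq k (n - k)) g)%C.
Proof.
  intros H. rewrite <- Csum_app. replace n with (k + (n - k))%nat at 1 by lia.
  rewrite seq_app. reflexivity.
Qed.

Lemma Csum_extend (k n : nat) (g : nat -> C) : (k <= n)%nat ->
  (forall i, (k <= i)%nat -> g i = 0%C) -> Csum (seq 0 n) g = Csum (seq 0 k) g.
Proof.
  intros H Hg. rewrite (Csum_split k n) by exact H.
  rewrite (Csum_zero (seq k (n - k))); [ ring | ].
  intros i Hi. apply in_seq in Hi. apply Hg; lia.
Qed.

(** Both sides run over the pairs of indices with sum below [n]; this is the rearrangement behind
    the Cauchy products below. *)
Lemma Csum_triangle (n : nat) (F : nat -> nat -> C) :
  Csum (seq 0 n) (fun d => Csum (seq 0 (S d)) (fun e => F e (d - e)%nat))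
  = Csum (seq 0 n) (fun e => Csum (seq 0 (n - e)) (F e)).
Proof.
  induction n as [ | n IH ]; [ reflexivity | ].
  rewrite Csum_seq_S, IH, (Csum_seq_S 0 n (fun e => Csum (seq 0 (S n - e)) (F e))).
  rewrite Csum_seq_S. simpl (0 + n)%nat.
  replace (S n - n)%nat with 1%nat by lia. rewrite Nat.sub_diag.
  rewrite Cplus_assoc, <- Csum_plus.
  f_equal; [ | unfold Csum; simpl; ring ].
  apply Csum_ext. intros e He. apply in_seq in He.
  replace (S n - e)%nat with (S (n - e)) by lia. rewrite Csum_seq_S. reflexivity.
Qed.

Lemma Cmod_Csum_le (l : list nat) (g : nat -> C) (K : R) :
  (forall i, In i l -> Cmod (g i) <= K) -> Cmod (Csum l g) <= INR (length l) * K.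
Proof.
  unfold Csum. induction l as [ | i l IH ]; intros H.
  - simpl. rewrite Cmod_0. lra.
  - cbn [map fold_right length]. rewrite S_INR.
    eapply Rle_trans; [ apply Cmod_triangle | ].
    pose proof (H i (or_introl eq_refl)).
    pose proof (IH (fun j Hj => H j (or_intror Hj))). lra.
Qed.

(** * The square root of a power series *)

Lemma binom_half_step (k : nat) :
  INR (S k) * binom_half (S k) = (1 / 2 - INR k) * binom_half k.
Proof.
  cbn [binom_half]. field. apply not_0_INR. lia.
Qed.

(** The coefficient of [u^n] in the square of the binomial series of [(1 + u)^(1/2)]; the aim is
    that this square is [1 + u]. *)
Definition binom_half_conv (n : nat) : C :=
  Csum (seq 0 (S n)) (fun i => RtoC (binom_half i * binom_half (n - i))).

(** The reflection [i -> n - i] fixes the products, so the weights [i] and [n - i] give the same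
    sum, and together they give the weight [n]. *)
Lemma binom_half_conv_weighted (n : nat) :
  (2 * Csum (seq 0 (S n)) (fun i => RtoC (INR i * (binom_half i * binom_half (n - i))))
   = RtoC (INR n) * binom_half_conv n)%C.
Proof.
  set (W := Csum _ _).
  assert (E : W = Csum (seq 0 (S n)) (fun i => RtoC (INR (n - i) * (binom_half i * binom_half (n - i))))).
  { unfold W. rewrite Csum_rev. apply Csum_ext. intros i Hi. apply in_seq in Hi.
    replace (S n - 1 - i)%nat with (n - i)%nat by lia.
    replace (n - (n - i))%nat with i by lia. f_equal. ring. }
  replace (2 * W)%C with (W + W)%C by ring. rewrite E at 2.
  unfold W, binom_half_conv. rewrite <- Csum_plus, <- Csum_scal.
  apply Csum_ext. intros i Hi. apply in_seq in Hi.
  rewrite <- RtoC_plus, <- RtoC_mult. f_equal. rewrite minus_INR by lia. ring.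
Qed.

(* The identity (1 + u) s'(u) = s(u) / 2 for s = sqrt (1 + u), read on the coefficients of s^2. *)
Lemma binom_half_conv_step (n : nat) :
  (RtoC (INR (S n)) * binom_half_conv (S n) = RtoC (1 - INR n) * binom_half_conv n)%C.
Proof.
  rewrite <- binom_half_conv_weighted, Csum_seq_first, Csum_shift.
  rewrite (Csum_ext _ _ (fun i => RtoC (1/2) * RtoC (binom_half i * binom_half (n - i))
     + RtoC (-1) * RtoC (INR i * (binom_half i * binom_half (n - i))))%C).
  - rewrite Csum_plus, !Csum_scal.
    pose proof (binom_half_conv_weighted n) as H.
    fold (binom_half_conv n).
    set (W := Csum _ _) in *.
    replace (2 * (RtoC (INR 0 * (binom_half 0 * binom_half (S n - 0)))
              + (RtoC (1/2) * binom_half_conv n + RtoC (-1) * W)))%C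
      with (RtoC 2 * RtoC (1/2) * binom_half_conv n - 2 * W)%C
      by (simpl INR; rewrite Rmult_0_l; ring).
    rewrite H, <- RtoC_mult, RtoC_minus.
    replace (2 * (1 / 2)) with 1 by field. ring.
  - intros i Hi. apply in_seq in Hi.
    replace (S n - S i)%nat with (n - i)%nat by lia.
    rewrite <- !RtoC_mult, <- RtoC_plus. f_equal.
    rewrite <- Rmult_assoc, binom_half_step. field.
Qed.

(** The recursion carries the factor [1 - n]: it yields 1 at index 1, and its zero at [n = 1] kills
    index 2 and with it all later ones. *)
Lemma binom_half_conv_eq (n : nat) :
  binom_half_conv n = if Nat.leb n 1 then 1%C else 0%C.
Proof.
  assert (H0 : binom_half_conv 0 = 1%C).
  { unfold binom_half_conv, Csum; simpl. rewrite Rmult_1_r. ring. }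
  assert (H1 : binom_half_conv 1 = 1%C).
  { pose proof (binom_half_conv_step 0) as H. rewrite H0 in H. simpl INR in H.
    rewrite Rminus_0_r in H. rewrite !Cmult_1_l in H. exact H. }
  destruct n as [ | [ | n ] ]; [ exact H0 | exact H1 | ]. simpl.
  induction n as [ | n IH ].
  - pose proof (binom_half_conv_step 1) as H. rewrite H1 in H.
    replace (1 - INR 1) with 0 in H by (simpl; ring).
    assert (Hn : RtoC (INR 2) <> 0%C) by (apply RtoC_neq0, not_0_INR; lia).
    rewrite Cmult_0_l in H.
    destruct (Ceq_dec (binom_half_conv 2) 0) as [ E | E ]; [ exact E | ].
    exfalso. exact (Cmult_neq_0 _ _ Hn E H).
  - pose proof (binom_half_conv_step (S (S n))) as H. rewrite IH, Cmult_0_r in H.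
    assert (Hn : RtoC (INR (S (S (S n)))) <> 0%C) by (apply RtoC_neq0, not_0_INR; lia).
    destruct (Ceq_dec (binom_half_conv (S (S (S n)))) 0) as [ E | E ]; [ exact E | ].
    exfalso. exact (Cmult_neq_0 _ _ Hn E H).
Qed.

(** The variable is [t = 1/x], which turns expansions at infinity into orders of vanishing at 0.
    Bounding on all of [(0, 1]], not merely near 0, lets orders be lowered and multiplied without
    shrinking the interval. *)
Definition isO (n : nat) (f : R -> C) : Prop :=
  exists K, 0 <= K /\ forall t, 0 < t <= 1 -> Cmod (f t) <= K * t ^ n.

Lemma isO_ext (n : nat) (f g : R -> C) :
  (forall t, 0 < t <= 1 -> f t = g t) -> isO n f -> isO n g.
Proof.
  intros E [ K [ HK H ] ]. exists K. split; [ exact HK | ].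
  intros t Ht. rewrite <- E by exact Ht. apply H, Ht.
Qed.

Lemma pow_le_1_antitone (t : R) (k n : nat) : 0 < t <= 1 -> (k <= n)%nat -> t ^ n <= t ^ k.
Proof.
  intros Ht Hk. replace n with (k + (n - k))%nat by lia. rewrite pow_add.
  assert (0 < t ^ k) by (apply pow_lt; lra).
  assert (t ^ (n - k) <= 1) by (rewrite <- (pow1 (n - k)); apply pow_incr; lra).
  nra.
Qed.

Lemma isO_weaken (k n : nat) (f : R -> C) : (k <= n)%nat -> isO n f -> isO k f.
Proof.
  intros Hk [ K [ HK H ] ]. exists K. split; [ exact HK | ].
  intros t Ht. eapply Rle_trans; [ apply H, Ht | ].
  apply Rmult_le_compat_l; [ exact HK | apply pow_le_1_antitone; assumption ].
Qed.

Lemma isO_const (c : C) : isO 0 (fun _ => c).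
Proof. exists (Cmod c). split; [ apply Cmod_ge_0 | intros; simpl; lra ]. Qed.

Lemma isO_pow (n : nat) : isO n (fun t => Cpow (RtoC t) n).
Proof.
  exists 1. split; [ lra | ]. intros t Ht. rewrite Cmod_pow, Cmod_R, Rabs_pos_eq; lra.
Qed.

Lemma isO_plus (n : nat) (f g : R -> C) : isO n f -> isO n g -> isO n (fun t => f t + g t)%C.
Proof.
  intros [ K [ HK H ] ] [ L [ HL H' ] ]. exists (K + L). split; [ lra | ].
  intros t Ht. eapply Rle_trans; [ apply Cmod_triangle | ].
  pose proof (H t Ht). pose proof (H' t Ht). lra.
Qed.

Lemma isO_mult (n k : nat) (f g : R -> C) :
  isO n f -> isO k g -> isO (n + k) (fun t => f t * g t)%C.
Proof.
  intros [ K [ HK H ] ] [ L [ HL H' ] ]. exists (K * L). split; [ nra | ].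
  intros t Ht. rewrite Cmod_mult, pow_add.
  replace (K * L * (t ^ n * t ^ k)) with ((K * t ^ n) * (L * t ^ k)) by ring.
  apply Rmult_le_compat; try apply Cmod_ge_0; [ apply H | apply H' ]; exact Ht.
Qed.

Lemma isO_scal (n : nat) (c : C) (f : R -> C) : isO n f -> isO n (fun t => c * f t)%C.
Proof. intros H. apply (isO_mult 0 n); [ apply isO_const | exact H ]. Qed.

Lemma isO_Csum (n : nat) (l : list nat) (f : nat -> R -> C) :
  (forall i, In i l -> isO n (f i)) -> isO n (fun t => Csum l (fun i => f i t)).
Proof.
  induction l as [ | i l IH ]; intros H.
  - exists 0. split; [ lra | ]. intros t Ht. unfold Csum; simpl. rewrite Cmod_0. lra.
  - apply (isO_plus n (f i) (fun t => Csum l (fun i => f i t))).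
    + apply H. left; reflexivity.
    + apply IH. intros j Hj. apply H. right; exact Hj.
Qed.

Lemma isO_Cpow (n : nat) (u : R -> C) : isO 1 u -> isO n (fun t => Cpow (u t) n).
Proof.
  intros H. induction n as [ | n IH ].
  - exact (isO_const 1).
  - exact (isO_mult 1 n _ _ H IH).
Qed.

(** The products of index sum below [n] add up to exactly [1 + u], both terms of which are present
    because [2 <= n]. What remains is the upper triangle of products of index sum at least [n]. *)
Lemma sqrt_series_square (n : nat) (u : R -> C) : isO 1 u -> (2 <= n)%nat ->
  isO n (fun t => Csum (seq 0 n) (fun k => RtoC (binom_half k) * Cpow (u t) k)
                  * Csum (seq 0 n) (fun k => RtoC (binom_half k) * Cpow (u t) k) - (1 + u t))%C.
Proof.
  intros Hu Hn.
  apply isO_ext with (f := fun t => Csum (seq 0 n) (fun e =>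
     RtoC (binom_half e) * (Cpow (u t) e * Csum (seq (n - e) e) (fun d => RtoC (binom_half d) * Cpow (u t) d)))%C).
  - intros t _. set (s := fun k => (RtoC (binom_half k) * Cpow (u t) k)%C).
    assert (E : Csum (seq 0 n) (fun d => binom_half_conv d * Cpow (u t) d)%C = (1 + u t)%C).
    { destruct n as [ | [ | n ] ]; [ lia | lia | ].
      rewrite Csum_seq_first. rewrite Csum_shift, Csum_seq_first, Csum_zero.
      - rewrite !binom_half_conv_eq. simpl. ring.
      - intros i Hi. apply in_seq in Hi. rewrite binom_half_conv_eq.
        destruct i; [ lia | ]. simpl. ring. }
    assert (E2 : Csum (seq 0 n) (fun d => binom_half_conv d * Cpow (u t) d)%C
                 = Csum (seq 0 n) (fun e => s e * Csum (seq 0 (n - e)) s)%C).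
    { transitivity (Csum (seq 0 n) (fun d => Csum (seq 0 (S d)) (fun e => s e * s (d - e)%nat)%C)).
      - apply Csum_ext. intros d _. unfold binom_half_conv. rewrite <- Csum_scal_r.
        apply Csum_ext. intros e He. apply in_seq in He. unfold s.
        assert (Eu : Cpow (u t) d = (Cpow (u t) e * Cpow (u t) (d - e))%C)
          by (rewrite <- Cpow_add_r; f_equal; lia).
        rewrite Eu, RtoC_mult. ring.
      - rewrite (Csum_triangle n (fun e d => s e * s d)%C).
        apply Csum_ext. intros e _. apply Csum_scal. }
    rewrite <- E, E2.
    transitivity (Csum (seq 0 n) (fun e => s e * Csum (seq 0 n) s + (- (1)) * (s e * Csum (seq 0 (n - e)) s))%C).
    + apply Csum_ext. intros e He. apply in_seq in He.
      rewrite (Csum_split (n - e) n s) by lia.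
      replace (n - (n - e))%nat with e by lia.
      change (RtoC (binom_half e) * (Cpow (u t) e * Csum (seq (n - e) e) s)
        = s e * (Csum (seq 0 (n - e)) s + Csum (seq (n - e) e) s)
          + - (1) * (s e * Csum (seq 0 (n - e)) s))%C.
      change (s e) with (RtoC (binom_half e) * Cpow (u t) e)%C. ring.
    + rewrite Csum_plus, Csum_scal, Csum_scal_r. ring.
  - apply isO_Csum. intros e He. apply in_seq in He. apply isO_scal.
    replace n with (e + (n - e))%nat at 1 by lia.
    apply isO_mult; [ apply isO_Cpow, Hu | ].
    apply (isO_Csum (n - e) (seq (n - e) e) (fun d t => RtoC (binom_half d) * Cpow (u t) d)%C).
    intros d Hd. apply in_seq in Hd. apply isO_scal.
    apply isO_weaken with (n := d); [ lia | apply isO_Cpow, Hu ].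
Qed.

(** * Coefficients of the powers of P *)

(** The reversed polynomial [t^m P(1/t)], for which [x^m + P(x) = x^m (1 + revP (1/x))]. It has no
    constant term, hence is [O(t)]. *)
Definition revP (m : nat) (a : nat -> C) (t : C) : C :=
  Csum (seq 1 m) (fun i => a i * Cpow t i)%C.

Lemma Pval_coef (m D : nat) (a : nat -> C) (z : C) : (m <= D)%nat ->
  Pval m a z = Csum (seq 0 D) (fun d => Pcoef m a d * Cpow z d)%C.
Proof.
  intros HD. rewrite (Csum_extend m D); [ | exact HD | ].
  - unfold Pval. rewrite Csum_shift, Csum_rev. apply Csum_ext. intros i Hi. apply in_seq in Hi.
    unfold Pcoef. destruct (Nat.ltb_spec i m); [ | lia ].
    replace (S (m - 1 - i)) with (m - i)%nat by lia.
    replace (m - (m - i))%nat with i by lia. reflexivity.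
  - intros i Hi. unfold Pcoef. destruct (Nat.ltb_spec i m); [ lia | ring ].
Qed.

Lemma Ppow_coef_support (m : nat) (a : nat -> C) (k d : nat) :
  ((m - 1) * k < d)%nat -> Ppow_coef m a k d = 0%C.
Proof.
  revert d. induction k as [ | k IH ]; intros d Hd; cbn [Ppow_coef].
  - destruct (Nat.eqb_spec d 0); [ lia | reflexivity ].
  - apply Csum_zero. intros e He. apply in_seq in He. unfold Pcoef.
    destruct (Nat.ltb_spec e m); [ | ring ].
    rewrite IH; [ ring | nia ].
Qed.

Lemma Pval_pow (m : nat) (a : nat -> C) (k D : nat) (z : C) : (m * k < D)%nat ->
  Cpow (Pval m a z) k = Csum (seq 0 D) (fun d => Ppow_coef m a k d * Cpow z d)%C.
Proof.
  revert D. induction k as [ | k IH ]; intros D HD.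
  - rewrite (Csum_extend 1 D); [ unfold Csum; simpl; ring | lia | ].
    intros i Hi. cbn [Ppow_coef]. destruct (Nat.eqb_spec i 0); [ lia | ring ].
  - rewrite Cpow_S, (Pval_coef m D a z ltac:(nia)) at 1. cbn [Ppow_coef].
    transitivity (Csum (seq 0 D) (fun d => Csum (seq 0 (S d)) (fun e =>
       (Pcoef m a e * Cpow z e) * (Ppow_coef m a k (d - e) * Cpow z (d - e))))%C).
    + rewrite (Csum_triangle D (fun e d => (Pcoef m a e * Cpow z e) * (Ppow_coef m a k d * Cpow z d))%C).
      rewrite <- Csum_scal_r. apply Csum_ext. intros e He. apply in_seq in He.
      rewrite Csum_scal. unfold Pcoef. destruct (Nat.ltb_spec e m) as [ Hem | Hem ]; [ | ring ].
      rewrite <- (IH (D - e)%nat) by nia. reflexivity.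
    + apply Csum_ext. intros d _. rewrite <- Csum_scal_r.
      apply Csum_ext. intros e He. apply in_seq in He.
      assert (Ez : Cpow z d = (Cpow z e * Cpow z (d - e))%C)
        by (rewrite <- Cpow_add_r; f_equal; lia).
      rewrite Ez. ring.
Qed.

(** The coefficient of [t^j] in the [k]-th power of [revP], which is that of [z^(mk-j)] in [P^k]; up
    to the binomial factor it is [bjk]. *)
Definition rev_coef (m : nat) (a : nat -> C) (k j : nat) : C :=
  if Nat.leb j (m * k) then Ppow_coef m a k (m * k - j) else 0%C.

(** The [k]-th power of [revP] is divisible by [t^k]. This is the reason why the sum defining [bj]
    may stop at [k = j]. *)
Lemma rev_coef_low (m : nat) (a : nat -> C) (k j : nat) :
  (1 <= m)%nat -> (j < k)%nat -> rev_coef m a k j = 0%C.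
Proof.
  intros Hm Hj. unfold rev_coef. destruct (Nat.leb_spec j (m * k)); [ | reflexivity ].
  apply Ppow_coef_support. destruct m; [ lia | ]. nia.
Qed.

Lemma revP_Pval (m : nat) (a : nat -> C) (t : C) : t <> 0%C ->
  revP m a t = (Cpow t m * Pval m a (/ t))%C.
Proof.
  intros Ht. unfold revP, Pval. rewrite <- Csum_scal. apply Csum_ext. intros i Hi. apply in_seq in Hi.
  assert (E : Cpow t m = (Cpow t (m - i) * Cpow t i)%C)
    by (rewrite <- Cpow_add_r; f_equal; lia).
  rewrite E, Cpow_inv by exact Ht. field. apply Cpow_nz, Ht.
Qed.

Lemma revP_pow (m : nat) (a : nat -> C) (k D : nat) (t : C) : t <> 0%C -> (m * k < D)%nat ->
  Cpow (revP m a t) k = Csum (seq 0 D) (fun j => rev_coef m a k j * Cpow t j)%C.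
Proof.
  intros Ht HD.
  rewrite (revP_Pval m a t Ht), Cpow_mult_l, (Pval_pow m a k (S (m * k))) by lia.
  rewrite (Csum_extend (S (m * k)) D); [ | exact HD | ].
  - rewrite <- Csum_scal, Csum_rev. apply Csum_ext. intros j Hj. apply in_seq in Hj.
    unfold rev_coef. destruct (Nat.leb_spec j (m * k)); [ | lia ].
    replace (S (m * k) - 1 - j)%nat with (m * k - j)%nat by lia.
    rewrite <- Cpow_mult_r, Cpow_inv by exact Ht.
    replace (m * k)%nat with ((m * k - j) + j)%nat at 1 by lia.
    rewrite Cpow_add_r. field. apply Cpow_nz, Ht.
  - intros j Hj. unfold rev_coef. destruct (Nat.leb_spec j (m * k)); [ lia | ring ].
Qed.

(** The Taylor polynomial of degree [n] of the square root of [1 + revP t] at [t = 0]. *)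
Definition bpoly (m : nat) (a : nat -> C) (n : nat) (t : C) : C :=
  (1 + Csum (seq 1 n) (fun j => bj m a j * Cpow t j))%C.

Lemma revP_isO (m : nat) (a : nat -> C) : isO 1 (fun t => revP m a (RtoC t)).
Proof.
  apply isO_Csum. intros i Hi. apply in_seq in Hi. apply isO_scal.
  apply isO_weaken with (n := i); [ lia | apply isO_pow ].
Qed.

(** Two truncations of one composite series, by powers of [t] and by powers of [revP]. They agree
    through [t^n], because powers of [revP] beyond the [n]-th contribute only higher orders. *)
Lemma bpoly_series (m : nat) (a : nat -> C) (n : nat) : (1 <= m)%nat ->
  isO (S n) (fun t => bpoly m a n (RtoC t)
     - Csum (seq 0 (S n)) (fun k => RtoC (binom_half k) * Cpow (revP m a (RtoC t)) k))%C.
Proof.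
  (* [D] exceeds [n] and the degree of every power of [revP] up to the [n]-th, so all sums share one
     range. *)
  intros Hm. set (D := (S (m * n) + S n)%nat).
  set (B := fun j => Csum (seq 0 (S n)) (fun k => RtoC (binom_half k) * rev_coef m a k j)%C).
  apply isO_ext with (f := fun t => Csum (seq (S n) (D - S n)) (fun j => (- B j) * Cpow (RtoC t) j)%C).
  - intros t Ht.
    assert (Ht0 : RtoC t <> 0%C) by (apply RtoC_neq0; lra).
    assert (E : Csum (seq 0 (S n)) (fun k => RtoC (binom_half k) * Cpow (revP m a (RtoC t)) k)%C
                = Csum (seq 0 D) (fun j => B j * Cpow (RtoC t) j)%C).
    { transitivity (Csum (seq 0 (S n)) (fun k => Csum (seq 0 D) (fun j =>
         RtoC (binom_half k) * rev_coef m a k j * Cpow (RtoC t) j))%C).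
      - apply Csum_ext. intros k Hk. apply in_seq in Hk.
        rewrite (revP_pow m a k D) by (assumption || unfold D; nia).
        rewrite <- Csum_scal. apply Csum_ext. intros; ring.
      - rewrite Csum_swap. apply Csum_ext. intros j _. apply Csum_scal_r. }
    rewrite E, (Csum_split (S n) D) by (unfold D; lia).
    rewrite (Csum_ext (seq (S n) _) _ (fun j => (- (1)) * (B j * Cpow (RtoC t) j))%C) by (intros; ring).
    rewrite Csum_scal.
    assert (E1 : Csum (seq 0 (S n)) (fun j => B j * Cpow (RtoC t) j)%C = bpoly m a n (RtoC t)).
    { rewrite Csum_seq_first. unfold bpoly. f_equal.
      - unfold B. rewrite Csum_seq_first, Csum_zero.
        + unfold rev_coef. simpl. rewrite Nat.mul_0_r. simpl. ring.
        + intros k Hk. apply in_seq in Hk. rewrite rev_coef_low by lia. ring.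
      - apply Csum_ext. intros j Hj. apply in_seq in Hj. f_equal.
        unfold B. rewrite (Csum_extend (S j) (S n)).
        + rewrite Csum_seq_first. unfold rev_coef at 1. rewrite Nat.mul_0_r.
          destruct (Nat.leb_spec j 0); [ lia | ].
          unfold bj. rewrite Cmult_0_r, Cplus_0_l. apply Csum_ext. intros k _.
          unfold rev_coef, bjk. destruct (Nat.leb j (m * k)); ring.
        + lia.
        + intros k Hk. rewrite rev_coef_low by lia. ring. }
    rewrite E1. ring.
  - apply (isO_Csum (S n) _ (fun j t => - B j * Cpow (RtoC t) j)%C). intros j Hj. apply in_seq in Hj. apply isO_scal.
    apply isO_weaken with (n := j); [ lia | apply isO_pow ].
Qed.

(** Stated for the square so that only polynomials occur; the correct root is selected later by a
    lower bound on the sum of the two candidates. *)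
Lemma bpoly_square (m : nat) (a : nat -> C) (n : nat) : (1 <= m)%nat -> (1 <= n)%nat ->
  isO (S n) (fun t => bpoly m a n (RtoC t) * bpoly m a n (RtoC t) - (1 + revP m a (RtoC t)))%C.
Proof.
  intros Hm Hn.
  set (s := fun t => Csum (seq 0 (S n)) (fun k => RtoC (binom_half k) * Cpow (revP m a (RtoC t)) k)%C).
  apply isO_ext with (f := fun t =>
    ((bpoly m a n (RtoC t) - s t) * (bpoly m a n (RtoC t) + s t)
     + (s t * s t - (1 + revP m a (RtoC t))))%C); [ intros; ring | ].
  apply isO_plus; [ | apply sqrt_series_square; [ apply revP_isO | lia ] ].
  replace (S n) with (S n + 0)%nat by lia.
  apply isO_mult; [ apply bpoly_series, Hm | ].
  apply isO_plus.
  - apply isO_plus; [ apply isO_const | ].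
    apply (isO_Csum 0 _ (fun j t => bj m a j * Cpow (RtoC t) j)%C).
    intros j _. apply isO_scal.
    apply isO_weaken with (n := j); [ lia | apply isO_pow ].
  - apply (isO_Csum 0 _ (fun k t => RtoC (binom_half k) * Cpow (revP m a (RtoC t)) k)%C).
    intros j _. apply isO_scal.
    apply isO_weaken with (n := j); [ lia | apply isO_Cpow, revP_isO ].
Qed.

(** * The potential and its derivatives *)

Definition Qpot (m : nat) (a : nat -> C) (lam : C) (x : R) : C :=
  (Cpow (RtoC x) m + Pval m a (RtoC x) + lam)%C.

(** The derivative of [x^n]. For [n = 0] the truncated [pred] is harmless because the factor [INR n]
    vanishes. *)
Definition dmono (n : nat) (x : R) : C := (RtoC (INR n) * Cpow (RtoC x) (pred n))%C.

Definition Qpot1 (m : nat) (a : nat -> C) (x : R) : C :=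
  (dmono m x + Csum (seq 1 m) (fun i => a i * dmono (m - i) x))%C.

Definition Qpot2 (m : nat) (a : nat -> C) (x : R) : C :=
  (RtoC (INR m) * dmono (pred m) x
   + Csum (seq 1 m) (fun i => a i * (RtoC (INR (m - i)) * dmono (pred (m - i)) x)))%C.

Lemma Cder_Cpow (n : nat) (x : R) : Cder (fun t => Cpow (RtoC t) n) x (dmono n x).
Proof.
  unfold dmono. induction n as [ | n IH ].
  - eapply Cder_eq; [ apply (Cder_const 1) | simpl INR; ring ].
  - apply Cder_ext with (g := fun t => (RtoC t * Cpow (RtoC t) n)%C); [ intros; symmetry; apply Cpow_S | ].
    eapply Cder_eq.
    + apply Cder_mult; [ apply Cder_RtoC, @is_derive_id | exact IH ].
    + cbv beta. change (RtoC one) with (RtoC 1). simpl pred. rewrite S_INR, RtoC_plus.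
      destruct n as [ | n ]; [ simpl; ring | ]. simpl pred. rewrite (Cpow_S _ n). ring.
Qed.

Lemma Cder_Csum (l : list nat) (g : nat -> R -> C) (g' : nat -> C) (x : R) :
  (forall i, In i l -> Cder (g i) x (g' i)) -> Cder (fun t => Csum l (fun i => g i t)) x (Csum l g').
Proof.
  intros H. induction l as [ | i l IH ].
  - apply (Cder_const 0).
  - refine (Cder_plus (g i) (fun t => Csum l (fun i => g i t)) x _ _ (H i (or_introl eq_refl)) (IH _)).
    intros j Hj. apply H. right; exact Hj.
Qed.

Lemma Cder_Qpot (m : nat) (a : nat -> C) (lam : C) (x : R) :
  Cder (Qpot m a lam) x (Qpot1 m a x).
Proof.
  unfold Qpot. eapply Cder_eq.
  - apply Cder_plus; [ apply Cder_plus; [ apply Cder_Cpow | ] | apply Cder_const ].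
    unfold Pval. apply Cder_Csum with (g' := fun i => (a i * dmono (m - i) x)%C).
    intros i _. apply Cder_scal, Cder_Cpow.
  - unfold Qpot1. ring.
Qed.

Lemma Cder_Qpot1 (m : nat) (a : nat -> C) (x : R) : Cder (Qpot1 m a) x (Qpot2 m a x).
Proof.
  unfold Qpot1, Qpot2. apply Cder_plus.
  - unfold dmono at 1. apply Cder_scal, Cder_Cpow.
  - apply (Cder_Csum (seq 1 m) (fun i t => a i * dmono (m - i) t)%C). intros i _.
    apply Cder_scal. unfold dmono at 1. apply Cder_scal, Cder_Cpow.
Qed.

(** A single scale [v], later [x + xi], dominates both 1 and [x], so it absorbs all lower monomials
    and [M] enters the bounds only through constants. *)
Lemma Cmod_pow_bound (x v : R) (n k : nat) :
  0 <= x -> x <= v -> 1 <= v -> (n <= k)%nat -> Cmod (Cpow (RtoC x) n) <= v ^ k.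
Proof.
  intros Hx Hv Hv1 Hn. rewrite Cmod_pow, Cmod_R, Rabs_pos_eq by exact Hx.
  apply Rle_trans with (v ^ n); [ apply pow_incr; lra | apply Rle_pow; assumption ].
Qed.

Lemma Cmod_dmono_bound (x v : R) (n k : nat) :
  0 <= x -> x <= v -> 1 <= v -> (pred n <= k)%nat -> Cmod (dmono n x) <= INR n * v ^ k.
Proof.
  intros Hx Hv Hv1 Hn. unfold dmono. rewrite Cmod_mult, Cmod_R, Rabs_pos_eq by apply pos_INR.
  apply Rmult_le_compat_l; [ apply pos_INR | apply Cmod_pow_bound; assumption ].
Qed.

Lemma Pval_bound (m : nat) (a : nat -> C) (M x v : R) :
  (forall k, (1 <= k <= m)%nat -> Cmod (a k) <= M) -> 0 <= x -> x <= v -> 1 <= v ->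
  Cmod (Pval m a (RtoC x)) <= INR m * (M * v ^ (m - 1)).
Proof.
  intros HM Hx Hv Hv1. unfold Pval.
  eapply Rle_trans; [ apply (Cmod_Csum_le _ _ (M * v ^ (m - 1))) | rewrite length_seq; lra ].
  intros i Hi. apply in_seq in Hi. rewrite Cmod_mult.
  apply Rmult_le_compat; try apply Cmod_ge_0; [ apply HM; lia | ].
  apply Cmod_pow_bound; try assumption. lia.
Qed.

Lemma Qpot1_bound (m : nat) (a : nat -> C) (M x v : R) :
  (forall k, (1 <= k <= m)%nat -> Cmod (a k) <= M) -> 0 <= x -> x <= v -> 1 <= v ->
  Cmod (Qpot1 m a x) <= (INR m + INR m * (M * INR m)) * v ^ (m - 1).
Proof.
  intros HM Hx Hv Hv1. unfold Qpot1.
  eapply Rle_trans; [ apply Cmod_triangle | ]. rewrite Rmult_plus_distr_r.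
  apply Rplus_le_compat; [ apply Cmod_dmono_bound; try assumption; lia | ].
  eapply Rle_trans; [ apply (Cmod_Csum_le _ _ (M * INR m * v ^ (m - 1))) | rewrite length_seq; lra ].
  intros i Hi. apply in_seq in Hi. rewrite Cmod_mult, Rmult_assoc.
  apply Rmult_le_compat; try apply Cmod_ge_0; [ apply HM; lia | ].
  eapply Rle_trans; [ apply (Cmod_dmono_bound x v _ (m - 1)); try assumption; lia | ].
  apply Rmult_le_compat_r; [ apply pow_le; lra | apply le_INR; lia ].
Qed.

Lemma Qpot2_bound (m : nat) (a : nat -> C) (M x v : R) :
  (forall k, (1 <= k <= m)%nat -> Cmod (a k) <= M) -> 0 <= x -> x <= v -> 1 <= v ->
  Cmod (Qpot2 m a x) <= (INR m * INR m + INR m * (M * (INR m * INR m))) * v ^ (m - 2).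
Proof.
  intros HM Hx Hv Hv1. unfold Qpot2.
  assert (Hd : forall n, (n <= m)%nat ->
     Cmod (RtoC (INR n) * dmono (pred n) x) <= INR m * INR m * v ^ (m - 2)).
  { intros n Hn. rewrite Cmod_mult, Cmod_R, Rabs_pos_eq, Rmult_assoc by apply pos_INR.
    apply Rmult_le_compat; [ apply pos_INR | apply Cmod_ge_0 | apply le_INR; lia | ].
    eapply Rle_trans; [ apply (Cmod_dmono_bound x v _ (m - 2)); try assumption; lia | ].
    apply Rmult_le_compat_r; [ apply pow_le; lra | apply le_INR; lia ]. }
  eapply Rle_trans; [ apply Cmod_triangle | ]. rewrite Rmult_plus_distr_r.
  apply Rplus_le_compat; [ apply Hd; lia | ].
  eapply Rle_trans; [ apply (Cmod_Csum_le _ _ (M * (INR m * INR m) * v ^ (m - 2))) | rewrite length_seq; lra ].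
  intros i Hi. apply in_seq in Hi. rewrite Cmod_mult, (Rmult_assoc M).
  apply Rmult_le_compat; try apply Cmod_ge_0; [ apply HM; lia | apply Hd; lia ].
Qed.

Lemma pow_add_le (x y : R) (m : nat) : 0 <= x -> 0 <= y -> (x + y) ^ m <= 2 ^ m * (x ^ m + y ^ m).
Proof.
  intros Hx Hy.
  assert (Hp : forall u v, 0 <= u <= v -> (u + v) ^ m <= 2 ^ m * (u ^ m + v ^ m)).
  { intros u v Huv. apply Rle_trans with ((2 * v) ^ m); [ apply pow_incr; lra | ].
    rewrite Rpow_mult_distr. apply Rmult_le_compat_l; [ apply pow_le; lra | ].
    assert (0 <= u ^ m) by (apply pow_le; lra). lra. }
  destruct (Rle_lt_dec x y) as [ H | H ]; [ apply Hp; lra | ].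
  rewrite Rplus_comm, (Rplus_comm (x ^ m)). apply Hp; lra.
Qed.

(* Bounding |w| below by Re (w e^{-i phi}) for w = X + r e^{i phi}. *)
Lemma sector_bound (X r phi : R) : 0 <= X -> 0 <= r ->
  (1 + cos phi) * (X + r) <= Cmod (RtoC X + polar r phi) + Re (RtoC X + polar r phi).
Proof.
  intros HX Hr. unfold polar.
  assert (H : Re ((RtoC X + RtoC r * Cexpo (0, phi)) * Cexpo (0, (- phi)%R))
              <= Cmod (RtoC X + RtoC r * Cexpo (0, phi))).
  { eapply Rle_trans; [ apply Rle_abs | ]. eapply Rle_trans; [ apply re_le_Cmod | ].
    rewrite Cmod_mult, Cmod_Cexpo. change (Re (0, - phi)) with 0. rewrite exp_0. lra. }
  replace ((RtoC X + RtoC r * Cexpo (0, phi)) * Cexpo (0, (- phi)%R))%C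
    with (RtoC X * Cexpo (0, (- phi)%R) + RtoC r)%C in H.
  - replace (Re (RtoC X * Cexpo (0, (- phi)%R) + RtoC r)) with (X * cos phi + r) in H
      by (unfold Cexpo; simpl; rewrite exp_0, cos_neg; ring).
    replace (Re (RtoC X + RtoC r * Cexpo (0, phi))) with (X + r * cos phi)
      by (unfold Cexpo; simpl; rewrite exp_0; ring).
    lra.
  - rewrite Cmult_plus_distr_r. f_equal.
    rewrite <- Cmult_assoc, <- Cexpo_plus.
    replace (Cplus (0, phi) (0, - phi)) with (RtoC 0)
      by (apply C_eq; simpl; ring).
    rewrite Cexpo_0. ring.
Qed.

(** Here [lam] has modulus [xi^m]. The sector leaves the margin [kap (x^m + xi^m)] for the leading
    part, while [P] has one degree less in [x + xi] and so is smaller by a factor of order [1/xi];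
    the largeness of [xi] limits it to a quarter of the margin, and it is spent twice. The first
    bound keeps [Q] off the cut, the second feeds the estimates of the error density. *)
Lemma Qpot_lower (m : nat) (a : nat -> C) (M kap xi phi x : R) :
  (1 <= m)%nat -> (forall k, (1 <= k <= m)%nat -> Cmod (a k) <= M) ->
  0 < kap -> kap <= 1 + cos phi -> 1 <= xi -> 4 * INR m * M * 2 ^ m <= kap * xi -> 0 <= x ->
  let Q := Qpot m a (polar (xi ^ m) phi) x in
  kap / 2 * (x ^ m + xi ^ m) <= Cmod Q + Re Q /\ kap / (4 * 2 ^ m) * (x + xi) ^ m <= Cmod Q.
Proof.
  intros Hm HM Hk Hkc Hxi Hbig Hx Q.
  assert (Hxm : 0 <= x ^ m) by (apply pow_le; exact Hx).
  assert (Hrm : 0 < xi ^ m) by (apply pow_lt; lra).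
  assert (H2 : 0 < 2 ^ m) by (apply pow_lt; lra).
  set (G := (RtoC (x ^ m) + polar (xi ^ m) phi)%C).
  set (P := Pval m a (RtoC x)).
  assert (EQ : Q = (G + P)%C) by (unfold Q, G, P, Qpot; rewrite RtoC_pow; ring).
  pose proof (sector_bound (x ^ m) (xi ^ m) phi Hxm ltac:(lra)) as HG. fold G in HG.
  pose proof (Pval_bound m a M x (x + xi) HM Hx ltac:(lra) ltac:(lra)) as HP. fold P in HP.
  assert (HM0 : 0 <= M).
  { eapply Rle_trans; [ apply Cmod_ge_0 | apply (HM 1%nat); lia ]. }
  assert (HP2 : Cmod P <= kap / 4 * (x ^ m + xi ^ m)).
  { eapply Rle_trans; [ exact HP | ].
    pose proof (pow_add_le x xi m Hx ltac:(lra)) as Hpa.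
    assert (Ev : (x + xi) ^ m = (x + xi) * (x + xi) ^ (m - 1)).
    { replace m with (S (m - 1)) at 1 by lia. reflexivity. }
    assert (Hv : 0 < (x + xi) ^ (m - 1)) by (apply pow_lt; lra).
    pose proof (pos_INR m) as Hm0.
    apply Rmult_le_reg_l with (4 * 2 ^ m); [ lra | ].
    apply Rle_trans with (kap * xi * (x + xi) ^ (m - 1)).
    - replace (4 * 2 ^ m * (INR m * (M * (x + xi) ^ (m - 1))))
        with (4 * INR m * M * 2 ^ m * (x + xi) ^ (m - 1)) by ring.
      apply Rmult_le_compat_r; lra.
    - apply Rle_trans with (kap * (x + xi) ^ m).
      + rewrite Ev, Rmult_assoc. apply Rmult_le_compat_l; [ lra | ].
        apply Rmult_le_compat_r; lra.
      + replace (4 * 2 ^ m * (kap / 4 * (x ^ m + xi ^ m)))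
          with (kap * (2 ^ m * (x ^ m + xi ^ m))) by field.
        apply Rmult_le_compat_l; lra. }
  assert (HQ : kap / 2 * (x ^ m + xi ^ m) <= Cmod Q + Re Q).
  { pose proof (Cmod_rev_triangle G P) as H3. rewrite <- EQ in H3.
    assert (Er : Re Q = Re G + Re P) by (rewrite EQ; reflexivity).
    pose proof (re_le_Cmod P) as H4. apply Rabs_le_between in H4.
    assert (kap * (x ^ m + xi ^ m) <= (1 + cos phi) * (x ^ m + xi ^ m))
      by (apply Rmult_le_compat_r; lra).
    lra. }
  split; [ exact HQ | ].
  pose proof (re_le_Cmod Q) as H5. pose proof (Rle_abs (Re Q)) as H6.
  apply Rle_trans with (kap / 4 * (x ^ m + xi ^ m)); [ | lra ].
  pose proof (pow_add_le x xi m Hx ltac:(lra)) as Hpa.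
  replace (kap / (4 * 2 ^ m) * (x + xi) ^ m) with (kap / 4 * ((x + xi) ^ m / 2 ^ m)) by (field; lra).
  apply Rmult_le_compat_l; [ lra | ]. apply Rle_div_l; lra.
Qed.

(** * Variation of constants for the WKB approximation *)

(** Taking all exponents from one logarithm makes the rules for powers exact: [Q^(1/2)] is the
    square of [Q^(1/4)] and [Q^(-1/4)] its inverse, with no ambiguity of branch. *)
Definition qroot (Q : R -> C) (s : R) (x : R) : C := Cexpo (RtoC s * Clog (Q x)).

(* The coefficients of [y] in the WKB basis [Q^(-1/4) e^(-S)], [Q^(-1/4) e^S], obtained from
   Wronskians; the second one is multiplied by [e^(2S)] so that it tends to 0. *)
Definition ampA (Q Q1 S y y1 : R -> C) (x : R) : C :=
  (RtoC (1/2) * (Cexpo (S x) * (qroot Q (1/4) x * y x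
     - RtoC (1/4) * Q1 x * Cpow (qroot Q (-1/4) x) 5 * y x - qroot Q (-1/4) x * y1 x)))%C.

Definition ampB (Q Q1 S y y1 : R -> C) (x : R) : C :=
  (RtoC (1/2) * (Cexpo (S x) * (qroot Q (1/4) x * y x
     + RtoC (1/4) * Q1 x * Cpow (qroot Q (-1/4) x) 5 * y x + qroot Q (-1/4) x * y1 x)))%C.

(** This is [Q^(-1/4) (Q^(-1/4))''], the defect of the WKB basis as solutions of [y'' = Q y]. The
    exponents 10 and 6 stand for [Q^(-5/2)] and [Q^(-3/2)]. *)
Definition wkb_error (Q Q1 Q2 : R -> C) (x : R) : C :=
  (RtoC (5/16) * (Q1 x * Q1 x * Cpow (qroot Q (-1/4) x) 10)
   - RtoC (1/4) * (Q2 x * Cpow (qroot Q (-1/4) x) 6))%C.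

Lemma qroot_inv (Q : R -> C) (x : R) : qroot Q (-1/4) x = (/ qroot Q (1/4) x)%C.
Proof.
  unfold qroot. rewrite <- Cexpo_opp. f_equal.
  replace (-1/4) with (- (1/4)) by field. rewrite RtoC_opp. ring.
Qed.

Lemma qroot_pow4 (Q : R -> C) (x : R) : offcut (Q x) -> Q x = Cpow (qroot Q (1/4) x) 4.
Proof.
  intros H. unfold qroot. rewrite <- Cexpo_nat.
  rewrite <- (Cexpo_Clog (Q x)) at 1 by (apply offcut_neq0, H). f_equal.
  rewrite Cmult_assoc, <- RtoC_mult. replace (INR 4 * (1/4)) with 1 by (simpl; field). ring.
Qed.

Lemma qroot_half (Q : R -> C) (x : R) : qroot Q (1/2) x = Cpow (qroot Q (1/4) x) 2.
Proof.
  unfold qroot. rewrite <- Cexpo_nat. f_equal.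
  rewrite Cmult_assoc, <- RtoC_mult. do 2 f_equal. simpl; field.
Qed.

Lemma Cder_qroot (Q : R -> C) (Q1 : C) (s x : R) :
  Cder Q x Q1 -> offcut (Q x) -> Cder (qroot Q s) x (RtoC s * (Q1 / Q x) * qroot Q s x)%C.
Proof.
  intros H Hc. unfold qroot. apply Cder_Cexpo. apply Cder_scal. apply Cder_Clog; assumption.
Qed.

Lemma Cder_pow (g : R -> C) (n : nat) (x : R) (l : C) :
  Cder g x l -> Cder (fun t => Cpow (g t) n) x (RtoC (INR n) * l * Cpow (g x) (pred n))%C.
Proof.
  intros H. induction n as [ | n IH ].
  - eapply Cder_eq; [ apply (Cder_const 1) | simpl INR; ring ].
  - apply Cder_ext with (g := fun t => (g t * Cpow (g t) n)%C); [ intros; symmetry; apply Cpow_S | ].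
    eapply Cder_eq; [ apply Cder_mult; [ exact H | exact IH ] | ].
    cbv beta. simpl pred. rewrite S_INR, RtoC_plus.
    destruct n as [ | n ]; [ simpl; ring | ]. simpl pred. rewrite (Cpow_S _ n). ring.
Qed.

Lemma amp_sum (Q Q1 S y y1 : R -> C) (x : R) :
  (ampA Q Q1 S y y1 x + ampB Q Q1 S y y1 x = Cexpo (S x) * qroot Q (1/4) x * y x)%C.
Proof.
  unfold ampA, ampB. rewrite <- Cmult_plus_distr_l.
  set (U := (Cexpo (S x) * qroot Q (1/4) x * y x)%C).
  transitivity (RtoC (1/2) * (2 * U))%C; [ unfold U; ring | ].
  rewrite Cmult_assoc, <- RtoC_mult. replace (1 / 2 * 2) with 1 by field. ring.
Qed.

(** Differentiating the Wronskian of [y] with a WKB function leaves only the defect of that function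
    times [y], and [y] is recovered from [A + B]. With [Q] written as the fourth power of [E] and
    [Q^(-1/4)] as its inverse, everything is rational in [E] and the identities become purely
    algebraic. *)
Lemma Cder_amp (Q Q1 Q2 S y y1 : R -> C) (x : R) :
  Cder Q x (Q1 x) -> Cder Q1 x (Q2 x) -> offcut (Q x) -> Cder S x (qroot Q (1/2) x) ->
  Cder y x (y1 x) -> Cder y1 x (Q x * y x)%C ->
  Cder (ampA Q Q1 S y y1) x (RtoC (1/2) * wkb_error Q Q1 Q2 x
     * (ampA Q Q1 S y y1 x + ampB Q Q1 S y y1 x))%C /\
  Cder (ampB Q Q1 S y y1) x (2 * qroot Q (1/2) x * ampB Q Q1 S y y1 x
     - RtoC (1/2) * wkb_error Q Q1 Q2 x * (ampA Q Q1 S y y1 x + ampB Q Q1 S y y1 x))%C.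
Proof.
  intros HQ HQ1 Hc HS Hy Hy1.
  pose proof (Cder_qroot Q (Q1 x) (1/4) x HQ Hc) as DE.
  pose proof (Cder_qroot Q (Q1 x) (-1/4) x HQ Hc) as DEi.
  rewrite amp_sum. rewrite qroot_half in *.
  assert (R4 : RtoC (1/4) = (/ 4)%C) by (rewrite RtoC_div by lra; field; apply RtoC_neq0; lra).
  assert (R4' : RtoC (-1/4) = (- / 4)%C)
    by (replace (-1/4) with (- (1/4)) by field; rewrite RtoC_opp, R4; ring).
  assert (R2 : RtoC (1/2) = (/ 2)%C) by (rewrite RtoC_div by lra; field; apply RtoC_neq0; lra).
  assert (R5 : RtoC (5/16) = (5 / 16)%C) by (apply RtoC_div; lra).
  pose proof (qroot_pow4 Q x Hc) as E4.
  assert (HE : qroot Q (1/4) x <> 0%C) by apply Cexpo_neq0.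
  assert (DU : Cder (fun t => qroot Q (1/4) t * y t)%C x
            (RtoC (1/4) * (Q1 x / Q x) * qroot Q (1/4) x * y x + qroot Q (1/4) x * y1 x)%C)
    by (apply Cder_mult; [ exact DE | exact Hy ]).
  assert (DV : Cder (fun t => RtoC (1/4) * Q1 t * Cpow (qroot Q (-1/4) t) 5 * y t)%C x
            ((RtoC (1/4) * Q2 x * Cpow (qroot Q (-1/4) x) 5 + RtoC (1/4) * Q1 x *
              (RtoC (INR 5) * (RtoC (-1/4) * (Q1 x / Q x) * qroot Q (-1/4) x) * Cpow (qroot Q (-1/4) x) 4)) * y x
              + RtoC (1/4) * Q1 x * Cpow (qroot Q (-1/4) x) 5 * y1 x)%C)
    by (apply Cder_mult; [ apply Cder_mult; [ apply Cder_scal, HQ1 | exact (Cder_pow _ 5 _ _ DEi) ]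
                         | exact Hy ]).
  assert (DW : Cder (fun t => qroot Q (-1/4) t * y1 t)%C x
            (RtoC (-1/4) * (Q1 x / Q x) * qroot Q (-1/4) x * y1 x + qroot Q (-1/4) x * (Q x * y x))%C)
    by (apply Cder_mult; [ exact DEi | exact Hy1 ]).
  pose proof (Cder_Cexpo _ _ _ HS) as DX.
  clear DE DEi HQ HQ1 HS Hy Hy1.
  assert (I5 : RtoC (INR 5) = RtoC 5) by (f_equal; simpl; ring).
  split.
  - eapply Cder_eq.
    + unfold ampA. apply Cder_scal, Cder_mult; [ exact DX | ].
      apply Cder_minus; [ apply Cder_minus; [ exact DU | exact DV ] | exact DW ].
    + clear DU DV DW DX. cbv beta. unfold wkb_error.
      rewrite I5, R5, R4', R4, R2, !(qroot_inv Q x), E4.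
      set (E := qroot Q (1/4) x) in *. set (X := Cexpo (S x)).
      generalize (Q1 x) (Q2 x) (y x) (y1 x). clear - HE. clearbody E X. intros q1 q2 u v.
      field. exact HE.
  - eapply Cder_eq.
    + unfold ampB. apply Cder_scal, Cder_mult; [ exact DX | ].
      apply Cder_plus; [ apply Cder_plus; [ exact DU | exact DV ] | exact DW ].
    + clear DU DV DW DX. cbv beta. unfold wkb_error, ampB.
      rewrite I5, R5, R4', R4, R2, !(qroot_inv Q x), E4.
      set (E := qroot Q (1/4) x) in *. set (X := Cexpo (S x)).
      generalize (Q1 x) (Q2 x) (y x) (y1 x). clear - HE. clearbody E X. intros q1 q2 u v.
      field. exact HE.
Qed.


Lemma Cmod_qroot (Q : R -> C) (s x : R) : Cmod (qroot Q s x) = Rpower (Cmod (Q x)) s.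
Proof.
  unfold qroot, Rpower. rewrite Cmod_Cexpo. f_equal. simpl. ring.
Qed.

Lemma Rpower_pow_mult (v s : R) (n : nat) : (Rpower v s) ^ n = Rpower v (INR n * s).
Proof.
  rewrite <- Rpower_pow by apply exp_pos. rewrite Rpower_mult. f_equal. ring.
Qed.

Lemma Rpower_antitone (v w s : R) : 0 < w <= v -> s <= 0 -> Rpower v s <= Rpower w s.
Proof.
  intros H Hs. unfold Rpower. apply exp_incr. pose proof (ln_le w v ltac:(lra) ltac:(lra)). nra.
Qed.

(** Power counting in [v]: [2 (m-1) - 5m/2] and [(m-2) - 3m/2] both equal [-m/2 - 2], written so as
    to match the derivative of [v^(-(m/2+1))]. The first bound concerns [Q' / Q^(3/2)], the size
    relative to [sqrt Q] of the correction made by differentiating [Q^(-1/4)]. *)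
Lemma wkb_error_bound (m : nat) (Q Q1 Q2 : R -> C) (k C1 C2 x v : R) :
  (2 <= m)%nat -> 0 < k -> 1 <= v -> 0 <= C1 -> 0 <= C2 ->
  k * v ^ m <= Cmod (Q x) -> Cmod (Q1 x) <= C1 * v ^ (m - 1) -> Cmod (Q2 x) <= C2 * v ^ (m - 2) ->
  Cmod (Q1 x * Cpow (qroot Q (-1/4) x) 6) <= C1 * Rpower k (-3/2) * Rpower v (- (INR m / 2 + 1)) /\
  Cmod (wkb_error Q Q1 Q2 x)
    <= (C1 * C1 * Rpower k (-5/2) + C2 * Rpower k (-3/2)) * Rpower v (- (INR m / 2 + 1) - 1).
Proof.
  intros Hm Hk Hv HC1 HC2 HQ HQ1 HQ2.
  assert (Hvm : 0 < v ^ m) by (apply pow_lt; lra).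
  assert (Hkv : 0 < k * v ^ m) by nra.
  assert (Hr : forall n : nat, Cmod (Cpow (qroot Q (-1/4) x) n)
             <= Rpower k (- (INR n / 4)) * Rpower v (- (INR n / 4) * INR m)).
  { intros n. rewrite Cmod_pow, Cmod_qroot, Rpower_pow_mult.
    replace (INR n * (-1/4)) with (- (INR n / 4)) by field.
    eapply Rle_trans; [ apply (Rpower_antitone _ (k * v ^ m)) | ].
    - split; [ exact Hkv | exact HQ ].
    - pose proof (pos_INR n). lra.
    - rewrite <- Rpower_mult_distr by lra.
      right. f_equal. rewrite <- Rpower_pow, Rpower_mult by lra. f_equal. ring. }
  assert (Hp : forall n, v ^ n = Rpower v (INR n)) by (intros; symmetry; apply Rpower_pow; lra).
  rewrite Hp in HQ1, HQ2.
  rewrite minus_INR in HQ1, HQ2 by lia.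
  pose proof (Hr 6%nat) as H6. pose proof (Hr 10%nat) as H10.
  replace (- (INR 6 / 4)) with (-3/2) in H6 by (simpl; field).
  replace (- (INR 10 / 4)) with (-5/2) in H10 by (simpl; field).
  assert (P0 : forall w s, 0 < Rpower w s) by (intros; apply exp_pos).
  pose proof (P0 k (-3/2)). pose proof (P0 k (-5/2)).
  split.
  - rewrite Cmod_mult.
    eapply Rle_trans; [ apply Rmult_le_compat; [ apply Cmod_ge_0 | apply Cmod_ge_0 | exact HQ1 | exact H6 ] | ].
    right. replace (- (INR m / 2 + 1)) with ((INR m - INR 1) + (-3/2 * INR m)) by (simpl; field).
    rewrite Rpower_plus. ring.
  - unfold wkb_error. unfold Cminus. eapply Rle_trans; [ apply Cmod_triangle | ].
    rewrite Cmod_opp, !Cmod_mult, !Cmod_R, !Rabs_pos_eq by lra.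
    assert (A1 : Cmod (Q1 x) * Cmod (Q1 x) * Cmod (Cpow (qroot Q (-1/4) x) 10)
      <= C1 * C1 * Rpower k (-5/2) * Rpower v (- (INR m / 2 + 1) - 1)).
    { eapply Rle_trans; [ apply Rmult_le_compat;
        [ apply Rmult_le_pos; apply Cmod_ge_0 | apply Cmod_ge_0
        | apply Rmult_le_compat; [ apply Cmod_ge_0 | apply Cmod_ge_0 | exact HQ1 | exact HQ1 ]
        | exact H10 ] | ].
      right. replace (- (INR m / 2 + 1) - 1) with ((INR m - INR 1) + (INR m - INR 1) + (-5/2 * INR m))
        by (simpl; field).
      rewrite !Rpower_plus. ring. }
    assert (A2 : Cmod (Q2 x) * Cmod (Cpow (qroot Q (-1/4) x) 6)
      <= C2 * Rpower k (-3/2) * Rpower v (- (INR m / 2 + 1) - 1)).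
    { eapply Rle_trans; [ apply Rmult_le_compat;
        [ apply Cmod_ge_0 | apply Cmod_ge_0 | exact HQ2 | exact H6 ] | ].
      right. replace (- (INR m / 2 + 1) - 1) with ((INR m - INR 2) + (-3/2 * INR m))
        by (simpl; field).
      rewrite !Rpower_plus. ring. }
    assert (0 <= Cmod (Q1 x) * Cmod (Q1 x) * Cmod (Cpow (qroot Q (-1/4) x) 10))
      by (repeat apply Rmult_le_pos; apply Cmod_ge_0).
    assert (0 <= Cmod (Q2 x) * Cmod (Cpow (qroot Q (-1/4) x) 6))
      by (repeat apply Rmult_le_pos; apply Cmod_ge_0).
    lra.
Qed.

(** * Limits at infinity *)

Definition limoo (f : R -> C) (c : C) : Prop :=
  forall eps, 0 < eps -> exists X, forall x, X <= x -> Cmod (f x - c) <= eps.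

Lemma limoo_ext (f g : R -> C) (c : C) (X0 : R) :
  (forall x, X0 <= x -> f x = g x) -> limoo f c -> limoo g c.
Proof.
  intros E H eps He. destruct (H eps He) as [ X HX ]. exists (Rmax X X0). intros x Hx.
  pose proof (Rmax_l X X0). pose proof (Rmax_r X X0).
  rewrite <- E by lra. apply HX. lra.
Qed.

Lemma limoo_const (c : C) : limoo (fun _ => c) c.
Proof.
  intros eps He. exists 0. intros x _. replace (c - c)%C with (RtoC 0) by ring.
  rewrite Cmod_0. lra.
Qed.

Lemma limoo_plus (f g : R -> C) (c d : C) :
  limoo f c -> limoo g d -> limoo (fun x => f x + g x)%C (c + d)%C.
Proof.
  intros Hf Hg eps He.
  destruct (Hf (eps / 2) ltac:(lra)) as [ X HX ]. destruct (Hg (eps / 2) ltac:(lra)) as [ Y HY ].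
  exists (Rmax X Y). intros x Hx. pose proof (Rmax_l X Y). pose proof (Rmax_r X Y).
  replace (f x + g x - (c + d))%C with ((f x - c) + (g x - d))%C by ring.
  eapply Rle_trans; [ apply Cmod_triangle | ].
  pose proof (HX x ltac:(lra)). pose proof (HY x ltac:(lra)). lra.
Qed.

Lemma limoo_mult (f g : R -> C) (c d : C) :
  limoo f c -> limoo g d -> limoo (fun x => f x * g x)%C (c * d)%C.
Proof.
  intros Hf Hg eps He.
  pose proof (Cmod_ge_0 c) as Hc. pose proof (Cmod_ge_0 d) as Hd.
  set (e1 := eps / (2 * (Cmod d + 1))). set (e2 := eps / (2 * (Cmod c + 1))).
  assert (H1 : 0 < e1) by (apply Rdiv_lt_0_compat; lra).
  assert (H2 : 0 < Rmin 1 e2) by (apply Rmin_glb_lt; [ lra | apply Rdiv_lt_0_compat; lra ]).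
  destruct (Hf e1 H1) as [ X HX ]. destruct (Hg _ H2) as [ Y HY ].
  exists (Rmax X Y). intros x Hx. pose proof (Rmax_l X Y). pose proof (Rmax_r X Y).
  replace (f x * g x - c * d)%C with ((f x - c) * g x + c * (g x - d))%C by ring.
  eapply Rle_trans; [ apply Cmod_triangle | ]. rewrite !Cmod_mult.
  pose proof (HX x ltac:(lra)) as Gf. pose proof (HY x ltac:(lra)) as Gg.
  pose proof (Rmin_l 1 e2). pose proof (Rmin_r 1 e2).
  assert (Gx : Cmod (g x) <= Cmod d + 1).
  { pose proof (Cmod_triangle (g x - d) d) as H5.
    replace (g x - d + d)%C with (g x) in H5 by ring. lra. }
  pose proof (Cmod_ge_0 (f x - c)). pose proof (Cmod_ge_0 (g x)). pose proof (Cmod_ge_0 (g x - d)).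
  assert (Cmod (f x - c) * Cmod (g x) <= e1 * (Cmod d + 1)) by (apply Rmult_le_compat; lra).
  assert (Cmod c * Cmod (g x - d) <= (Cmod c + 1) * e2) by (apply Rmult_le_compat; lra).
  assert (e1 * (Cmod d + 1) = eps / 2) by (unfold e1; field; lra).
  assert ((Cmod c + 1) * e2 = eps / 2) by (unfold e2; field; lra).
  lra.
Qed.

Lemma limoo_scal (k : C) (f : R -> C) (c : C) : limoo f c -> limoo (fun x => k * f x)%C (k * c)%C.
Proof. intros H. apply limoo_mult; [ apply limoo_const | exact H ]. Qed.

Lemma limoo_minus (f g : R -> C) (c d : C) :
  limoo f c -> limoo g d -> limoo (fun x => f x - g x)%C (c - d)%C.
Proof.
  intros Hf Hg. apply limoo_ext with (f := fun x => (f x + (- (1)) * g x)%C) (X0 := 0);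
    [ intros; ring | ].
  replace (c - d)%C with (c + (- (1)) * d)%C by ring.
  apply limoo_plus; [ exact Hf | apply limoo_scal, Hg ].
Qed.

Lemma limoo_Cexpo (f : R -> C) (c : C) : limoo f c -> limoo (fun x => Cexpo (f x)) (Cexpo c).
Proof.
  intros H.
  assert (H0 : limoo (fun x => Cexpo (f x - c)) 1%C).
  { intros eps He.
    destruct (H (Rmin 1 (eps / 3))) as [ X HX ].
    { apply Rmin_glb_lt; lra. }
    exists X. intros x Hx. pose proof (HX x Hx) as Hb.
    pose proof (Rmin_l 1 (eps / 3)). pose proof (Rmin_r 1 (eps / 3)).
    eapply Rle_trans; [ apply Cexpo_sub1_le; lra | lra ]. }
  apply limoo_ext with (f := fun x => (Cexpo c * Cexpo (f x - c))%C) (X0 := 0).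
  - intros x _. rewrite <- Cexpo_plus. f_equal. ring.
  - pose proof (limoo_scal (Cexpo c) _ _ H0) as H1. rewrite Cmult_1_r in H1. exact H1.
Qed.

Lemma limoo_unique (f : R -> C) (c d : C) : limoo f c -> limoo f d -> c = d.
Proof.
  intros Hc Hd.
  assert (H : Cmod (c - d) <= 0).
  { apply le_epsilon. intros eps He.
    destruct (Hc (eps / 2) ltac:(lra)) as [ X HX ]. destruct (Hd (eps / 2) ltac:(lra)) as [ Y HY ].
    pose proof (HX _ (Rmax_l X Y)) as H1. pose proof (HY _ (Rmax_r X Y)) as H2.
    replace (c - d)%C with ((f (Rmax X Y) - d) + - (f (Rmax X Y) - c))%C by ring.
    eapply Rle_trans; [ apply Cmod_triangle | ]. rewrite Cmod_opp. lra. }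
  assert (E : (c - d = 0)%C) by (apply Cmod_eq_0; pose proof (Cmod_ge_0 (c - d)); lra).
  replace c with ((c - d) + d)%C by ring. rewrite E. ring.
Qed.

Lemma Rpower_small (s eps : R) : 0 < s -> 0 < eps -> exists X, 1 <= X /\ forall x, X <= x -> Rpower x (- s) <= eps.
Proof.
  intros Hs He. exists (Rmax 1 (Rpower eps (- / s))). split; [ apply Rmax_l | ].
  intros x Hx. pose proof (Rmax_r 1 (Rpower eps (- / s))).
  eapply Rle_trans; [ apply (Rpower_antitone _ (Rpower eps (- / s))) | ].
  - split; [ apply exp_pos | lra ].
  - lra.
  - rewrite Rpower_mult. replace (- / s * - s) with 1 by (field; lra). rewrite Rpower_1 by exact He. lra.
Qed.

Lemma limoo_of_Rpower (f : R -> C) (K s X0 : R) : 0 < s ->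
  (forall x, X0 <= x -> Cmod (f x) <= K * Rpower x (- s)) -> limoo f 0%C.
Proof.
  intros Hs H eps He.
  destruct (Rpower_small s (eps / (Rabs K + 1))) as [ X [ HX1 HX ] ]; [ exact Hs | | ].
  { apply Rdiv_lt_0_compat; [ exact He | pose proof (Rabs_pos K); lra ]. }
  exists (Rmax X X0). intros x Hx. pose proof (Rmax_l X X0). pose proof (Rmax_r X X0).
  replace (f x - 0)%C with (f x) by ring.
  eapply Rle_trans; [ apply H; lra | ].
  pose proof (HX x ltac:(lra)) as Hb. pose proof (Rabs_pos K) as HK. pose proof (Rle_abs K).
  assert (Hp : 0 < Rpower x (- s)) by apply exp_pos.
  apply Rle_trans with ((Rabs K + 1) * (eps / (Rabs K + 1))).
  - apply Rle_trans with ((Rabs K + 1) * Rpower x (- s)).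
    + apply Rmult_le_compat_r; lra.
    + apply Rmult_le_compat_l; lra.
  - right; field; lra.
Qed.

(** * Powers and primitives on the positive axis *)

Lemma Clog_pos (x : R) : 0 < x -> Clog (RtoC x) = RtoC (ln x).
Proof.
  intros Hx. replace (RtoC x) with (Cexpo (RtoC (ln x))) by (rewrite Cexpo_R, exp_ln; auto).
  apply Clog_Cexpo. simpl. pose proof PI_RGT_0. lra.
Qed.

Lemma Cpowc_pos (x : R) (s : C) : 0 < x -> Cpowc (RtoC x) s = Cexpo (s * RtoC (ln x)).
Proof.
  intros Hx. unfold Cpowc. rewrite Cmod_R, Rabs_pos_eq by lra.
  destruct (Req_EM_T x 0) as [ E | _ ]; [ lra | ]. rewrite Clog_pos by exact Hx. reflexivity.
Qed.

Lemma Cpowc_Rpower (x s : R) : 0 < x -> Cpowc (RtoC x) (RtoC s) = RtoC (Rpower x s).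
Proof.
  intros Hx. rewrite Cpowc_pos by exact Hx. rewrite <- RtoC_mult, Cexpo_R. reflexivity.
Qed.

Lemma Cder_Rpower (s x : R) : 0 < x ->
  Cder (fun t => RtoC (Rpower t s)) x (RtoC (s * Rpower x (s - 1))).
Proof.
  intros Hx. apply Cder_RtoC. unfold Rpower. auto_derive; [ exact Hx | ].
  replace ((s - 1) * ln x) with (s * ln x + - ln x) by ring.
  rewrite exp_plus, exp_Ropp, exp_ln by exact Hx. field. lra.
Qed.

Lemma primitive_exists (p : R -> R) : (forall x, 0 <= x -> continuous p x) ->
  exists P, P 0 = 0 /\ forall x, 0 <= x -> is_derive P x (p x).
Proof.
  intros Hp.
  (* Continuity is known on [[0, oo)] only. Composing with [Rabs] extends [p] to the whole line,
     which gives the primitive a two-sided derivative at 0. *)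
  assert (Hc : forall x, continuous (fun t => p (Rabs t)) x).
  { intros x. apply (continuous_comp Rabs p); [ apply continuous_Rabs | apply Hp, Rabs_pos ]. }
  exists (fun x => RInt (fun t => p (Rabs t)) 0 x). split.
  - apply (RInt_point (V := R_CompleteNormedModule)).
  - intros x Hx. replace (p x) with (p (Rabs x)) by (rewrite Rabs_pos_eq; auto).
    apply (is_derive_RInt (fun t => p (Rabs t)) _ 0 x).
    + apply filter_forall. intros y. apply (RInt_correct (V := R_CompleteNormedModule)).
      apply (ex_RInt_continuous (V := R_CompleteNormedModule)). intros z _. apply Hc.
    + apply Hc.
Qed.

Lemma action_exists (g g' : R -> C) : (forall x, 0 <= x -> Cder g x (g' x)) ->
  exists S : R -> C, S 0 = 0%C /\ forall x, 0 <= x -> Cder S x (g x).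
Proof.
  intros H.
  destruct (primitive_exists (fun x => Re (g x))) as [ P1 [ H10 H1 ] ].
  { intros x Hx. eapply Cder_continuous_Re, H, Hx. }
  destruct (primitive_exists (fun x => Im (g x))) as [ P2 [ H20 H2 ] ].
  { intros x Hx. eapply Cder_continuous_Im, H, Hx. }
  exists (fun x => (P1 x, P2 x) : C). split.
  - rewrite H10, H20. reflexivity.
  - intros x Hx. split; simpl; [ apply H1 | apply H2 ]; exact Hx.
Qed.

(** * Expansion of the square root of the potential at infinity *)

Lemma isO_small (f : R -> C) (eps : R) : isO 1 f -> 0 < eps ->
  exists X, 1 <= X /\ forall x, X <= x -> Cmod (f (/ x)) <= eps.
Proof.
  intros [ K [ HK H ] ] He.
  exists (Rmax 1 ((K + 1) / eps)). split; [ apply Rmax_l | ]. intros x Hx.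
  pose proof (Rmax_l 1 ((K + 1) / eps)). pose proof (Rmax_r 1 ((K + 1) / eps)).
  assert (Hi : 0 < / x <= 1).
  { split; [ apply Rinv_0_lt_compat; lra | rewrite <- Rinv_1; apply Rinv_le_contravar; lra ]. }
  eapply Rle_trans; [ apply H; exact Hi | ]. rewrite pow_1.
  apply Rmult_le_reg_r with x; [ lra | ].
  replace (K * / x * x) with K by (field; lra).
  assert ((K + 1) / eps * eps = K + 1) by (field; lra). nra.
Qed.

Definition etaQ (m : nat) (a : nat -> C) (lam : C) (t : R) : C :=
  (revP m a (RtoC t) + lam * Cpow (RtoC t) m)%C.

Lemma etaQ_isO (m : nat) (a : nat -> C) (lam : C) : (1 <= m)%nat -> isO 1 (etaQ m a lam).
Proof.
  intros Hm. apply isO_plus; [ apply revP_isO | apply isO_scal ].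
  apply isO_weaken with (n := m); [ exact Hm | apply isO_pow ].
Qed.

Lemma Qpot_etaQ (m : nat) (a : nat -> C) (lam : C) (x : R) : 0 < x ->
  Qpot m a lam x = (Cpow (RtoC x) m * (1 + etaQ m a lam (/ x)))%C.
Proof.
  intros Hx. assert (Hx0 : RtoC x <> 0%C) by (apply RtoC_neq0; lra).
  assert (Hi : RtoC (/ x) = (/ RtoC x)%C) by (apply RtoC_inv; lra).
  unfold Qpot, etaQ. rewrite revP_Pval; [ | rewrite Hi ].
  - rewrite Hi, Cpow_inv by exact Hx0.
    replace (/ / RtoC x)%C with (RtoC x) by (field; exact Hx0).
    field. apply Cpow_nz, Hx0.
  - intros E. apply Hx0. rewrite <- (Cmult_1_l (RtoC x)), <- (Cinv_l (RtoC x)) at 1 by exact Hx0.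
    rewrite E. ring.
Qed.

(** The positive factor [x^m] contributes no argument, so the logarithm of the product splits
    without a multiple of [2 pi i]. *)
Lemma Clog_Qpot (m : nat) (a : nat -> C) (lam : C) (x : R) : 0 < x ->
  Cmod (etaQ m a lam (/ x)) <= 1 / 2 ->
  Clog (Qpot m a lam x) = (RtoC (INR m * ln x) + Clog (1 + etaQ m a lam (/ x)))%C.
Proof.
  intros Hx He. destruct (Clog_1_plus _ He) as [ Hc [ Hexp _ ] ].
  rewrite <- Clog_Cexpo.
  - f_equal. rewrite Cexpo_plus, Hexp, Qpot_etaQ by exact Hx. f_equal.
    rewrite RtoC_mult, Cexpo_nat, Cexpo_R, exp_ln by exact Hx. reflexivity.
  - pose proof (Im_Clog_bound _ Hc). simpl Im in *. unfold Im in H |- *. simpl. lra.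
Qed.

Lemma limoo_Clog_Qpot (m : nat) (a : nat -> C) (lam : C) : (1 <= m)%nat ->
  limoo (fun x => Clog (Qpot m a lam x) - RtoC (INR m * ln x))%C 0%C.
Proof.
  intros Hm eps He.
  destruct (isO_small (etaQ m a lam) (Rmin (1/2) (eps / 4)) (etaQ_isO m a lam Hm)) as [ X [ HX1 HX ] ].
  { apply Rmin_glb_lt; lra. }
  exists X. intros x Hx. pose proof (HX x Hx) as Hb.
  pose proof (Rmin_l (1/2) (eps / 4)). pose proof (Rmin_r (1/2) (eps / 4)).
  rewrite Clog_Qpot by lra.
  destruct (Clog_1_plus (etaQ m a lam (/ x))) as [ _ [ _ H3 ] ]; [ lra | ].
  replace (RtoC (INR m * ln x) + Clog (1 + etaQ m a lam (/ x)) - RtoC (INR m * ln x) - 0)%C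
    with (Clog (1 + etaQ m a lam (/ x))) by ring. lra.
Qed.

Lemma Csqrtp_Qpot (m : nat) (a : nat -> C) (lam : C) (x : R) : Qpot m a lam x <> 0%C ->
  Csqrtp (Cpow (RtoC x) m + Pval m a (RtoC x) + lam) = qroot (Qpot m a lam) (1/2) x.
Proof.
  intros H. unfold Csqrtp, Cpowc. fold (Qpot m a lam x).
  destruct (Req_EM_T (Cmod (Qpot m a lam x)) 0) as [ E | _ ].
  - exfalso. apply H, Cmod_eq_0, E.
  - reflexivity.
Qed.

(** A primitive of the powers subtracted in the integrand of [L], namely [F] on the positive axis.
    Its exponents are positive: the term that would integrate to a logarithm is treated separately
    through [nu]. *)
Definition Fprim (m : nat) (a : nat -> C) (x : R) : C :=
  (RtoC (2 / (INR m + 2)) * RtoC (Rpower x ((INR m + 2) / 2))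
   + Csum (seq 1 ((m + 1) / 2))
       (fun j => RtoC (2 / (INR m + 2 - 2 * INR j)) * bj m a j
                 * RtoC (Rpower x ((INR m + 2 - 2 * INR j) / 2))))%C.

Lemma Fexp_pos (m : nat) (a : nat -> C) (x : R) : 0 < x -> Fexp m a (RtoC x) = Fprim m a x.
Proof.
  intros Hx. unfold Fexp, Fprim. rewrite Cpowc_Rpower by exact Hx. f_equal.
  apply Csum_ext. intros j _. rewrite Cpowc_Rpower by exact Hx. reflexivity.
Qed.

Lemma index_range (m j : nat) : In j (seq 1 ((m + 1) / 2)) -> 0 < INR m + 2 - 2 * INR j.
Proof.
  intros Hj. apply in_seq in Hj.
  assert (H : (2 * j <= m + 1)%nat).
  { pose proof (Nat.Div0.mul_div_le (m + 1) 2). lia. }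
  apply le_INR in H. rewrite mult_INR, plus_INR in H. simpl in H. lra.
Qed.

Lemma Cder_Fprim (m : nat) (a : nat -> C) (x : R) : 0 < x ->
  Cder (Fprim m a) x (RtoC (Rpower x (INR m / 2))
    + Csum (seq 1 ((m + 1) / 2)) (fun j => bj m a j * RtoC (Rpower x (INR m / 2 - INR j))))%C.
Proof.
  intros Hx. pose proof (INR_plus2_pos m). unfold Fprim. apply Cder_plus.
  - eapply Cder_eq; [ apply Cder_scal, Cder_Rpower, Hx | ].
    rewrite <- RtoC_mult. f_equal.
    replace ((INR m + 2) / 2 - 1) with (INR m / 2) by field. field. lra.
  - apply (Cder_Csum _ (fun j t => RtoC (2 / (INR m + 2 - 2 * INR j)) * bj m a j
                 * RtoC (Rpower t ((INR m + 2 - 2 * INR j) / 2)))%C).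
    intros j Hj. pose proof (index_range m j Hj) as Hp.
    eapply Cder_eq; [ apply Cder_scal, Cder_Rpower, Hx | ].
    replace ((INR m + 2 - 2 * INR j) / 2 - 1) with (INR m / 2 - INR j) by field.
    replace (RtoC (2 / (INR m + 2 - 2 * INR j)) * bj m a j
      * RtoC ((INR m + 2 - 2 * INR j) / 2 * Rpower x (INR m / 2 - INR j)))%C
      with (bj m a j * RtoC (2 / (INR m + 2 - 2 * INR j) * ((INR m + 2 - 2 * INR j) / 2 * Rpower x (INR m / 2 - INR j))))%C
      by (rewrite (RtoC_mult (2 / _)); ring).
    do 2 f_equal. field. lra.
Qed.

(** Compares the number of powers subtracted in [L] with the order [m/2 + 1] of the expansion: equal
    for odd [m], one less for even [m], where the additional term is the one in [1/x]. *)
Lemma half_succ (m : nat) : ((m + 1) / 2)%nat = if Nat.even m then (m / 2)%nat else (m / 2 + 1)%nat.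
Proof.
  destruct (Nat.even m) eqn:E.
  - apply Nat.even_spec in E. destruct E as [ p -> ].
    rewrite (Nat.mul_comm 2 p), Nat.div_mul by lia.
    rewrite Nat.div_add_l by lia. simpl. lia.
  - assert (O : Nat.odd m = true) by (unfold Nat.odd; rewrite E; reflexivity).
    apply Nat.odd_spec in O. destruct O as [ p -> ].
    replace (2 * p + 1 + 1)%nat with ((p + 1) * 2)%nat by lia. rewrite Nat.div_mul by lia.
    replace (2 * p + 1)%nat with (p * 2 + 1)%nat by lia. rewrite Nat.div_add_l by lia. simpl. lia.
Qed.

Lemma Rpower_shift (x s : R) (j : nat) : 0 < x -> Rpower x (s - INR j) = Rpower x s * (/ x) ^ j.
Proof.
  intros Hx. unfold Rminus. rewrite Rpower_plus, Rpower_Ropp, Rpower_pow, pow_inv by exact Hx.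
  reflexivity.
Qed.

(* What is left of L_integrand once the square root is replaced by its expansion to order
   m/2 + 1: nothing for m odd, and nu (1/x - 1/(x+1)) for m even. *)
Lemma expansion_remainder (m : nat) (a : nat -> C) (x : R) : 1 <= x ->
  Cmod (RtoC (Rpower x (INR m / 2)) * bpoly m a (m / 2 + 1) (RtoC (/ x))
     - RtoC (Rpower x (INR m / 2))
     - Csum (seq 1 ((m + 1) / 2)) (fun j => bj m a j * RtoC (Rpower x (INR m / 2 - INR j)))
     - nu m a / RtoC (x + 1))%C <= Cmod (nu m a) * Rpower x (-3/2).
Proof.
  intros Hx.
  assert (Hs : forall n, Csum (seq 1 n) (fun j => bj m a j * RtoC (Rpower x (INR m / 2 - INR j)))%C
     = (RtoC (Rpower x (INR m / 2)) * Csum (seq 1 n) (fun j => bj m a j * Cpow (RtoC (/ x)) j))%C).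
  { intros n. rewrite <- Csum_scal. apply Csum_ext. intros j _.
    rewrite Rpower_shift, RtoC_mult, RtoC_pow by lra. ring. }
  rewrite half_succ. unfold bpoly, nu. destruct (Nat.even m) eqn:E.
  - rewrite Nat.add_1_r, Csum_seq_S, Hs. change (1 + m / 2)%nat with (S (m / 2)).
    set (N := S (m / 2)). set (Sg := Csum _ _).
    assert (EN : (RtoC (Rpower x (INR m / 2)) * Cpow (RtoC (/ x)) N)%C = RtoC (/ x)).
    { rewrite <- RtoC_pow, <- RtoC_mult. f_equal. rewrite <- Rpower_shift by lra.
      apply Nat.even_spec in E. destruct E as [ p Ep ].
      replace (INR m / 2 - INR N) with (- (1)).
      - rewrite Rpower_Ropp, Rpower_1 by lra. reflexivity.
      - unfold N. rewrite Ep, (Nat.mul_comm 2 p), Nat.div_mul, S_INR, mult_INR by lia. simpl. field. }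
    replace (RtoC (Rpower x (INR m / 2)) * (1 + (Sg + bj m a N * Cpow (RtoC (/ x)) N))
      - RtoC (Rpower x (INR m / 2)) - RtoC (Rpower x (INR m / 2)) * Sg - bj m a N / RtoC (x + 1))%C
      with (bj m a N * (RtoC (Rpower x (INR m / 2)) * Cpow (RtoC (/ x)) N) - bj m a N / RtoC (x + 1))%C
      by ring.
    rewrite EN.
    replace (bj m a N * RtoC (/ x) - bj m a N / RtoC (x + 1))%C
      with (bj m a N * RtoC (/ x - / (x + 1)))%C
      by (rewrite RtoC_minus, (RtoC_inv (x + 1)) by lra; unfold Cdiv; ring).
    rewrite Cmod_mult. apply Rmult_le_compat_l; [ apply Cmod_ge_0 | ].
    rewrite Cmod_R, Rabs_pos_eq.
    + apply Rle_trans with (Rpower x (-2)).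
      * replace (-2) with (- INR 2) by (simpl; ring). rewrite Rpower_Ropp, Rpower_pow by lra.
        replace (/ x - / (x + 1)) with (/ (x * (x + 1))) by (field; lra).
        apply Rinv_le_contravar; [ nra | simpl; nra ].
      * apply Rle_Rpower; lra.
    + assert (/ (x + 1) <= / x) by (apply Rinv_le_contravar; lra). lra.
  - rewrite Hs. set (Sg := Csum _ _).
    replace (_ - _ - _ - _)%C with (RtoC 0) by (unfold Cdiv; ring).
    rewrite Cmod_0. lra.
Qed.

(** The root [sg] of [1 + eta] and the polynomial [T] have squares that agree to order [S N], and
    [sg + T] stays away from 0, so they agree to the same order themselves. The factor [x^(m/2)]
    leaves [x^(-3/2)] for odd and [x^(-2)] for even [m]. The term with [lam] is of order [t^m] and
    falls into the remainder because [S N <= m], which uses [m >= 3]. *)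
Lemma L_integrand_bound (m : nat) (a : nat -> C) (lam : C) : (3 <= m)%nat ->
  exists K X, 1 <= X /\ 0 <= K /\ forall x, X <= x -> Cmod (L_integrand m a lam x) <= K * Rpower x (-3/2).
Proof.
  intros Hm. set (N := (m / 2 + 1)%nat).
  assert (HN : (S N <= m)%nat).
  { unfold N. pose proof (Nat.Div0.mul_div_le m 2). destruct (Nat.eq_dec m 3) as [ -> | ]; [ simpl; lia | lia ]. }
  assert (HNr : INR m / 2 - INR (S N) <= -3/2).
  { unfold N. assert (Hd : (m <= 2 * (m / 2) + 1)%nat).
    { pose proof (Nat.div_mod_eq m 2). pose proof (Nat.mod_upper_bound m 2). lia. }
    apply le_INR in Hd. rewrite plus_INR, mult_INR in Hd. rewrite S_INR, plus_INR. simpl in *. lra. }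
  assert (HO : isO (S N) (fun t => (1 + etaQ m a lam t) - bpoly m a N (RtoC t) * bpoly m a N (RtoC t))%C).
  { apply isO_ext with (f := fun t => (lam * Cpow (RtoC t) m
       + (- (1)) * (bpoly m a N (RtoC t) * bpoly m a N (RtoC t) - (1 + revP m a (RtoC t))))%C).
    - intros t _. unfold etaQ. ring.
    - apply isO_plus.
      + apply isO_scal. apply isO_weaken with (n := m); [ exact HN | apply isO_pow ].
      + apply isO_scal. apply bpoly_square; unfold N; lia. }
  assert (HT : isO 1 (fun t => bpoly m a N (RtoC t) - 1)%C).
  { apply isO_ext with (f := fun t => Csum (seq 1 N) (fun j => bj m a j * Cpow (RtoC t) j)%C).
    - intros t _. unfold bpoly. ring.
    - apply (isO_Csum 1 _ (fun j t => bj m a j * Cpow (RtoC t) j)%C). intros j Hj. apply in_seq in Hj.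
      apply isO_scal. apply isO_weaken with (n := j); [ lia | apply isO_pow ]. }
  (* From 1/12 the logarithm of [1 + eta] is at most 1/3, its half at most 1/6, and [sg - 1] at most
     1/2. As [T - 1] is also at most 1/2, [sg + T] has modulus at least 1. *)
  destruct (isO_small _ (1/12) (etaQ_isO m a lam ltac:(lia))) as [ X1 [ HX1 HX1' ] ]; [ lra | ].
  destruct (isO_small _ (1/2) HT) as [ X2 [ HX2 HX2' ] ]; [ lra | ].
  destruct HO as [ K [ HK HKt ] ].
  exists (K + Cmod (nu m a)), (Rmax X1 X2).
  split; [ pose proof (Rmax_l X1 X2); lra | ].
  split; [ pose proof (Cmod_ge_0 (nu m a)); lra | ].
  intros x Hx. pose proof (Rmax_l X1 X2). pose proof (Rmax_r X1 X2).
  assert (Hx1 : 1 <= x) by lra.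
  pose proof (HX1' x ltac:(lra)) as He. pose proof (HX2' x ltac:(lra)) as HTx. cbv beta in HTx.
  set (eta := etaQ m a lam (/ x)) in *. set (T := bpoly m a N (RtoC (/ x))) in *.
  destruct (Clog_1_plus eta) as [ Hc [ Hexp Hl ] ]; [ lra | ].
  set (sg := Cexpo (RtoC (1/2) * Clog (1 + eta))).
  assert (Hsg2 : (sg * sg)%C = (1 + eta)%C).
  { transitivity (Cexpo (Clog (1 + eta))); [ | exact Hexp ].
    unfold sg. rewrite <- Cexpo_plus. f_equal.
    rewrite <- Cmult_plus_distr_r, <- RtoC_plus. replace (1/2 + 1/2) with 1 by field. ring. }
  assert (Hsg1 : Cmod (sg - 1) <= 1/2).
  { assert (Hh : Cmod (RtoC (1/2) * Clog (1 + eta)) <= 1/6).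
    { rewrite Cmod_mult, Cmod_R, Rabs_pos_eq by lra. lra. }
    eapply Rle_trans; [ apply Cexpo_sub1_le; lra | lra ]. }
  assert (Hsum : 1 <= Cmod (sg + T)).
  { pose proof (Cmod_rev_triangle 2 ((sg - 1) + (T - 1))) as H1.
    pose proof (Cmod_triangle (sg - 1) (T - 1)) as H2.
    replace (2 + (sg - 1 + (T - 1)))%C with (sg + T)%C in H1 by ring.
    rewrite (Cmod_R 2), Rabs_pos_eq in H1 by lra. lra. }
  assert (Hti : 0 < / x <= 1).
  { split; [ apply Rinv_0_lt_compat; lra | rewrite <- Rinv_1; apply Rinv_le_contravar; lra ]. }
  assert (Hdiff : Cmod (sg - T) <= K * (/ x) ^ (S N)).
  { eapply Rle_trans; [ | apply (HKt (/ x) Hti) ]. cbv beta. fold eta T.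
    rewrite <- Hsg2. replace (sg * sg - T * T)%C with ((sg - T) * (sg + T))%C by ring.
    rewrite Cmod_mult. pose proof (Cmod_ge_0 (sg - T)). nra. }
  assert (Hxm : Cpow (RtoC x) m <> 0%C) by (apply Cpow_nz, RtoC_neq0; lra).
  assert (HQ : Qpot m a lam x <> 0%C).
  { rewrite Qpot_etaQ by lra. fold eta. apply Cmult_neq_0; [ exact Hxm | apply offcut_neq0, Hc ]. }
  assert (Hq : qroot (Qpot m a lam) (1/2) x = (RtoC (Rpower x (INR m / 2)) * sg)%C).
  { unfold qroot. rewrite Clog_Qpot by (fold eta; lra). fold eta.
    rewrite Cmult_plus_distr_l, Cexpo_plus. f_equal.
    rewrite <- RtoC_mult, Cexpo_R. unfold Rpower. do 2 f_equal. field. }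
  unfold L_integrand. rewrite Csqrtp_Qpot, Hq by exact HQ.
  pose proof (expansion_remainder m a x Hx1) as Hrem. fold N T in Hrem.
  set (Sg := Csum _ _) in *. set (p := RtoC (Rpower x (INR m / 2))) in *.
  replace (p * sg - p - Sg - nu m a / RtoC (x + 1))%C
    with (p * (sg - T) + (p * T - p - Sg - nu m a / RtoC (x + 1)))%C by ring.
  eapply Rle_trans; [ apply Cmod_triangle | ]. rewrite Rmult_plus_distr_r.
  apply Rplus_le_compat; [ | exact Hrem ].
  rewrite Cmod_mult. unfold p. rewrite Cmod_R, Rabs_pos_eq by (left; apply exp_pos).
  apply Rle_trans with (Rpower x (INR m / 2) * (K * (/ x) ^ S N)).
  - apply Rmult_le_compat_l; [ left; apply exp_pos | exact Hdiff ].
  - replace (Rpower x (INR m / 2) * (K * (/ x) ^ S N)) with (K * Rpower x (INR m / 2 - INR (S N)))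
      by (rewrite Rpower_shift by lra; ring).
    apply Rmult_le_compat_l; [ exact HK | ]. apply Rle_Rpower; assumption.
Qed.

(** * The integral L as the limit of a regularised action *)

Lemma limoo_filterlim (f : R -> C) (c : C) : limoo f c ->
  filterlim (fun x => Re (f x)) (Rbar_locally p_infty) (locally (Re c)) /\
  filterlim (fun x => Im (f x)) (Rbar_locally p_infty) (locally (Im c)).
Proof.
  intros H. split; apply filterlim_locally; intros eps;
    (destruct (H (eps / 2)) as [ X HX ]; [ pose proof (cond_pos eps); lra | ]);
    exists X; intros x Hx; pose proof (HX x (Rlt_le _ _ Hx)) as Hb; pose proof (cond_pos eps).
  - apply Rle_lt_trans with (Cmod (f x - c)); [ | lra ].
    eapply Rle_trans; [ | apply re_le_Cmod ]. right. reflexivity.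
  - apply Rle_lt_trans with (Cmod (f x - c)); [ | lra ].
    eapply Rle_trans; [ | apply Im_le_Cmod ]. right. reflexivity.
Qed.

Lemma limoo_inv_filterlim (f : R -> C) : limoo (fun t => f (/ t)) 0%C ->
  filterlim (fun x => Re (f x)) (at_right 0) (locally 0) /\
  filterlim (fun x => Im (f x)) (at_right 0) (locally 0).
Proof.
  intros H.
  assert (E : forall eps : posreal, at_right 0 (fun x => Cmod (f x) < eps)).
  { intros eps. destruct (H (eps / 2)) as [ X HX ]; [ pose proof (cond_pos eps); lra | ].
    pose proof (Rmax_l 1 X). pose proof (Rmax_r 1 X).
    assert (Hd : 0 < / Rmax 1 X) by (apply Rinv_0_lt_compat; lra).
    exists (mkposreal _ Hd). intros x Hx Hx0.
    change (Rabs (x - 0) < / Rmax 1 X) in Hx. rewrite Rminus_0_r, Rabs_pos_eq in Hx by lra.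
    pose proof (HX (/ x)) as Hb. rewrite Rinv_inv in Hb.
    replace (f x - 0)%C with (f x) in Hb by ring. pose proof (cond_pos eps).
    assert (X <= / x); [ | specialize (Hb H3); lra ].
    apply Rle_trans with (Rmax 1 X); [ lra | ]. left.
    rewrite <- (Rinv_inv (Rmax 1 X)). apply Rinv_lt_contravar; [ nra | exact Hx ]. }
  split; apply filterlim_locally; intros eps; generalize (E eps); apply filter_imp; intros x Hx.
  - apply Rle_lt_trans with (Cmod (f x)); [ | exact Hx ].
    eapply Rle_trans; [ | apply re_le_Cmod ]. right.
    change (Rabs (Re (f x) - 0) = Rabs (Re (f x))). f_equal. ring.
  - apply Rle_lt_trans with (Cmod (f x)); [ | exact Hx ].
    eapply Rle_trans; [ | apply Im_le_Cmod ]. right.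
    change (Rabs (Im (f x) - 0) = Rabs (Im (f x))). f_equal. ring.
Qed.

Lemma real_cauchy_limit (p : R -> R) :
  (forall eps, 0 < eps -> exists X, forall x y, X <= x <= y -> Rabs (p y - p x) <= eps) ->
  exists l, filterlim p (Rbar_locally p_infty) (locally l).
Proof.
  intros H. apply (proj1 (filterlim_locally_cauchy (U := R_CompleteSpace) p)).
  intros eps. destruct (H (eps / 2)) as [ X HX ]; [ pose proof (cond_pos eps); lra | ].
  pose proof (cond_pos eps).
  exists (fun x => X < x). split; [ exists X; auto | ].
  intros u v Hu Hv. change (Rabs (p v - p u) < eps).
  destruct (Rle_lt_dec u v).
  - pose proof (HX u v ltac:(lra)). lra.
  - rewrite Rabs_minus_sym. pose proof (HX v u ltac:(lra)). lra.
Qed.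

Lemma limoo_of_cauchy (f : R -> C) :
  (forall eps, 0 < eps -> exists X, forall x y, X <= x <= y -> Cmod (f y - f x) <= eps) ->
  exists c, limoo f c.
Proof.
  intros H.
  destruct (real_cauchy_limit (fun x => Re (f x))) as [ l1 H1 ].
  { intros eps He. destruct (H eps He) as [ X HX ]. exists X. intros x y Hxy.
    eapply Rle_trans; [ | apply (HX x y Hxy) ]. eapply Rle_trans; [ | apply re_le_Cmod ].
    right. reflexivity. }
  destruct (real_cauchy_limit (fun x => Im (f x))) as [ l2 H2 ].
  { intros eps He. destruct (H eps He) as [ X HX ]. exists X. intros x y Hxy.
    eapply Rle_trans; [ | apply (HX x y Hxy) ]. eapply Rle_trans; [ | apply Im_le_Cmod ].
    right. reflexivity. }
  exists (l1, l2). intros eps He.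
  assert (He2 : 0 < eps / 2) by lra.
  destruct (proj1 (filterlim_locally (U := R_UniformSpace) _ _) H1 (mkposreal _ He2)) as [ X HX ].
  destruct (proj1 (filterlim_locally (U := R_UniformSpace) _ _) H2 (mkposreal _ He2)) as [ Y HY ].
  exists (Rmax X Y + 1). intros x Hx. pose proof (Rmax_l X Y). pose proof (Rmax_r X Y).
  pose proof (HX x ltac:(lra)) as G1. pose proof (HY x ltac:(lra)) as G2.
  change (Rabs (Re (f x) - l1) < eps / 2) in G1. change (Rabs (Im (f x) - l2) < eps / 2) in G2.
  eapply Rle_trans; [ apply Cmod_le_ReIm | ].
  change (Re (f x - (l1, l2))) with (Re (f x) - l1).
  change (Im (f x - (l1, l2))) with (Im (f x) - l2). lra.
Qed.

(** The lower end is treated as improper too, since for odd [m] the integrand of [L] contains a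
    multiple of [x^(-1/2)]. *)
Lemma RInt_gen_of_primitive (p p' q : R -> R) (l : R) :
  (forall x, 0 < x -> is_derive p x (p' x)) ->
  (forall x, 0 < x -> continuous p' x) ->
  (forall x, 0 < x -> q x = p' x) ->
  filterlim p (at_right 0) (locally 0) ->
  filterlim p (Rbar_locally p_infty) (locally l) ->
  RInt_gen q (at_right 0) (Rbar_locally p_infty) = l.
Proof.
  intros Hp Hc Hq H0 Hl. apply is_RInt_gen_unique.
  assert (Hpos : filter_prod (at_right 0) (Rbar_locally p_infty)
            (fun ab : R * R => forall x, Rmin (fst ab) (snd ab) <= x -> 0 < x)).
  { apply Filter_prod with (Q := fun a => 0 < a) (R := fun b => 0 < b).
    - exists (mkposreal 1 Rlt_0_1). intros y _ Hy. exact Hy.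
    - exists 0. auto.
    - intros a b Ha Hb x. simpl. unfold Rmin. destruct (Rle_dec a b); lra. }
  apply is_RInt_gen_ext with (f := Derive p).
  - revert Hpos. apply filter_imp. intros ab H x Hx. rewrite Hq by (apply H; lra).
    apply is_derive_unique, Hp, H. lra.
  - replace l with (l - 0) by ring. apply is_RInt_gen_Derive; try assumption.
    + revert Hpos. apply filter_imp. intros ab H x Hx. eexists. apply Hp, H. lra.
    + revert Hpos. apply filter_imp. intros ab H x Hx.
      assert (Hx0 : 0 < x) by (apply H; lra).
      apply continuous_ext_loc with (g := p'); [ | apply Hc, Hx0 ].
      exists (mkposreal x Hx0). intros y Hy. change (Rabs (y - x) < x) in Hy.
      apply Rabs_lt_between in Hy. symmetry. apply is_derive_unique, Hp. lra.
Qed.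

Lemma limoo_Csum0 (l : list nat) (f : nat -> R -> C) :
  (forall i, In i l -> limoo (f i) 0%C) -> limoo (fun x => Csum l (fun i => f i x)) 0%C.
Proof.
  induction l as [ | i l IH ]; intros H.
  - apply (limoo_const 0).
  - replace (RtoC 0) with (0 + 0)%C by ring.
    apply (limoo_plus (f i) (fun t => Csum l (fun i => f i t))).
    + apply H. left; reflexivity.
    + apply IH. intros j Hj. apply H. right; exact Hj.
Qed.

Lemma limoo_scal0 (k : C) (f : R -> C) : limoo f 0%C -> limoo (fun x => k * f x)%C 0%C.
Proof. intros H. rewrite <- (Cmult_0_r k). apply limoo_scal, H. Qed.

Lemma limoo_Rpower_inv (s : R) : 0 < s -> limoo (fun t => RtoC (Rpower (/ t) s)) 0%C.
Proof.
  intros Hs. apply limoo_of_Rpower with (K := 1) (s := s) (X0 := 1); [ exact Hs | ].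
  intros x Hx. rewrite Cmod_R, Rabs_pos_eq by (left; apply exp_pos).
  right. unfold Rpower. rewrite ln_Rinv by lra. rewrite Rmult_1_l. f_equal. ring.
Qed.

Lemma limoo_at_0 (S : R -> C) (l : C) : S 0 = 0%C -> Cder S 0 l -> limoo (fun t => S (/ t)) 0%C.
Proof.
  intros H0 H eps He.
  pose proof (Cder_continuous_Re _ _ _ H) as C1. pose proof (Cder_continuous_Im _ _ _ H) as C2.
  assert (He2 : 0 < eps / 2) by lra.
  destruct (proj1 (filterlim_locally (U := R_UniformSpace) _ _) C1 (mkposreal _ He2)) as [ d1 D1 ].
  destruct (proj1 (filterlim_locally (U := R_UniformSpace) _ _) C2 (mkposreal _ He2)) as [ d2 D2 ].
  exists (1 + / Rmin d1 d2). intros x Hx.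
  assert (Hd : 0 < Rmin d1 d2) by (apply Rmin_glb_lt; apply cond_pos).
  assert (Hd' : 0 < / Rmin d1 d2) by (apply Rinv_0_lt_compat, Hd).
  assert (Hix : 0 < / x) by (apply Rinv_0_lt_compat; lra).
  assert (Hxd : / x < Rmin d1 d2).
  { rewrite <- (Rinv_inv (Rmin d1 d2)). apply Rinv_lt_contravar; [ nra | lra ]. }
  pose proof (Rmin_l d1 d2). pose proof (Rmin_r d1 d2).
  assert (G1 : Rabs (Re (S (/ x)) - Re (S 0)) < eps / 2).
  { apply D1. change (Rabs (/ x - 0) < d1). rewrite Rminus_0_r, Rabs_pos_eq; lra. }
  assert (G2 : Rabs (Im (S (/ x)) - Im (S 0)) < eps / 2).
  { apply D2. change (Rabs (/ x - 0) < d2). rewrite Rminus_0_r, Rabs_pos_eq; lra. }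
  rewrite <- H0. eapply Rle_trans; [ apply Cmod_le_ReIm | ].
  change (Re (S (/ x) - S 0)) with (Re (S (/ x)) - Re (S 0)).
  change (Im (S (/ x) - S 0)) with (Im (S (/ x)) - Im (S 0)). lra.
Qed.

(** [S - F - nu ln (x + 1)] is a primitive of the integrand of [L]. It tends to 0 at 0, as the
    exponents in [F] are positive and [ln 1 = 0], and it is Cauchy at infinity by the [x^(-3/2)]
    bound; so its limit is [L] without an additive constant. The same argument shows that the
    improper integral converges. *)
Lemma Lfun_lim (m : nat) (a : nat -> C) (lam : C) (S : R -> C) : (3 <= m)%nat ->
  (forall x, 0 <= x -> offcut (Qpot m a lam x)) -> S 0 = 0%C ->
  (forall x, 0 <= x -> Cder S x (qroot (Qpot m a lam) (1/2) x)) ->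
  limoo (fun x => S x - Fexp m a (RtoC x) - nu m a * RtoC (ln (x + 1)))%C (Lfun m a lam).
Proof.
  intros Hm Hc HS0 HS.
  set (Phi := fun x => (S x - Fprim m a x - nu m a * RtoC (ln (x + 1)))%C).
  set (D := fun x => (qroot (Qpot m a lam) (1/2) x - (RtoC (Rpower x (INR m / 2))
    + Csum (seq 1 ((m + 1) / 2)) (fun j => bj m a j * RtoC (Rpower x (INR m / 2 - INR j))))
    - nu m a * RtoC (/ (x + 1)))%C).
  assert (HD : forall x, 0 < x -> L_integrand m a lam x = D x).
  { intros x Hx. unfold L_integrand. rewrite Csqrtp_Qpot by (apply offcut_neq0, Hc; lra).
    unfold D. rewrite RtoC_inv by lra. unfold Cdiv. ring. }
  assert (HPhi : forall x, 0 < x -> Cder Phi x (D x)).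
  { intros x Hx. unfold Phi, D. apply Cder_minus; [ apply Cder_minus | ].
    - apply HS. lra.
    - apply Cder_Fprim, Hx.
    - apply Cder_scal, Cder_RtoC. auto_derive; [ lra | field; lra ]. }
  assert (HDc : forall x, 0 < x -> exists l, Cder D x l).
  { intros x Hx. eexists. unfold D. apply Cder_minus; [ apply Cder_minus; [ | apply Cder_plus ] | ].
    - apply Cder_qroot; [ apply Cder_Qpot | apply Hc; lra ].
    - apply Cder_Rpower, Hx.
    - apply (Cder_Csum _ (fun j t => bj m a j * RtoC (Rpower t (INR m / 2 - INR j)))%C
        (fun j => bj m a j * RtoC ((INR m / 2 - INR j) * Rpower x (INR m / 2 - INR j - 1)))%C).
      intros j _. apply Cder_scal, Cder_Rpower, Hx.
    - apply Cder_scal, Cder_RtoC. auto_derive; [ lra | reflexivity ]. }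
  assert (H0 : limoo (fun t => Phi (/ t)) 0%C).
  { unfold Phi, Fprim. replace (RtoC 0) with (0 - (0 + 0) - 0)%C by ring.
    apply limoo_minus; [ apply limoo_minus; [ | apply limoo_plus ] | ].
    - eapply limoo_at_0; [ exact HS0 | apply HS; lra ].
    - apply limoo_scal0, limoo_Rpower_inv. pose proof (pos_INR m). lra.
    - apply (limoo_Csum0 _ (fun j t => RtoC (2 / (INR m + 2 - 2 * INR j)) * bj m a j
                 * RtoC (Rpower (/ t) ((INR m + 2 - 2 * INR j) / 2)))%C).
      intros j Hj. apply limoo_scal0, limoo_Rpower_inv. pose proof (index_range m j Hj). lra.
    - apply limoo_scal0. apply limoo_of_Rpower with (K := 1) (s := 1) (X0 := 1); [ lra | ].
      intros x Hx. rewrite Rpower_Ropp, Rpower_1, Rmult_1_l by lra.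
      assert (Hix : 0 < / x) by (apply Rinv_0_lt_compat; lra).
      rewrite Cmod_R, Rabs_pos_eq.
      + rewrite <- (ln_exp (/ x)) at 2. apply ln_le; [ lra | ].
        rewrite Rplus_comm. apply exp_ineq1_le.
      + rewrite <- ln_1. apply ln_le; lra. }
  assert (Hoo : exists c, limoo Phi c).
  { apply limoo_of_cauchy. intros eps He.
    destruct (L_integrand_bound m a lam Hm) as [ K [ X [ HX [ HK HB ] ] ] ].
    destruct (Rpower_small (1/2) (eps / (2 * K + 1))) as [ Y [ HY1 HY ] ].
    { lra. }
    { apply Rdiv_lt_0_compat; lra. }
    exists (Rmax X Y). intros x y Hxy. pose proof (Rmax_l X Y). pose proof (Rmax_r X Y).
    assert (HM : Cmod (Phi y - Phi x)
       <= 2 * K * Rpower x (-(1/2)) - 2 * K * Rpower y (-(1/2))).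
    { apply (Cder_mean_value Phi D (fun t => 2 * K * Rpower t (-(1/2)))
              (fun t => 2 * K * (-(1/2) * Rpower t (-(1/2) - 1)))); [ lra | | | ].
      - intros t Ht. apply HPhi; lra.
      - intros t Ht. apply is_derive_scal. apply (Cder_Rpower (-(1/2)) t ltac:(lra)).
      - intros t Ht. rewrite <- HD by lra. eapply Rle_trans; [ apply HB; lra | ].
        replace (-(1/2) - 1) with (-3/2) by field. lra. }
    eapply Rle_trans; [ exact HM | ].
    pose proof (exp_pos (-(1/2) * ln y)) as Hp. fold (Rpower y (-(1/2))) in Hp.
    pose proof (HY x ltac:(lra)) as Hr.
    assert (Hr' : (2 * K + 1) * Rpower x (-(1/2)) <= eps).
    { apply Rle_trans with ((2 * K + 1) * (eps / (2 * K + 1))).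
      - apply Rmult_le_compat_l; lra.
      - right; field; lra. }
    pose proof (exp_pos (-(1/2) * ln x)) as Hpx. fold (Rpower x (-(1/2))) in Hpx. nra. }
  destruct Hoo as [ c Hlim ].
  assert (EL : Lfun m a lam = c).
  { destruct (limoo_filterlim Phi c Hlim) as [ L1 L2 ].
    destruct (limoo_inv_filterlim Phi H0) as [ Z1 Z2 ].
    unfold Lfun. apply C_eq; simpl.
    - apply (RInt_gen_of_primitive (fun x => Re (Phi x)) (fun x => Re (D x))); try assumption.
      + intros x Hx. apply HPhi, Hx.
      + intros x Hx. destruct (HDc x Hx) as [ l Hl ]. eapply Cder_continuous_Re, Hl.
      + intros x Hx. exact (f_equal Re (HD x Hx)).
    - apply (RInt_gen_of_primitive (fun x => Im (Phi x)) (fun x => Im (D x))); try assumption.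
      + intros x Hx. apply HPhi, Hx.
      + intros x Hx. destruct (HDc x Hx) as [ l Hl ]. eapply Cder_continuous_Im, Hl.
      + intros x Hx. exact (f_equal Im (HD x Hx)). }
  rewrite EL. apply limoo_ext with (f := Phi) (X0 := 1); [ | exact Hlim ].
  intros x Hx. unfold Phi. rewrite Fexp_pos by lra. reflexivity.
Qed.

(** * Sibuya's asymptotics along rays and the limits of the amplitudes *)

Lemma sibuya_ray_limits (m : nat) (f fp : C -> (nat -> C) -> C -> C) (a : nat -> C) (lam u : C) (theta : R) :
  is_sibuya m f fp -> - (2 * PI) < theta * (INR m + 2) < 2 * PI -> - PI < theta < PI ->
  u = Cexpo (0, theta) ->
  limoo (fun t => f (RtoC t * u)%C a lam
     * Cexpo (Fexp m a (RtoC t * u) - (mu m a - RtoC (INR m / 2)) * (ln t, theta)))%C 1%C /\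
  limoo (fun t => fp (RtoC t * u)%C a lam
     * Cexpo (Fexp m a (RtoC t * u) - mu m a * (ln t, theta)))%C (- (1))%C.
Proof.
  intros Hf Htm Hth Hu.
  destruct (Hf a lam) as [ _ [ _ H ] ]. pose proof (INR_plus2_pos m) as Hm2. pose proof PI_RGT_0 as HPI.
  (* This choice of [eps] leaves the sector [|arg z| <= 2 PI / (m + 2)], which contains the rays of
     argument 0 and [+-PI / (m + 2)] used later. *)
  destruct (H (PI / (INR m + 2))) as [ K [ R0 [ HR0 HK ] ] ].
  { apply Rdiv_lt_0_compat; lra. }
  assert (Hlog : forall t, 0 < t -> (RtoC t * u)%C = Cexpo (ln t, theta)).
  { intros t Ht. rewrite Hu. unfold Cexpo. apply C_eq; simpl; rewrite exp_0, exp_ln by exact Ht; ring. }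
  assert (Hmod : forall t, 0 < t -> Cmod (RtoC t * u) = t).
  { intros t Ht. rewrite Hlog, Cmod_Cexpo by exact Ht. simpl. apply exp_ln, Ht. }
  assert (Harg : forall t, 0 < t -> Carg (RtoC t * u) = theta).
  { intros t Ht. rewrite Hlog, Carg_Cexpo by (try exact Ht; exact Hth). reflexivity. }
  assert (Hpow : forall t s, 0 < t -> Cpowc (RtoC t * u) s = Cexpo (s * (ln t, theta))).
  { intros t s Ht. unfold Cpowc. rewrite Hmod by exact Ht.
    destruct (Req_EM_T t 0) as [ E | _ ]; [ lra | ].
    unfold Clog. rewrite Hmod, Harg by exact Ht. reflexivity. }
  assert (HA : forall t, Rmax 1 R0 <= t -> exists h1 h2 : C,
     Cmod h1 <= K * Rpower t (- (1/2)) /\ Cmod h2 <= K * Rpower t (- (1/2)) /\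
     f (RtoC t * u)%C a lam = (Cexpo ((mu m a - RtoC (INR m / 2)) * (ln t, theta)) * (1 + h1)
                          * Cexpo (- Fexp m a (RtoC t * u)))%C /\
     fp (RtoC t * u)%C a lam = (- (Cexpo (mu m a * (ln t, theta)) * (1 + h2)
                          * Cexpo (- Fexp m a (RtoC t * u))))%C).
  { intros t Ht. pose proof (Rmax_l 1 R0). pose proof (Rmax_r 1 R0).
    destruct (HK (RtoC t * u)%C) as [ h1 [ h2 [ B1 [ B2 [ E1 E2 ] ] ] ] ].
    - rewrite Hmod; lra.
    - rewrite Harg by lra.
      replace (3 * PI / (INR m + 2) - PI / (INR m + 2)) with (2 * PI / (INR m + 2)) by (field; lra).
      apply Rle_div_r; [ lra | ]. unfold Rabs; destruct (Rcase_abs theta); nra.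
    - exists h1, h2. rewrite Hmod in B1, B2 by lra. rewrite !Hpow in E1, E2 by lra. auto. }
  split.
  - intros eps He.
    assert (H0 : limoo (fun t => f (RtoC t * u)%C a lam
     * Cexpo (Fexp m a (RtoC t * u) - (mu m a - RtoC (INR m / 2)) * (ln t, theta)) - 1)%C 0%C).
    { apply limoo_of_Rpower with (K := K) (s := 1/2) (X0 := Rmax 1 R0); [ lra | ].
      intros t Ht. destruct (HA t Ht) as [ h1 [ h2 [ B1 [ _ [ E1 _ ] ] ] ] ].
      rewrite E1. eapply Rle_trans; [ | exact B1 ]. right. f_equal.
      set (w := ((mu m a - RtoC (INR m / 2)) * (ln t, theta))%C). set (F := Fexp m a (RtoC t * u)).
      transitivity ((1 + h1) * (Cexpo w * Cexpo (- F) * Cexpo (F - w)) - 1)%C; [ ring | ].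
      rewrite <- !Cexpo_plus. replace (w + - F + (F - w))%C with (RtoC 0) by ring.
      rewrite Cexpo_0. ring. }
    destruct (H0 eps He) as [ X HX ]. exists X. intros x Hx. pose proof (HX x Hx) as Hb.
    cbv beta in Hb.
    eapply Rle_trans; [ | exact Hb ]. right. f_equal. ring.
  - intros eps He.
    assert (H0 : limoo (fun t => fp (RtoC t * u)%C a lam
     * Cexpo (Fexp m a (RtoC t * u) - mu m a * (ln t, theta)) - - (1))%C 0%C).
    { apply limoo_of_Rpower with (K := K) (s := 1/2) (X0 := Rmax 1 R0); [ lra | ].
      intros t Ht. destruct (HA t Ht) as [ h1 [ h2 [ _ [ B2 [ _ E2 ] ] ] ] ].
      rewrite E2. eapply Rle_trans; [ | exact B2 ]. right. rewrite <- (Cmod_opp h2). f_equal.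
      set (w := (mu m a * (ln t, theta))%C). set (F := Fexp m a (RtoC t * u)).
      transitivity (- ((1 + h2) * (Cexpo w * Cexpo (- F) * Cexpo (F - w))) - - (1))%C; [ ring | ].
      rewrite <- !Cexpo_plus. replace (w + - F + (F - w))%C with (RtoC 0) by ring.
      rewrite Cexpo_0. ring. }
    destruct (H0 eps He) as [ X HX ]. exists X. intros x Hx. pose proof (HX x Hx) as Hb.
    cbv beta in Hb.
    eapply Rle_trans; [ | exact Hb ]. right. f_equal. ring.
Qed.

Lemma limoo_ln_shift : limoo (fun x => RtoC (ln (x + 1) - ln x)) 0%C.
Proof.
  apply limoo_of_Rpower with (K := 1) (s := 1) (X0 := 1); [ lra | ].
  intros x Hx. rewrite Rpower_Ropp, Rpower_1, Rmult_1_l by lra.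
  assert (Hix : 0 < / x) by (apply Rinv_0_lt_compat; lra).
  assert (E : ln (x + 1) - ln x = ln (1 + / x)).
  { rewrite <- ln_div by lra. f_equal. field. lra. }
  rewrite E, Cmod_R, Rabs_pos_eq.
  - rewrite <- (ln_exp (/ x)) at 2. apply ln_le; [ lra | apply exp_ineq1_le ].
  - rewrite <- ln_1. apply ln_le; lra.
Qed.

(** The powers of [x] match because [mu = m/4 - nu]: [Q^(1/4)] grows like [x^(m/4)], [f] carries
    [x^(mu - m/2)], and their product [x^(-nu)] cancels the logarithm in
    [S = F + nu ln (x + 1) + L + o(1)]. The same count for [Q^(-1/4) f'] also leaves [x^(-nu)]. *)
Lemma wkb_limits (m : nat) (f fp : C -> (nat -> C) -> C -> C) (a : nat -> C) (lam : C) (S : R -> C) :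
  (3 <= m)%nat -> is_sibuya m f fp ->
  (forall x, 0 <= x -> offcut (Qpot m a lam x)) -> S 0 = 0%C ->
  (forall x, 0 <= x -> Cder S x (qroot (Qpot m a lam) (1/2) x)) ->
  limoo (fun x => Cexpo (S x) * qroot (Qpot m a lam) (1/4) x * f (RtoC x) a lam)%C (Cexpo (Lfun m a lam)) /\
  limoo (fun x => Cexpo (S x) * qroot (Qpot m a lam) (-1/4) x * fp (RtoC x) a lam)%C (- Cexpo (Lfun m a lam))%C.
Proof.
  intros Hm Hf Hc HS0 HS.
  pose proof PI_RGT_0.
  destruct (sibuya_ray_limits m f fp a lam 1 0 Hf) as [ G1 G2 ]; try lra.
  { rewrite <- Cexpo_0. reflexivity. }
  pose proof (Lfun_lim m a lam S Hm Hc HS0 HS) as HL.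
  pose proof (limoo_Clog_Qpot m a lam ltac:(lia)) as HQ.
  pose proof (limoo_scal (nu m a) _ _ limoo_ln_shift) as Hln.
  assert (Hx1 : forall x, (RtoC x * 1)%C = RtoC x) by (intros; ring).
  assert (E14 : (RtoC (1/4) * RtoC 4 = 1)%C) by (rewrite <- RtoC_mult; f_equal; field).
  split.
  - pose proof (limoo_plus _ _ _ _ (limoo_plus _ _ _ _ HL Hln) (limoo_scal (RtoC (1/4)) _ _ HQ)) as HW.
    replace (Lfun m a lam + nu m a * 0 + RtoC (1/4) * 0)%C with (Lfun m a lam) in HW by ring.
    pose proof (limoo_mult _ _ _ _ (limoo_Cexpo _ _ HW) G1) as HP.
    rewrite Cmult_1_r in HP. revert HP. apply limoo_ext with (X0 := 1). intros x Hx. cbv beta.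
    rewrite Hx1. change (ln x, 0) with (RtoC (ln x)).
    unfold qroot, mu. set (l := Clog (Qpot m a lam x)). set (F := Fexp m a (RtoC x)).
    transitivity (f (RtoC x) a lam * (Cexpo (S x - F - nu m a * RtoC (ln (x + 1))
        + nu m a * RtoC (ln (x + 1) - ln x) + RtoC (1/4) * (l - RtoC (INR m * ln x)))
        * Cexpo (F - (RtoC (INR m / 4) - nu m a - RtoC (INR m / 2)) * RtoC (ln x))))%C; [ ring | ].
    rewrite <- Cexpo_plus.
    transitivity (f (RtoC x) a lam * (Cexpo (S x) * Cexpo (RtoC (1/4) * l)))%C; [ | ring ].
    rewrite <- Cexpo_plus. do 2 f_equal.
    rewrite RtoC_minus.
    replace (RtoC (INR m * ln x)) with (RtoC (INR m / 4 * 4) * RtoC (ln x))%C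
      by (rewrite <- RtoC_mult; f_equal; field).
    replace (RtoC (INR m / 2)) with (RtoC (INR m / 4) + RtoC (INR m / 4))%C
      by (rewrite <- RtoC_plus; f_equal; field).
    rewrite (RtoC_mult (INR m / 4)).
    transitivity (S x + RtoC (1/4) * l + RtoC (INR m / 4) * RtoC (ln x) * (1 - RtoC (1/4) * RtoC 4))%C; [ ring | ].
    rewrite E14. ring.
  - pose proof (limoo_minus _ _ _ _ (limoo_plus _ _ _ _ HL Hln) (limoo_scal (RtoC (1/4)) _ _ HQ)) as HW.
    replace (Lfun m a lam + nu m a * 0 - RtoC (1/4) * 0)%C with (Lfun m a lam) in HW by ring.
    pose proof (limoo_mult _ _ _ _ (limoo_Cexpo _ _ HW) G2) as HP.
    replace (Cexpo (Lfun m a lam) * - (1))%C with (- Cexpo (Lfun m a lam))%C in HP by ring.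
    revert HP. apply limoo_ext with (X0 := 1). intros x Hx. cbv beta.
    rewrite Hx1. change (ln x, 0) with (RtoC (ln x)).
    unfold qroot, mu. set (l := Clog (Qpot m a lam x)). set (F := Fexp m a (RtoC x)).
    transitivity (fp (RtoC x) a lam * (Cexpo (S x - F - nu m a * RtoC (ln (x + 1))
        + nu m a * RtoC (ln (x + 1) - ln x) - RtoC (1/4) * (l - RtoC (INR m * ln x)))
        * Cexpo (F - (RtoC (INR m / 4) - nu m a) * RtoC (ln x))))%C; [ ring | ].
    rewrite <- Cexpo_plus.
    transitivity (fp (RtoC x) a lam * (Cexpo (S x) * Cexpo (RtoC (-1/4) * l)))%C; [ | ring ].
    rewrite <- Cexpo_plus. do 2 f_equal.
    rewrite RtoC_minus.
    replace (RtoC (INR m * ln x)) with (RtoC (INR m / 4 * 4) * RtoC (ln x))%C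
      by (rewrite <- RtoC_mult; f_equal; field).
    replace (RtoC (-1/4)) with (- RtoC (1/4))%C by (rewrite <- RtoC_opp; f_equal; field).
    rewrite (RtoC_mult (INR m / 4)).
    transitivity (S x - RtoC (1/4) * l - RtoC (INR m / 4) * RtoC (ln x) * (1 - RtoC (1/4) * RtoC 4))%C; [ ring | ].
    rewrite E14. ring.
Qed.

(** * The WKB estimate at the origin *)

Lemma sibuya_Cder (m : nat) (f fp : C -> (nat -> C) -> C -> C) (a : nat -> C) (lam u : C) (t : R) :
  is_sibuya m f fp ->
  Cder (fun s => f (RtoC s * u)%C a lam) t (u * fp (RtoC t * u)%C a lam)%C /\
  Cder (fun s => fp (RtoC s * u)%C a lam) t
    (u * ((Cpow (RtoC t * u) m + Pval m a (RtoC t * u) + lam) * f (RtoC t * u)%C a lam))%C.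
Proof.
  intros Hf. destruct (Hf a lam) as [ H1 [ H2 _ ] ].
  split; [ apply (is_derive_C_ray (fun w => f w a lam)), H1
         | apply (is_derive_C_ray (fun w => fp w a lam)), H2 ].
Qed.

(** At 0 the action vanishes, [A + B] gives [f], and [A - B] gives [- f'] up to the correction
    [Q' / (4 Q^(3/2)) (A + B)] that comes from differentiating [Q^(-1/4)]. Hence [2 * C3] for the
    two amplitudes and [C4] for the correction. The bounds see [a] and [lam] only through [k], [xi],
    [C1], [C2], which makes them uniform. *)
Lemma wkb_at_origin (m : nat) (f fp : C -> (nat -> C) -> C -> C) (a : nat -> C) (lam : C)
    (k xi C1 C2 : R) :
  (3 <= m)%nat -> is_sibuya m f fp -> 0 < k -> 1 <= xi -> 0 <= C1 -> 0 <= C2 ->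
  (forall x, 0 <= x -> offcut (Qpot m a lam x)) ->
  (forall x, 0 <= x -> k * (x + xi) ^ m <= Cmod (Qpot m a lam x)) ->
  (forall x, 0 <= x -> Cmod (Qpot1 m a x) <= C1 * (x + xi) ^ (m - 1)) ->
  (forall x, 0 <= x -> Cmod (Qpot2 m a x) <= C2 * (x + xi) ^ (m - 2)) ->
  let C3 := C1 * C1 * Rpower k (-5/2) + C2 * Rpower k (-3/2) in
  let C4 := C1 * Rpower k (-3/2) in
  let G := Rpower xi (- (INR m / 2 + 1)) in
  C3 * G <= 1 / 2 ->
  exists h1 h2 : C,
    Cmod h1 <= (2 * C3 + C4) * G /\ Cmod h2 <= (2 * C3 + C4) * G /\
    f 0%C a lam = (qroot (Qpot m a lam) (-1/4) 0 * Cexpo (Lfun m a lam) * (1 + h1))%C /\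
    fp 0%C a lam = (- (qroot (Qpot m a lam) (1/4) 0 * Cexpo (Lfun m a lam) * (1 + h2)))%C.
Proof.
  intros Hm Hf Hk Hxi HC1 HC2 Hc HQ HQ1 HQ2 C3 C4 G Hsmall.
  set (Q := Qpot m a lam) in *.
  assert (Hp : forall w s, 0 < Rpower w s) by (intros; apply exp_pos).
  assert (HC3 : 0 <= C3).
  { pose proof (Hp k (-5/2)). pose proof (Hp k (-3/2)). unfold C3.
    apply Rplus_le_le_0_compat; repeat apply Rmult_le_pos; lra. }
  assert (HC4 : 0 <= C4) by (pose proof (Hp k (-3/2)); unfold C4; apply Rmult_le_pos; lra).
  assert (HG : 0 < G) by apply Hp.
  assert (Hm3 : 3 <= INR m) by (apply le_INR in Hm; simpl in Hm; lra).
  destruct (action_exists (qroot Q (1/2)) (fun x => RtoC (1/2) * (Qpot1 m a x / Q x) * qroot Q (1/2) x)%C)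
    as [ S [ HS0 HS ] ].
  { intros x Hx. apply Cder_qroot; [ apply Cder_Qpot | apply Hc, Hx ]. }
  destruct (wkb_limits m f fp a lam S Hm Hf Hc HS0 HS) as [ L1 L2 ]. fold Q in L1, L2.
  set (c := Cexpo (Lfun m a lam)) in *.
  assert (Hc0 : 0 < Cmod c) by (apply Cmod_gt_0, Cexpo_neq0).
  set (y := fun x => f (RtoC x) a lam) in *. set (y1 := fun x => fp (RtoC x) a lam) in *.
  assert (Hy : forall x, Cder y x (y1 x) /\ Cder y1 x (Q x * y x)%C).
  { intros x. destruct (sibuya_Cder m f fp a lam 1 x Hf) as [ D1 D2 ].
    assert (Ex : forall s, (RtoC s * 1)%C = RtoC s) by (intros; ring).
    rewrite Ex, Cmult_1_l in D1, D2.
    split; [ revert D1 | revert D2 ]; apply Cder_ext; intros t; rewrite Ex; reflexivity. }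
  set (A := ampA Q (Qpot1 m a) S y y1). set (B := ampB Q (Qpot1 m a) S y y1).
  set (Z := wkb_error Q (Qpot1 m a) (Qpot2 m a)).
  assert (HAB : forall x, 0 <= x ->
     Cder A x (RtoC (1/2) * Z x * (A x + B x))%C /\
     Cder B x (2 * qroot Q (1/2) x * B x - RtoC (1/2) * Z x * (A x + B x))%C).
  { intros x Hx. apply Cder_amp; [ apply Cder_Qpot | apply Cder_Qpot1 | apply Hc, Hx | apply HS, Hx
                                 | apply Hy | apply Hy ]. }
  assert (HE : forall x, 0 <= x ->
     Cmod (Qpot1 m a x * Cpow (qroot Q (-1/4) x) 6) <= C4 * Rpower (x + xi) (- (INR m / 2 + 1)) /\
     Cmod (Z x) <= C3 * Rpower (x + xi) (- (INR m / 2 + 1) - 1)).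
  { intros x Hx. apply (wkb_error_bound m Q (Qpot1 m a) (Qpot2 m a) k C1 C2 x (x + xi)); try assumption.
    - lia.
    - lra.
    - apply HQ, Hx.
    - apply HQ1, Hx.
    - apply HQ2, Hx. }
  clearbody C3 C4.
  assert (LG : limoo (fun x => Qpot1 m a x * Cpow (qroot Q (-1/4) x) 6)%C 0%C).
  { apply limoo_of_Rpower with (K := C4) (s := INR m / 2 + 1) (X0 := 1); [ lra | ].
    intros x Hx. eapply Rle_trans; [ apply HE; lra | ].
    apply Rmult_le_compat_l; [ exact HC4 | apply Rpower_antitone; lra ]. }
  assert (Hi : forall x, qroot Q (-1/4) x = (/ qroot Q (1/4) x)%C) by (intros; apply qroot_inv).
  assert (H4 : forall x, qroot Q (1/4) x <> 0%C) by (intros; apply Cexpo_neq0).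
  assert (HA : forall x, A x = (RtoC (1/2) * (Cexpo (S x) * qroot Q (1/4) x * y x
      - RtoC (1/4) * (Qpot1 m a x * Cpow (qroot Q (-1/4) x) 6) * (Cexpo (S x) * qroot Q (1/4) x * y x)
      - Cexpo (S x) * qroot Q (-1/4) x * y1 x))%C).
  { intros x. unfold A, ampA. rewrite !Hi. field. apply H4. }
  assert (HB : forall x, B x = (RtoC (1/2) * (Cexpo (S x) * qroot Q (1/4) x * y x
      + RtoC (1/4) * (Qpot1 m a x * Cpow (qroot Q (-1/4) x) 6) * (Cexpo (S x) * qroot Q (1/4) x * y x)
      + Cexpo (S x) * qroot Q (-1/4) x * y1 x))%C).
  { intros x. unfold B, ampB. rewrite !Hi. field. apply H4. }
  pose proof (limoo_mult _ _ _ _ (limoo_scal (RtoC (1/4)) _ _ LG) L1) as LM.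
  (* The middle term vanishes at infinity by [LG]. The two other limits, [c] and [- c], reinforce
     each other in [A] and cancel in [B]. *)
  assert (LA : limoo A c).
  { apply limoo_ext with (X0 := 0) (f := fun x => (RtoC (1/2) * (Cexpo (S x) * qroot Q (1/4) x * y x
      - RtoC (1/4) * (Qpot1 m a x * Cpow (qroot Q (-1/4) x) 6) * (Cexpo (S x) * qroot Q (1/4) x * y x)
      - Cexpo (S x) * qroot Q (-1/4) x * y1 x))%C); [ intros; symmetry; apply HA | ].
    replace c with (RtoC (1/2) * (c - RtoC (1/4) * 0 * c - - c))%C.
    - apply limoo_scal, limoo_minus; [ apply limoo_minus; assumption | exact L2 ].
    - transitivity (RtoC (1/2) * RtoC 2 * c)%C; [ ring | ].
      rewrite <- RtoC_mult. replace (1 / 2 * 2) with 1 by field. ring. }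
  assert (LB : limoo B 0%C).
  { apply limoo_ext with (X0 := 0) (f := fun x => (RtoC (1/2) * (Cexpo (S x) * qroot Q (1/4) x * y x
      + RtoC (1/4) * (Qpot1 m a x * Cpow (qroot Q (-1/4) x) 6) * (Cexpo (S x) * qroot Q (1/4) x * y x)
      + Cexpo (S x) * qroot Q (-1/4) x * y1 x))%C); [ intros; symmetry; apply HB | ].
    replace (RtoC 0) with (RtoC (1/2) * (c + RtoC (1/4) * 0 * c + - c))%C by ring.
    apply limoo_scal, limoo_plus; [ apply limoo_plus; assumption | exact L2 ]. }
  set (H := fun x => C3 * Rpower (x + xi) (- (INR m / 2 + 1))).
  assert (HH0 : H 0 = C3 * G) by (unfold H; rewrite Rplus_0_l; reflexivity).
  destruct (amplitude_estimate A B (qroot Q (1/2)) Z S H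
     (fun x => C3 * (- (INR m / 2 + 1) * Rpower (x + xi) (- (INR m / 2 + 1) - 1))) c) as [ R1 R2 ].
  - intros x Hx. apply HAB, Hx.
  - intros x Hx. apply HAB, Hx.
  - exact HS.
  (* Half of an argument in [(-PI, PI)] has nonnegative cosine, so [Re (sqrt Q) >= 0]. *)
  - intros x Hx. unfold qroot, Cexpo. simpl.
    apply Rmult_le_pos; [ left; apply exp_pos | ].
    pose proof (Im_Clog_bound (Q x) (Hc x Hx)) as Hb. unfold Im in Hb.
    apply cos_ge_0; unfold Clog in *; simpl in *; lra.
  - intros x Hx. unfold H. apply is_derive_scal.
    destruct (Cder_Rpower (- (INR m / 2 + 1)) (x + xi) ltac:(lra)) as [ D _ ]. simpl in D.
    eapply (eq_ind _ (fun v => is_derive _ x v)).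
    + apply (is_derive_comp (fun v => Rpower v (- (INR m / 2 + 1))) (fun x => x + xi)).
      * exact D.
      * auto_derive; [ exact I | reflexivity ].
    + unfold scal; simpl. unfold mult; simpl. ring.
  - intros x Hx. eapply Rle_trans; [ apply HE, Hx | ].
    pose proof (Hp (x + xi) (- (INR m / 2 + 1) - 1)).
    replace (- (C3 * (- (INR m / 2 + 1) * Rpower (x + xi) (- (INR m / 2 + 1) - 1))))
      with (C3 * ((INR m / 2 + 1) * Rpower (x + xi) (- (INR m / 2 + 1) - 1))) by ring.
    apply Rmult_le_compat_l; [ exact HC3 | nra ].
  - intros x Hx. unfold H. apply Rmult_le_pos; [ exact HC3 | left; apply Hp ].
  - rewrite HH0. exact Hsmall.
  - intros eps He. destruct (LA eps He) as [ X HX ]. destruct (LB eps He) as [ Y HY ].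
    exists (Rmax X Y). intros x Hx. pose proof (Rmax_l X Y). pose proof (Rmax_r X Y).
    split; [ apply HX; lra | ]. replace (B x) with (B x - 0)%C by ring. apply HY; lra.
  - rewrite HH0 in R1, R2.
    assert (Hcn : c <> 0%C) by apply Cexpo_neq0.
    set (P0 := (Cexpo (S 0) * qroot Q (1/4) 0 * y 0)%C).
    assert (EP : (A 0 + B 0)%C = P0) by apply amp_sum.
    set (q := (Qpot1 m a 0 * Cpow (qroot Q (-1/4) 0) 6)%C).
    assert (Hq : Cmod q <= C4 * G).
    { pose proof (proj1 (HE 0 (Rle_refl 0))) as Hq. rewrite Rplus_0_l in Hq. exact Hq. }
    set (h1 := ((A 0 - c + B 0) / c)%C).
    set (h2 := ((A 0 - c - B 0 + RtoC (1/4) * q * P0) / c)%C).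
    assert (N1 : Cmod (A 0 - c + B 0) <= Cmod c * (2 * C3 * G)).
    { eapply Rle_trans; [ apply Cmod_triangle | ]. lra. }
    assert (N0 : Cmod P0 <= Cmod c * 2).
    { rewrite <- EP. replace (A 0 + B 0)%C with (c + (A 0 - c + B 0))%C by ring.
      eapply Rle_trans; [ apply Cmod_triangle | ]. nra. }
    exists h1, h2. split; [ | split; [ | split ] ].
    + unfold h1. rewrite Cmod_div by exact Hcn. apply Rle_div_l; [ exact Hc0 | ].
      eapply Rle_trans; [ exact N1 | ]. pose proof (Cmod_ge_0 c).
      assert (0 <= C4 * G * Cmod c) by (repeat apply Rmult_le_pos; lra). lra.
    + unfold h2. rewrite Cmod_div by exact Hcn. apply Rle_div_l; [ exact Hc0 | ].
      eapply Rle_trans; [ apply Cmod_triangle | ].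
      unfold Cminus at 1.
      assert (N2 : Cmod (A 0 - c + - B 0) <= Cmod c * (2 * C3 * G)).
      { eapply Rle_trans; [ apply Cmod_triangle | ]. rewrite Cmod_opp. lra. }
      assert (N3 : Cmod (RtoC (1/4) * q * P0) <= 1 / 4 * (C4 * G) * (Cmod c * 2)).
      { rewrite !Cmod_mult, Cmod_R, Rabs_pos_eq by lra.
        apply Rmult_le_compat; [ apply Rmult_le_pos; [ lra | apply Cmod_ge_0 ] | apply Cmod_ge_0
                               | apply Rmult_le_compat_l; lra | exact N0 ]. }
      assert (0 <= C4 * G * Cmod c) by (repeat apply Rmult_le_pos; lra). lra.
    + change (f 0%C a lam) with (y 0).
      rewrite <- Cmult_assoc.
      replace (c * (1 + h1))%C with P0.
      2:{ rewrite <- EP. unfold h1. field. exact Hcn. }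
      unfold P0. rewrite HS0, Cexpo_0, Hi. field. apply H4.
    + change (fp 0%C a lam) with (y1 0). rewrite <- Cmult_assoc.
      replace (c * (1 + h2))%C with (A 0 - B 0 + RtoC (1/4) * q * P0)%C.
      2:{ unfold h2. field. exact Hcn. }
      rewrite HA, HB. fold q P0. rewrite HS0, Cexpo_0, Hi.
      assert (R2' : RtoC (1/2) = (/ 2)%C) by (rewrite RtoC_div by lra; field; apply RtoC_neq0; lra).
      rewrite R2'. field. apply H4.
Qed.

(** * Uniform estimates in the sector away from the cut *)

Lemma lam_pow_Cexpo (r theta s : R) : lam_pow r theta s = Cexpo (RtoC s * (ln r, theta)).
Proof.
  unfold lam_pow, Rpower. rewrite <- Cexpo_R, <- Cexpo_plus. f_equal. apply C_eq; simpl; ring.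
Qed.

Lemma polar_Cexpo (r theta : R) : 0 < r -> polar r theta = Cexpo (ln r, theta).
Proof.
  intros Hr. unfold polar. rewrite <- (exp_ln r Hr) at 1. rewrite <- Cexpo_R, <- Cexpo_plus.
  f_equal. apply C_eq; simpl; ring.
Qed.

Lemma cos_sector (delta phi : R) : 0 < delta <= PI -> - PI + delta <= phi <= PI - delta ->
  1 - cos delta <= 1 + cos phi.
Proof.
  intros Hd Hphi.
  assert (E : cos phi = cos (Rabs phi)).
  { unfold Rabs. destruct (Rcase_abs phi); [ rewrite cos_neg | ]; reflexivity. }
  assert (Ha : 0 <= Rabs phi <= PI - delta) by (split; [ apply Rabs_pos | apply Rabs_le; lra ]).
  assert (H : cos (PI - delta) <= cos (Rabs phi)) by (apply cos_decr_1; lra).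
  rewrite <- E in H. replace (PI - delta) with (- delta + PI) in H by ring.
  rewrite neg_cos, cos_neg in H. lra.
Qed.

Lemma one_minus_cos_pos (delta : R) : 0 < delta <= PI -> 0 < 1 - cos delta.
Proof.
  intros Hd. assert (H : cos delta < cos 0) by (apply cos_decreasing_1; lra).
  rewrite cos_0 in H. lra.
Qed.

Definition wkb_rate (m : nat) : R := 1/2 + 1 / INR m.

(** Replaces the principal power of [Q 0 = lam + a_m] by the power of [lam] taken with the argument
    [phi]. The margin between [phi] and [+-PI] exceeds the possible change of argument, so both
    refer to the same branch. *)
Lemma qroot_Qpot_0 (m : nat) (a : nat -> C) (M r phi s : R) :
  (1 <= m)%nat -> (forall k, (1 <= k <= m)%nat -> Cmod (a k) <= M) ->
  0 < r -> INR m * M <= r / 2 ->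
  - PI + 4 * (INR m * M / r) < phi < PI - 4 * (INR m * M / r) ->
  exists e0 : C, Cmod e0 <= 4 * (INR m * M / r) /\
    qroot (Qpot m a (polar r phi)) s 0 = (lam_pow r phi s * Cexpo (RtoC s * e0))%C.
Proof.
  intros Hm HM Hr Hbig Hphi.
  pose proof (Pval_bound m a M 0 1 HM ltac:(lra) ltac:(lra) ltac:(lra)) as HP.
  rewrite pow1, Rmult_1_r in HP.
  set (P := Pval m a (RtoC 0)) in *.
  assert (Hl0 : polar r phi <> 0%C) by (rewrite polar_Cexpo by exact Hr; apply Cexpo_neq0).
  assert (Hlm : Cmod (polar r phi) = r).
  { rewrite polar_Cexpo, Cmod_Cexpo by exact Hr. simpl. apply exp_ln, Hr. }
  set (h := (P / polar r phi)%C).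
  assert (Hh : Cmod h <= INR m * M / r).
  { unfold h. rewrite Cmod_div, Hlm by exact Hl0. apply Rmult_le_compat_r; [ | exact HP ].
    left; apply Rinv_0_lt_compat, Hr. }
  assert (Hh2 : INR m * M / r <= 1/2) by (apply Rle_div_l; lra).
  destruct (Clog_1_plus h) as [ Hc [ Hexp Hl ] ]; [ lra | ].
  exists (Clog (1 + h)). split; [ lra | ].
  rewrite lam_pow_Cexpo, <- Cexpo_plus, <- Cmult_plus_distr_l. unfold qroot. do 2 f_equal.
  rewrite <- Clog_Cexpo.
  - f_equal. rewrite Cexpo_plus, Hexp, <- polar_Cexpo by exact Hr.
    unfold Qpot. fold P. unfold h.
    assert (E0 : Cpow (RtoC 0) m = 0%C).
    { destruct m as [ | m ]; [ lia | ]. rewrite Cpow_S. ring. }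
    rewrite E0. field. exact Hl0.
  - pose proof (Im_le_Cmod (Clog (1 + h))) as Hi. apply Rabs_le_between in Hi.
    change (Im ((ln r, phi) + Clog (1 + h))) with (phi + Im (Clog (1 + h))). lra.
Qed.

Lemma wkb_origin (m : nat) (f fp : C -> (nat -> C) -> C -> C) (delta M : R) :
  (3 <= m)%nat -> is_sibuya m f fp -> 0 < delta <= PI -> 0 <= M ->
  exists K R0 : R, 0 <= K /\ 1 <= R0 /\
    forall (a : nat -> C) (r phi : R),
      (forall k : nat, (1 <= k <= m)%nat -> Cmod (a k) <= M) ->
      R0 <= r -> - PI + delta <= phi <= PI - delta ->
      exists e1 e2 : C,
        Cmod e1 <= K * Rpower r (- wkb_rate m) /\ Cmod e2 <= K * Rpower r (- wkb_rate m) /\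
        f 0%C a (polar r phi)
        = (lam_pow r phi (- (1/4)) * Cexpo (Lfun m a (polar r phi) + e1))%C /\
        fp 0%C a (polar r phi)
        = (- (lam_pow r phi (1/4) * Cexpo (Lfun m a (polar r phi) + e2)))%C.
Proof.
  intros Hm Hf Hd HM0.
  assert (Hm3 : 3 <= INR m) by (apply le_INR in Hm; simpl in Hm; lra).
  pose proof (one_minus_cos_pos delta Hd) as Hkap. set (kap := 1 - cos delta) in *.
  assert (H2m : 0 < 2 ^ m) by (apply pow_lt; lra).
  set (k := kap / (4 * 2 ^ m)).
  assert (Hk : 0 < k) by (apply Rdiv_lt_0_compat; lra).
  set (C1 := INR m + INR m * (M * INR m)). set (C2 := INR m * INR m + INR m * (M * (INR m * INR m))).
  assert (HmM : 0 <= INR m * M) by (apply Rmult_le_pos; lra).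
  assert (HC1 : 0 <= C1) by (unfold C1; nra).
  assert (HC2 : 0 <= C2).
  { unfold C2. replace (INR m * (M * (INR m * INR m))) with (INR m * M * (INR m * INR m)) by ring. nra. }
  set (C3 := C1 * C1 * Rpower k (-5/2) + C2 * Rpower k (-3/2)).
  set (C4 := C1 * Rpower k (-3/2)).
  assert (Hp : forall w s, 0 < Rpower w s) by (intros; apply exp_pos).
  assert (HC3 : 0 <= C3).
  { pose proof (Hp k (-5/2)). pose proof (Hp k (-3/2)). unfold C3.
    apply Rplus_le_le_0_compat; repeat apply Rmult_le_pos; lra. }
  assert (HC4 : 0 <= C4) by (pose proof (Hp k (-3/2)); unfold C4; apply Rmult_le_pos; lra).
  set (B := 2 * C3 + C4).
  assert (Hrho : 0 < wkb_rate m <= 1).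
  { unfold wkb_rate. assert (0 < 1 / INR m) by (apply Rdiv_lt_0_compat; lra).
    assert (1 / INR m <= 1/2) by (apply Rle_div_l; lra). lra. }
  destruct (Rpower_small (wkb_rate m) (/ (2 * (B + 1)))) as [ X [ HX1 HX ] ].
  { lra. }
  { apply Rinv_0_lt_compat. unfold B; lra. }
  set (X1 := Rmax 1 (4 * INR m * M * 2 ^ m / kap)).
  assert (HX1a : 1 <= X1) by apply Rmax_l.
  assert (HX1b : 4 * INR m * M * 2 ^ m <= kap * X1).
  { pose proof (Rmax_r 1 (4 * INR m * M * 2 ^ m / kap)) as Hr. fold X1 in Hr.
    apply Rle_div_l in Hr; lra. }
  (* In [K], the part with [M] covers the replacement of [Q 0] by [lam], and [4 * B] covers the
     logarithms of [1 + h1] and [1 + h2]. In [R0], [X] makes the total error at most 1/2, [X1 ^ m]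
     gives [xi >= X1] and so the lower bounds on [Q], the third term gives [|a_m| <= r / 2], and the
     last keeps the change of argument at 0 below [delta]. *)
  exists (4 * (INR m * M) + 4 * B), (X + X1 ^ m + 2 * (INR m * M) + 8 * (INR m * M) / delta).
  assert (HX1m : 1 <= X1 ^ m) by (apply pow_R1_Rle; exact HX1a).
  assert (Hdd : 0 <= 8 * (INR m * M) / delta) by (apply Rdiv_le_0_compat; lra).
  split; [ unfold B; lra | split; [ lra | ] ].
  intros a r phi HM Hr Hphi.
  assert (Hr1 : 1 <= r) by lra.
  set (xi := Rpower r (1 / INR m)).
  assert (Hxim : xi ^ m = r).
  { unfold xi. rewrite Rpower_pow_mult. replace (INR m * (1 / INR m)) with 1 by (field; lra).
    apply Rpower_1. lra. }
  assert (Hxi : X1 <= xi).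
  { rewrite <- (Rpower_1 X1) by lra.
    replace 1 with (INR m * (1 / INR m)) at 1 by (field; lra).
    rewrite <- Rpower_mult, Rpower_pow by lra. apply Rle_Rpower_l; [ | lra ].
    left. apply Rdiv_lt_0_compat; lra. }
  assert (HG : Rpower xi (- (INR m / 2 + 1)) = Rpower r (- wkb_rate m)).
  { unfold xi. rewrite Rpower_mult. f_equal. unfold wkb_rate. field. lra. }
  pose proof (HX r ltac:(lra)) as HGs.
  assert (HBG : (B + 1) * Rpower r (- wkb_rate m) <= 1/2).
  { apply Rle_trans with ((B + 1) * / (2 * (B + 1))).
    - apply Rmult_le_compat_l; [ unfold B; lra | exact HGs ].
    - right. field. unfold B; lra. }
  pose proof (Hp r (- wkb_rate m)) as HGp.
  assert (Hlow : forall x, 0 <= x ->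
     kap / 2 * (x ^ m + xi ^ m) <= Cmod (Qpot m a (polar r phi) x) + Re (Qpot m a (polar r phi) x) /\
     k * (x + xi) ^ m <= Cmod (Qpot m a (polar r phi) x)).
  { intros x Hx. rewrite <- Hxim.
    apply (Qpot_lower m a M kap xi phi x); try assumption; try lra; try lia.
    - apply cos_sector; assumption.
    - eapply Rle_trans; [ exact HX1b | ]. apply Rmult_le_compat_l; lra. }
  destruct (wkb_at_origin m f fp a (polar r phi) k xi C1 C2) as [ h1 [ h2 [ N1 [ N2 [ E1 E2 ] ] ] ] ];
    try assumption; try lra.
  - intros x Hx. unfold offcut. eapply Rlt_le_trans; [ | apply (proj1 (Hlow x Hx)) ].
    rewrite Hxim. assert (0 <= x ^ m) by (apply pow_le, Hx).
    apply Rmult_lt_0_compat; lra.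
  - intros x Hx. apply Hlow, Hx.
  - intros x Hx. apply Qpot1_bound; try assumption; lra.
  - intros x Hx. apply Qpot2_bound; try assumption; lra.
  - fold C3. rewrite HG.
    apply Rle_trans with ((B + 1) * Rpower r (- wkb_rate m)); [ | exact HBG ].
    apply Rmult_le_compat_r; [ lra | unfold B; lra ].
  - fold C3 C4 in N1, N2. fold B in N1, N2. rewrite HG in N1, N2.
    clearbody C3 C4 B.
    (* The rate is at most 1, so the [O(1/r)] error made at [x = 0] is absorbed. *)
    assert (Hmr : INR m * M / r <= INR m * M * Rpower r (- wkb_rate m)).
    { apply Rmult_le_compat_l; [ exact HmM | ].
      rewrite <- (Rpower_1 r) at 1 by lra. rewrite <- Rpower_Ropp.
      apply Rle_Rpower; lra. }
    assert (Hdr : 4 * (INR m * M / r) < delta).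
    { replace (4 * (INR m * M / r)) with (4 * (INR m * M) / r) by (field; lra).
      apply Rlt_div_l; [ lra | ].
      assert (8 * (INR m * M) / delta * delta = 8 * (INR m * M)) by (field; lra). nra. }
    assert (HB1 : B * Rpower r (- wkb_rate m) <= 1/2) by lra.
    destruct (Clog_1_plus h1) as [ _ [ X1e X1l ] ]; [ lra | ].
    destruct (Clog_1_plus h2) as [ _ [ X2e X2l ] ]; [ lra | ].
    destruct (qroot_Qpot_0 m a M r phi (-1/4)) as [ e1 [ B1 D1 ] ]; try assumption; try lia; try lra.
    destruct (qroot_Qpot_0 m a M r phi (1/4)) as [ e2 [ B2 D2 ] ]; try assumption; try lia; try lra.
    exists (RtoC (-1/4) * e1 + Clog (1 + h1))%C, (RtoC (1/4) * e2 + Clog (1 + h2))%C.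
    split; [ | split; [ | split ] ].
    + eapply Rle_trans; [ apply Cmod_triangle | ].
      rewrite Cmod_mult, Cmod_R. replace (Rabs (-1/4)) with (1/4) by (rewrite Rabs_left; lra).
      pose proof (Cmod_ge_0 e1). lra.
    + eapply Rle_trans; [ apply Cmod_triangle | ].
      rewrite Cmod_mult, Cmod_R, Rabs_pos_eq by lra.
      pose proof (Cmod_ge_0 e2). lra.
    + rewrite E1, D1, !Cexpo_plus, X1e. replace (- (1/4)) with (-1/4) by field. ring.
    + rewrite E2, D2, !Cexpo_plus, X2e. ring.
Qed.

(** * Rotation symmetry and the Wronskian of neighbouring solutions *)

Lemma omega_pow_plus_R (m : nat) (s t : R) :
  omega_pow m (RtoC (s + t)) = (omega_pow m (RtoC s) * omega_pow m (RtoC t))%C.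
Proof. rewrite RtoC_plus. apply omega_pow_plus. Qed.

(** Weighted homogeneity: [a_i] has weight [i], so the coefficient of [z^d] in [P^k] has weight
    [mk - d]. Consequently [bj] has weight [j]. *)
Lemma Ppow_coef_Gpow (m : nat) (l : Z) (a : nat -> C) (k d : nat) :
  Ppow_coef m (Gpow m l a) k d
  = (omega_pow m (RtoC (- ((INR m * INR k - INR d) * IZR l))) * Ppow_coef m a k d)%C.
Proof.
  revert d. induction k as [ | k IH ]; intros d; cbn [Ppow_coef].
  - destruct (Nat.eqb_spec d 0) as [ -> | _ ]; [ | ring ].
    simpl INR. replace (- ((INR m * 0 - 0) * IZR l)) with 0 by ring. rewrite omega_pow_0. ring.
  - rewrite <- Csum_scal. apply Csum_ext. intros e He. apply in_seq in He.
    rewrite IH. unfold Pcoef, Gpow. destruct (Nat.ltb_spec e m); [ | ring ].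
    replace (- ((INR m * INR (S k) - INR d) * IZR l))
      with (- (INR (m - e) * IZR l) + - ((INR m * INR k - INR (d - e)) * IZR l))
      by (rewrite S_INR, !minus_INR by lia; ring).
    rewrite omega_pow_plus_R. ring.
Qed.

Lemma bj_Gpow (m : nat) (l : Z) (a : nat -> C) (j : nat) :
  bj m (Gpow m l a) j = (omega_pow m (RtoC (- (INR j * IZR l))) * bj m a j)%C.
Proof.
  unfold bj. rewrite <- Csum_scal. apply Csum_ext. intros k _. unfold bjk.
  destruct (Nat.leb_spec j (m * k)); [ | ring ].
  rewrite Ppow_coef_Gpow, minus_INR, mult_INR by assumption.
  replace (INR m * INR k - (INR m * INR k - INR j)) with (INR j) by ring. ring.
Qed.

(** For even [m] the weight [m/2 + 1] of [nu] is half a period of omega. This gives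
    [mu (G a) = m/2 - mu a]. *)
Lemma nu_Gpow1 (m : nat) (a : nat -> C) : nu m (Gpow m 1 a) = (- nu m a)%C.
Proof.
  unfold nu. destruct (Nat.even m) eqn:E; [ | ring ].
  rewrite bj_Gpow.
  assert (Ew : omega_pow m (RtoC (- (INR (m / 2 + 1) * 1))) = (- (1))%C).
  { apply Nat.even_spec in E. destruct E as [ p Ep ].
    replace (- (INR (m / 2 + 1) * 1)) with ((INR m + 2) / 2 + - (INR m + 2)).
    - rewrite omega_pow_plus_R, omega_pow_half_period.
      assert (Ei : (omega_pow m (RtoC (INR m + 2)) * omega_pow m (RtoC (- (INR m + 2))) = 1)%C).
      { rewrite <- omega_pow_plus_R, Rplus_opp_r. apply omega_pow_0. }
      rewrite omega_pow_period, Cmult_1_l in Ei. rewrite Ei. ring.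
    - rewrite Ep, (Nat.mul_comm 2 p), Nat.div_mul, plus_INR, mult_INR by lia. simpl. field. }
  rewrite Ew. ring.
Qed.

Lemma Gpow_inverse (m : nat) (l : Z) (a : nat -> C) : Gpow m l (Gpow m (- l) a) = a.
Proof.
  apply functional_extensionality. intros i. unfold Gpow.
  rewrite Cmult_assoc, <- omega_pow_plus_R, opp_IZR.
  replace (- (INR i * IZR l) + - (INR i * - IZR l)) with 0 by ring.
  rewrite omega_pow_0. ring.
Qed.

(** Under the rotation each of the three parts of the potential is multiplied by
    [omega^(-m) = omega^2]; the second derivative acquires the inverse factor, so the rotated
    solution satisfies the original equation. *)
Lemma potential_rotation (m : nat) (a : nat -> C) (lam z : C) :
  (omega_pow m (RtoC (- 2)) * (Cpow (omega_pow m (RtoC (-1)) * z) m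
     + Pval m (Gpow m 1 a) (omega_pow m (RtoC (-1)) * z) + omega_pow m (RtoC 2) * lam)
   = Cpow z m + Pval m a z + lam)%C.
Proof.
  assert (Hw : forall n, Cpow (omega_pow m (RtoC (-1))) n = omega_pow m (RtoC (- INR n))).
  { intros n. rewrite <- omega_pow_nat. f_equal. f_equal. ring. }
  assert (Hm2 : (omega_pow m (RtoC (-2)) * omega_pow m (RtoC (- INR m)) = 1)%C).
  { rewrite <- omega_pow_plus_R.
    assert (Ei : (omega_pow m (RtoC (INR m + 2)) * omega_pow m (RtoC (-2 + - INR m)) = 1)%C).
    { rewrite <- omega_pow_plus_R, <- (omega_pow_0 m). f_equal. f_equal. ring. }
    rewrite omega_pow_period, Cmult_1_l in Ei. exact Ei. }
  rewrite !Cmult_plus_distr_l. f_equal; [ f_equal | ].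
  - rewrite Cpow_mult_l, Hw, Cmult_assoc, Hm2. ring.
  - unfold Pval. rewrite <- Csum_scal. apply Csum_ext. intros i Hi. apply in_seq in Hi.
    rewrite Cpow_mult_l, Hw. unfold Gpow.
    transitivity (omega_pow m (RtoC (-2)) * (omega_pow m (RtoC (- (INR i * 1)))
       * omega_pow m (RtoC (- INR (m - i)))) * (a i * Cpow z (m - i)))%C; [ ring | ].
    rewrite <- omega_pow_plus_R, minus_INR by lia.
    replace (- (INR i * 1) + - (INR m - INR i)) with (- INR m) by ring. rewrite Hm2. ring.
  - rewrite Cmult_assoc, <- omega_pow_plus_R. replace (-2 + 2) with 0 by ring.
    rewrite omega_pow_0. ring.
Qed.

Lemma Cder_zero_const (g : R -> C) : (forall t, 0 <= t -> Cder g t 0) ->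
  forall t, 0 <= t -> g t = g 0.
Proof.
  intros H t Ht.
  assert (Hb : Cmod (g t - g 0) <= 0 - 0).
  { apply (Cder_mean_value g (fun _ => 0%C) (fun _ => 0) (fun _ => 0)); [ exact Ht | | | ].
    - intros s Hs. apply H; lra.
    - intros s _. apply @is_derive_const.
    - intros s _. rewrite Cmod_0. lra. }
  assert (E : (g t - g 0 = 0)%C).
  { apply Cmod_eq_0. pose proof (Cmod_ge_0 (g t - g 0)). lra. }
  replace (g t) with ((g t - g 0) + g 0)%C by ring. rewrite E. ring.
Qed.

Lemma Cpowc_ray (t theta : R) (s : C) : 0 < t -> - PI < theta < PI ->
  Cpowc (RtoC t * Cexpo (0, theta)) s = Cexpo (s * (ln t, theta)).
Proof.
  intros Ht Hth.
  assert (E : (RtoC t * Cexpo (0, theta))%C = Cexpo (ln t, theta)).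
  { exact (polar_Cexpo t theta Ht). }
  rewrite E. unfold Cpowc. rewrite Clog_Cexpo by exact Hth. rewrite Cmod_Cexpo.
  destruct (Req_EM_T _ _) as [ E0 | _ ]; [ | reflexivity ].
  pose proof (exp_pos (Re (ln t, theta))). lra.
Qed.

(** The points [t e^(+-i theta)] differ by the factor omega. In the term with index [j], the factor
    [omega^(-j)] from [bj] and the change of the power combine to [e^(-i PI)] independently of [j],
    so the exponentials of the two solutions cancel. *)
Lemma Fexp_rotation (m : nat) (a : nat -> C) (t : R) : 0 < t ->
  let theta := PI / (INR m + 2) in
  Fexp m (Gpow m 1 a) (RtoC t * Cexpo (0, (- theta)%R)) = (- Fexp m a (RtoC t * Cexpo (0, theta)))%C.
Proof.
  intros Ht theta. pose proof (INR_plus2_pos m) as Hm2. pose proof PI_RGT_0 as HPI.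
  pose proof (pos_INR m) as Hm0.
  assert (Hth : - PI < theta < PI).
  { unfold theta. split.
    - apply Rlt_trans with 0; [ lra | apply Rdiv_lt_0_compat; lra ].
    - apply Rlt_div_l; [ lra | nra ]. }
  assert (Hkey : forall j : R, (omega_pow m (RtoC (- (j * 1)))
       * Cexpo (RtoC ((INR m + 2 - 2 * j) / 2) * (ln t, (- theta)%R))
       = - Cexpo (RtoC ((INR m + 2 - 2 * j) / 2) * (ln t, theta)))%C).
  { intros j.
    assert (Epi : Cexpo (0, (- PI)%R) = (- (1))%C).
    { unfold Cexpo. apply C_eq; simpl; rewrite exp_0, ?cos_neg, ?sin_neg, ?cos_PI, ?sin_PI; ring. }
    transitivity (Cexpo (0, (- PI)%R) * Cexpo (RtoC ((INR m + 2 - 2 * j) / 2) * (ln t, theta)))%C;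
      [ | rewrite Epi; ring ].
    unfold omega_pow. rewrite <- !Cexpo_plus. f_equal. unfold theta.
    apply C_eq; simpl; field; lra. }
  unfold Fexp.
  assert (Esum : forall S1 S2 T1 T2 : C, S1 = (- S2)%C -> T1 = (- T2)%C -> (S1 + T1 = - (S2 + T2))%C)
    by (intros S1 S2 T1 T2 -> ->; ring).
  apply Esum.
  - rewrite !Cpowc_ray by (try exact Ht; lra).
    pose proof (Hkey 0) as H0. rewrite Rmult_0_l, Ropp_0, omega_pow_0, Rmult_0_r, Rminus_0_r, Cmult_1_l in H0.
    rewrite H0. ring.
  - transitivity ((- (1)) * Csum (seq 1 ((m + 1) / 2))
       (fun j => RtoC (2 / (INR m + 2 - 2 * INR j)) * bj m a j
                 * Cpowc (RtoC t * Cexpo (0, theta)) (RtoC ((INR m + 2 - 2 * INR j) / 2))))%C; [ | ring ].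
    rewrite <- Csum_scal. apply Csum_ext. intros j _.
    rewrite !Cpowc_ray by (try exact Ht; lra). rewrite bj_Gpow.
    pose proof (Hkey (INR j)) as Hj.
    transitivity (RtoC (2 / (INR m + 2 - 2 * INR j)) * bj m a j * (omega_pow m (RtoC (- (INR j * 1)))
       * Cexpo (RtoC ((INR m + 2 - 2 * INR j) / 2) * (ln t, (- theta)%R))))%C; [ ring | ].
    rewrite Hj. ring.
Qed.

(* The Wronskian is evaluated along the ray arg z = PI / (m + 2), which lies in the sectors of
   validity of both expansions and on which the exponential factors cancel. *)
Lemma stokes_wronskian (m : nat) (f fp : C -> (nat -> C) -> C -> C) (a : nat -> C) (lam : C) :
  is_sibuya m f fp ->
  (omega_pow m (RtoC (-1)) * (f 0 a lam * fp 0 (Gpow m 1 a) (omega_pow m (RtoC 2) * lam))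
   - fp 0 a lam * f 0 (Gpow m 1 a) (omega_pow m (RtoC 2) * lam) = 2 * omega_pow m (mu m a))%C.
Proof.
  intros Hf. set (theta := PI / (INR m + 2)).
  pose proof (INR_plus2_pos m) as Hm2. pose proof PI_RGT_0 as HPI. pose proof (pos_INR m) as Hm0.
  set (a' := Gpow m 1 a). set (lam' := (omega_pow m (RtoC 2) * lam)%C).
  set (u := Cexpo (0, theta)). set (v := Cexpo (0, (- theta)%R)).
  assert (Huv : (u * v = 1)%C).
  { unfold u, v. rewrite <- Cexpo_plus, <- Cexpo_0. f_equal. apply C_eq; simpl; ring. }
  assert (Hv2 : (v * v)%C = omega_pow m (RtoC (-1))).
  { unfold v, omega_pow. rewrite <- Cexpo_plus. f_equal. unfold theta. apply C_eq; simpl; field; lra. }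
  assert (Hv4 : (omega_pow m (RtoC (-1)) * omega_pow m (RtoC (-1)))%C = omega_pow m (RtoC (- 2))).
  { rewrite <- omega_pow_plus_R. f_equal. f_equal. ring. }
  assert (Hth : - PI < theta < PI).
  { unfold theta. split.
    - apply Rlt_trans with 0; [ lra | apply Rdiv_lt_0_compat; lra ].
    - apply Rlt_div_l; [ lra | nra ]. }
  assert (Hthm : theta * (INR m + 2) = PI) by (unfold theta; field; lra).
  set (W := fun t : R => (v * v * (f (RtoC t * u) a lam * fp (RtoC t * v) a' lam')
     - fp (RtoC t * u) a lam * f (RtoC t * v) a' lam')%C).
  assert (HW : forall t, 0 <= t -> Cder W t 0).
  { intros t _. unfold W.
    destruct (sibuya_Cder m f fp a lam u t Hf) as [ D1 D2 ].
    destruct (sibuya_Cder m f fp a' lam' v t Hf) as [ D3 D4 ].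
    eapply Cder_eq.
    - apply Cder_minus; [ apply Cder_scal, Cder_mult; [ exact D1 | exact D4 ]
                        | apply Cder_mult; [ exact D2 | exact D3 ] ].
    - cbv beta. pose proof (potential_rotation m a lam (RtoC t * u)%C) as HP.
      replace (omega_pow m (RtoC (-1)) * (RtoC t * u))%C with (RtoC t * v)%C in HP
        by (rewrite <- Hv2; transitivity (RtoC t * v * (u * v))%C; [ rewrite Huv; ring | ring ]).
      fold a' lam' in HP. rewrite <- HP, <- Hv4, <- Hv2.
      set (q := (Cpow (RtoC t * v) m + Pval m a' (RtoC t * v) + lam')%C).
      transitivity ((u * v - 1) * (v * fp (RtoC t * u) a lam * fp (RtoC t * v) a' lam')
          + (1 - u * v) * (v * v * v * q * f (RtoC t * u) a lam * f (RtoC t * v) a' lam'))%C; [ ring | ].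
      rewrite Huv. ring. }
  assert (L : limoo W (2 * omega_pow m (mu m a))%C).
  { destruct (sibuya_ray_limits m f fp a lam u theta Hf) as [ L1 L2 ]; try lra; [ reflexivity | ].
    destruct (sibuya_ray_limits m f fp a' lam' v (- theta) Hf) as [ L3 L4 ]; try lra; [ reflexivity | ].
    pose proof (limoo_mult _ _ _ _ L1 L4) as L14. pose proof (limoo_mult _ _ _ _ L2 L3) as L23.
    assert (Hmu : mu m a' = (RtoC (INR m / 2) - mu m a)%C).
    { unfold mu, a'. rewrite nu_Gpow1.
      replace (RtoC (INR m / 2)) with (RtoC (INR m / 4) + RtoC (INR m / 4))%C
        by (rewrite <- RtoC_plus; f_equal; field). ring. }
    assert (Eth : forall s : C, Cexpo (s * (0, (2 * theta)%R)) = omega_pow m s).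
    { intros s. unfold omega_pow. do 2 f_equal. unfold theta. apply C_eq; simpl; field; lra. }
    (* Each product of two normalised factors tends to -1. The normalising exponentials multiply to
       [omega^(m/2 - mu)] and [omega^(-mu)], free of [t]; the prefactors undo them, by means of
       [- omega^(m/2) = omega^(-1)]. *)
    apply limoo_ext with (X0 := 1) (f := fun t =>
      (- omega_pow m (mu m a) * (f (RtoC t * u) a lam
         * Cexpo (Fexp m a (RtoC t * u) - (mu m a - RtoC (INR m / 2)) * (ln t, theta))
         * (fp (RtoC t * v) a' lam' * Cexpo (Fexp m a' (RtoC t * v) - mu m a' * (ln t, (- theta)%R))))
       - omega_pow m (mu m a) * (fp (RtoC t * u) a lam
         * Cexpo (Fexp m a (RtoC t * u) - mu m a * (ln t, theta))
         * (f (RtoC t * v) a' lam'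
            * Cexpo (Fexp m a' (RtoC t * v) - (mu m a' - RtoC (INR m / 2)) * (ln t, (- theta)%R)))))%C).
    - intros t Ht. unfold W.
      assert (EF : Fexp m a' (RtoC t * v) = (- Fexp m a (RtoC t * u))%C)
        by (apply (Fexp_rotation m a t); lra).
      rewrite EF, Hmu. set (F := Fexp m a (RtoC t * u)). set (M := mu m a). set (h := RtoC (INR m / 2)).
      assert (Epair : (ln t, theta) = ((ln t, (- theta)%R) + (0, (2 * theta)%R))%C)
        by (apply C_eq; simpl; ring).
      rewrite Epair. set (p := (ln t, (- theta)%R) : C). set (w := (0, (2 * theta)%R) : C).
      assert (X1 : (Cexpo (F - (M - h) * (p + w)) * Cexpo (- F - (h - M) * p))%C = omega_pow m (h - M)).
      { rewrite <- Cexpo_plus, <- Eth. fold w. f_equal. ring. }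
      assert (X2 : (Cexpo (F - M * (p + w)) * Cexpo (- F - (h - M - h) * p))%C = omega_pow m (- M)).
      { rewrite <- Cexpo_plus, <- Eth. fold w. f_equal. ring. }
      assert (Y1 : (- omega_pow m M * omega_pow m (h - M))%C = (v * v)%C).
      { rewrite Hv2. transitivity (- omega_pow m (M + (h - M)))%C; [ rewrite omega_pow_plus; ring | ].
        replace (M + (h - M))%C with (RtoC (-1 + (INR m + 2) / 2)).
        - rewrite omega_pow_plus_R, omega_pow_half_period. ring.
        - transitivity h; [ | ring ]. unfold h. f_equal. field. }
      assert (Y2 : (omega_pow m M * omega_pow m (- M))%C = 1%C).
      { rewrite <- omega_pow_plus, <- (omega_pow_0 m). f_equal. ring. }
      transitivity ((- omega_pow m M * (Cexpo (F - (M - h) * (p + w)) * Cexpo (- F - (h - M) * p)))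
         * (f (RtoC t * u) a lam * fp (RtoC t * v) a' lam')
         - omega_pow m M * (Cexpo (F - M * (p + w)) * Cexpo (- F - (h - M - h) * p))
         * (fp (RtoC t * u) a lam * f (RtoC t * v) a' lam'))%C; [ ring | ].
      rewrite X1, X2, Y1, Y2. ring.
    - replace (2 * omega_pow m (mu m a))%C
        with (- omega_pow m (mu m a) * (1 * - (1)) - omega_pow m (mu m a) * (- (1) * 1))%C by ring.
      apply limoo_minus; apply limoo_scal; assumption. }
  assert (Hconst : limoo W (W 0)).
  { apply limoo_ext with (X0 := 0) (f := fun _ => W 0); [ | apply limoo_const ].
    intros t Ht. symmetry. apply (Cder_zero_const W HW t Ht). }
  rewrite <- (limoo_unique _ _ _ Hconst L). unfold W. rewrite Hv2.
  replace (RtoC 0 * u)%C with (RtoC 0) by ring. replace (RtoC 0 * v)%C with (RtoC 0) by ring.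
  reflexivity.
Qed.

(** * Recovery of f and of its derivative from the two rotations *)

Lemma Ci_sqr : (Ci * Ci = - (1))%C.
Proof. apply C_eq; simpl; ring. Qed.

Lemma Cmult_cancel_r (x y z : C) : z <> 0%C -> (x * z = y * z)%C -> x = y.
Proof.
  intros Hz E. replace x with (x * z / z)%C by (field; exact Hz). rewrite E. field. exact Hz.
Qed.

Lemma omega_pow_quarter_period (m : nat) : omega_pow m (RtoC ((INR m + 2) / 4)) = Ci.
Proof.
  pose proof (INR_plus2_pos m). unfold omega_pow.
  replace (Cmult (RtoC ((INR m + 2) / 4)) (0, 2 * PI / (INR m + 2))) with ((0, PI / 2) : C)
    by (apply C_eq; simpl; field; lra).
  unfold Cexpo. apply C_eq; simpl; rewrite exp_0, ?cos_PI2, ?sin_PI2; ring.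
Qed.

Lemma polar_rotate (m : nat) (r theta s : R) :
  (omega_pow m (RtoC s) * polar r theta)%C = polar r (theta + s * (2 * PI / (INR m + 2))).
Proof.
  unfold polar, omega_pow.
  transitivity (RtoC r * (Cexpo (Cmult (RtoC s) (0, 2 * PI / (INR m + 2))%R) * Cexpo (0, theta)))%C; [ ring | ].
  rewrite <- Cexpo_plus. do 2 f_equal. apply C_eq; simpl; ring.
Qed.

Lemma lam_pow_rotate (m : nat) (r theta s t : R) :
  lam_pow r (theta + s * (2 * PI / (INR m + 2))) t
  = (lam_pow r theta t * omega_pow m (RtoC (t * s)))%C.
Proof.
  rewrite !lam_pow_Cexpo. unfold omega_pow. rewrite <- Cexpo_plus. f_equal.
  apply C_eq; simpl; ring.
Qed.

Theorem theorem5p1 (m : nat) (f fp : C -> (nat -> C) -> C -> C) :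
  (3 <= m)%nat ->
  is_sibuya m f fp ->
  forall delta : R, 0 < delta ->
  forall M : R,
  exists K R0 : R, 0 < R0 /\
    forall (a : nat -> C) (r theta : R),
      (forall k : nat, (1 <= k <= m)%nat -> Cmod (a k) <= M) ->
      R0 <= r ->
      PI - 4 * PI / (INR m + 2) + delta <= theta <= PI + 4 * PI / (INR m + 2) - delta ->
      let rho := 1/2 + 1 / INR m in
      let lam := polar r theta in
      let aGi := Gpow m (-1) a in
      let aG := Gpow m 1 a in
      let lam1 := (omega_pow m (RtoC (-2)) * lam)%C in
      let lam2 := (omega_pow m (RtoC (- INR m)) * lam)%C in
      (exists e : C, Cmod e <= K * Rpower r (- rho) /\
         Wr m f fp (-1) 1 0%C a lam
         = (2 * Ci * Cexpo (Lfun m aGi lam1 + Lfun m aG lam2 + e))%C) /\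
      (exists e1 e2 : C,
         Cmod e1 <= K * Rpower r (- rho) /\ Cmod e2 <= K * Rpower r (- rho) /\
         f 0%C a lam
         = (omega_pow m (RtoC (1/2) + mu m aGi) * lam_pow r theta (- (1/4))
              * Cexpo (- Lfun m aGi lam1 + e1)
            - Ci * omega_pow m (RtoC (1/2) + mu m a) * lam_pow r theta (- (1/4))
              * Cexpo (- Lfun m aG lam2 + e2))%C) /\
      (exists e1 e2 : C,
         Cmod e1 <= K * Rpower r (- rho) /\ Cmod e2 <= K * Rpower r (- rho) /\
         fp 0%C a lam
         = (omega_pow m (RtoC (1/2) + mu m aGi) * lam_pow r theta (1/4)
              * Cexpo (- Lfun m aGi lam1 + e1)
            + Ci * omega_pow m (RtoC (1/2) + mu m a) * lam_pow r theta (1/4)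
              * Cexpo (- Lfun m aG lam2 + e2))%C).
Proof.
  intros Hm Hf delta Hdelta M. pose proof PI_RGT_0 as HPI.
  assert (Hm3 : 3 <= INR m) by (apply le_INR in Hm; simpl in Hm; lra).
  (* [delta] may exceed [PI] and [M] may be negative here, hence the minimum and the maximum. *)
  destruct (wkb_origin m f fp (Rmin delta PI) (Rmax M 0) Hm Hf) as [ K0 [ R1 [ HK0 [ HR1 H ] ] ] ].
  { split; [ apply Rmin_glb_lt; assumption | apply Rmin_r ]. }
  { apply Rmax_r. }
  assert (Hrho : 0 < wkb_rate m).
  { unfold wkb_rate. assert (0 < 1 / INR m) by (apply Rdiv_lt_0_compat; lra). lra. }
  (* The threshold makes [K0 * eps <= 1/12], so that the relative error [h] of the Wronskian, at
     most [6 * (K0 * eps)], stays below 1/2. Its logarithm then costs [24 * (K0 * eps)], and one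
     more unit for a single rotated solution gives the constant 25. *)
  destruct (Rpower_small (wkb_rate m) (/ (12 * (K0 + 1))) Hrho) as [ X [ HX1 HX ] ].
  { apply Rinv_0_lt_compat; lra. }
  exists (25 * K0), (R1 + X). split; [ lra | ].
  intros a r theta HM Hr Htheta rho lam aGi aG lam1 lam2.
  change rho with (wkb_rate m). specialize (fun a phi => H a r phi).
  set (eps := Rpower r (- wkb_rate m)) in *.
  assert (Heps : 0 < eps) by apply exp_pos.
  assert (Hsmall : K0 * eps <= 1 / 12).
  { pose proof (HX r ltac:(lra)) as Hb. fold eps in Hb.
    apply Rle_trans with ((K0 + 1) * eps); [ lra | ].
    apply Rle_trans with ((K0 + 1) * / (12 * (K0 + 1))).
    - apply Rmult_le_compat_l; lra.
    - right; field; lra. }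
  assert (Hke : 0 <= K0 * eps) by (apply Rmult_le_pos; lra).
  clearbody eps.
  (* The sector has opening [8 PI / (m + 2) - 2 delta]. Once rotated to end at [PI - delta], or to
     begin at [- PI + delta], it avoids the cut because [8 PI / (m + 2) <= 2 PI]. *)
  assert (Hang : 8 * PI / (INR m + 2) <= 2 * PI).
  { apply Rle_div_l; [ lra | nra ]. }
  assert (Hmin : Rmin delta PI <= delta) by apply Rmin_l.
  assert (Hq8 : 8 * PI / (INR m + 2) = 2 * (4 * PI / (INR m + 2))) by (field; lra).
  assert (HG : forall l k, (1 <= k <= m)%nat -> Cmod (Gpow m l a k) <= Rmax M 0).
  { intros l k Hk. unfold Gpow. rewrite Cmod_mult, Cmod_omega_pow, Rmult_1_l.
    eapply Rle_trans; [ apply HM, Hk | apply Rmax_l ]. }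
  destruct (H aGi (theta + -2 * (2 * PI / (INR m + 2))) (HG _) ltac:(lra))
    as [ e1 [ e1' [ B1 [ B1' [ F1 P1 ] ] ] ] ].
  { replace (theta + -2 * (2 * PI / (INR m + 2))) with (theta - 4 * PI / (INR m + 2)) by (field; lra).
    lra. }
  destruct (H aG (theta + - INR m * (2 * PI / (INR m + 2))) (HG _) ltac:(lra))
    as [ e2 [ e2' [ B2 [ B2' [ F2 P2 ] ] ] ] ].
  { replace (theta + - INR m * (2 * PI / (INR m + 2)))
      with (theta - 2 * PI + 4 * PI / (INR m + 2)) by (field; lra).
    lra. }
  rewrite !lam_pow_rotate, <- !polar_rotate in F1, P1, F2, P2.
  fold lam in F1, P1, F2, P2. fold lam1 in F1, P1. fold lam2 in F2, P2.
  (* [omega^2] and [omega^(-m)] are the same number, but the exponent [-m] lowers the argument by a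
     further [2 PI], into the admissible range. *)
  assert (Hlam2 : (omega_pow m (RtoC 2) * lam)%C = lam2).
  { unfold lam2. replace 2 with ((INR m + 2) + - INR m) by ring.
    rewrite omega_pow_plus_R, omega_pow_period. ring. }
  assert (Hlam1 : (omega_pow m (RtoC 2) * lam1)%C = lam).
  { unfold lam1. rewrite Cmult_assoc, <- omega_pow_plus_R. replace (2 + -2) with 0 by ring.
    rewrite omega_pow_0. ring. }
  pose proof (stokes_wronskian m f fp a lam Hf) as S01.
  (* The same identity one rotation earlier: rotating [(aGi, lam1)] gives [(a, lam)], so this is
     [W_{-1,0}] up to a factor omega. *)
  pose proof (stokes_wronskian m f fp aGi lam1 Hf) as S10.
  rewrite Hlam2 in S01. fold aG in S01.
  assert (HGG : Gpow m 1 aGi = a) by exact (Gpow_inverse m 1 a).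
  rewrite Hlam1, HGG in S10.
  assert (HW : Wr m f fp (-1) 1 0%C a lam
     = (omega_pow m (RtoC (-1)) * (f 0 aGi lam1 * fp 0 aG lam2)
        - omega_pow m (RtoC 1) * (fp 0 aGi lam1 * f 0 aG lam2))%C).
  { unfold Wr, fk, fk'. rewrite !Cmult_0_r.
    replace (2 * IZR (-1)) with (-2) by ring. replace (2 * IZR 1) with 2 by ring.
    replace (- IZR (-1)) with 1 by ring. replace (- IZR 1) with (-1) by ring.
    fold lam1 aGi aG. rewrite Hlam2. ring. }
  rewrite HW. clear HW H HG.
  set (f0 := f 0%C a lam) in *. set (fp0 := fp 0%C a lam) in *.
  set (w := omega_pow m (RtoC (1/2))). set (w' := omega_pow m (RtoC (- (1/2)))).
  assert (Hww : (w * w' = 1)%C).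
  { unfold w, w'. rewrite <- omega_pow_plus_R, Rplus_opp_r. apply omega_pow_0. }
  assert (W1 : omega_pow m (RtoC 1) = (w * w)%C).
  { unfold w. rewrite <- omega_pow_plus_R. do 2 f_equal. field. }
  assert (Wm1 : omega_pow m (RtoC (-1)) = (w' * w')%C).
  { unfold w'. rewrite <- omega_pow_plus_R. do 2 f_equal. field. }
  assert (Wa : omega_pow m (RtoC (- (1/4) * -2)) = w) by (unfold w; do 2 f_equal; field).
  assert (Wb : omega_pow m (RtoC (1/4 * -2)) = w') by (unfold w'; do 2 f_equal; field).
  (* The origin of the factors [i] in the theorem: [m/4 = (m+2)/4 - 1/2], and [omega^((m+2)/4) = i].
     The quarter power registers the [2 PI] by which the argument was lowered. *)
  assert (Wc : omega_pow m (RtoC (- (1/4) * - INR m)) = (Ci * w')%C).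
  { unfold w'. rewrite <- (omega_pow_quarter_period m), <- omega_pow_plus_R. do 2 f_equal. field. }
  assert (Wd : omega_pow m (RtoC (1/4 * - INR m)) = (- Ci * w)%C).
  { assert (Wq : (Ci * omega_pow m (RtoC (- ((INR m + 2) / 4))) = 1)%C).
    { rewrite <- (omega_pow_quarter_period m), <- omega_pow_plus_R, Rplus_opp_r. apply omega_pow_0. }
    replace (1/4 * - INR m) with (- ((INR m + 2) / 4) + 1/2) by field.
    rewrite omega_pow_plus_R. fold w.
    transitivity (- (Ci * Ci) * omega_pow m (RtoC (- ((INR m + 2) / 4))) * w)%C.
    - rewrite Ci_sqr. ring.
    - transitivity (- Ci * (Ci * omega_pow m (RtoC (- ((INR m + 2) / 4)))) * w)%C; [ ring | ].
      rewrite Wq. ring. }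
  rewrite W1, Wm1, Wa, Wb, Wc, Wd in *.
  set (l := lam_pow r theta (1/4)) in *. set (l' := lam_pow r theta (- (1/4))) in *.
  assert (Hll : (l * l' = 1)%C).
  { unfold l, l'. rewrite !lam_pow_Cexpo, <- Cexpo_plus, <- Cexpo_0. f_equal.
    rewrite RtoC_opp. ring. }
  rewrite !omega_pow_plus. fold w.
  set (om := omega_pow m (mu m a)) in *. set (omi := omega_pow m (mu m aGi)) in *.
  set (L1 := Lfun m aGi lam1) in *. set (L2 := Lfun m aG lam2) in *.
  pose proof Ci_sqr as HCi.
  set (F1v := f 0%C aGi lam1) in *. set (P1v := fp 0%C aGi lam1) in *.
  set (F2v := f 0%C aG lam2) in *. set (P2v := fp 0%C aG lam2) in *.
  (* Both products in the Wronskian have the leading part [i e^(L1 + L2)], with equal signs; [h] is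
     the mean of their relative errors. *)
  set (h := (RtoC (1/2) * ((Cexpo (e1 + e2') - 1) + (Cexpo (e1' + e2) - 1)))%C).
  assert (Hh : Cmod h <= 6 * (K0 * eps)).
  { unfold h. rewrite Cmod_mult, Cmod_R, Rabs_pos_eq by lra.
    assert (T1 : Cmod (e1 + e2') <= 2 * (K0 * eps))
      by (eapply Rle_trans; [ apply Cmod_triangle | lra ]).
    assert (T2 : Cmod (e1' + e2) <= 2 * (K0 * eps))
      by (eapply Rle_trans; [ apply Cmod_triangle | lra ]).
    pose proof (Cexpo_sub1_le (e1 + e2') ltac:(lra)).
    pose proof (Cexpo_sub1_le (e1' + e2) ltac:(lra)).
    pose proof (Cmod_triangle (Cexpo (e1 + e2') - 1) (Cexpo (e1' + e2) - 1)). lra. }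
  destruct (Clog_1_plus h) as [ _ [ Xh Bh ] ]; [ lra | ].
  set (ew := Clog (1 + h)) in *.
  assert (Bew : Cmod ew <= 24 * (K0 * eps)) by lra.
  assert (HWv : (w' * w' * (F1v * P2v) - w * w * (P1v * F2v))%C
     = (2 * Ci * Cexpo (L1 + L2 + ew))%C).
  { rewrite F1, F2, P1, P2, !Cexpo_plus, Xh. unfold h. rewrite !Cexpo_plus.
    assert (R2 : RtoC (1/2) = (/ 2)%C) by (rewrite RtoC_div by lra; field; apply RtoC_neq0; lra).
    rewrite R2.
    transitivity (Ci * (l * l') * ((w * w') * (w * w')) * Cexpo L1 * Cexpo L2
       * (Cexpo e1 * Cexpo e2' + Cexpo e1' * Cexpo e2))%C; [ ring | ].
    rewrite Hll, Hww. field. }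
  assert (Hbound : forall x : C, Cmod x <= K0 * eps -> Cmod (x - ew) <= 25 * K0 * eps).
  { intros x Hx. unfold Cminus. eapply Rle_trans; [ apply Cmod_triangle | ]. rewrite Cmod_opp. lra. }
  set (Wv := (w' * w' * (F1v * P2v) - w * w * (P1v * F2v))%C) in *.
  assert (HW0 : (2 * Ci * Cexpo (L1 + L2 + ew))%C <> 0%C).
  { repeat apply Cmult_neq_0; [ apply RtoC_neq0; lra | | apply Cexpo_neq0 ].
    intros E. apply (f_equal Im) in E. simpl in E. lra. }
  assert (Ef : (f0 * Wv = 2 * om * F1v + 2 * (w * w) * omi * F2v)%C).
  { unfold Wv.
    transitivity (F1v * (w' * w' * (f0 * P2v) - fp0 * F2v)
      + w * w * F2v * (w' * w' * (F1v * fp0) - P1v * f0)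
      + (1 - (w * w') * (w * w')) * (F1v * fp0 * F2v))%C; [ ring | ].
    rewrite S01, S10, Hww. ring. }
  assert (Efp : (fp0 * Wv = 2 * omi * P2v + 2 * (w * w) * om * P1v)%C).
  { unfold Wv.
    transitivity (P2v * (w' * w' * (F1v * fp0) - P1v * f0)
      + w * w * P1v * (w' * w' * (f0 * P2v) - fp0 * F2v)
      + (1 - (w * w') * (w * w')) * (f0 * P2v * P1v))%C; [ ring | ].
    rewrite S01, S10, Hww. ring. }
  rewrite HWv in Ef, Efp. clearbody Wv.
  assert (HE : forall x y : C, (Cexpo (- L1 + (x - ew)) * Cexpo (L1 + L2 + ew) = Cexpo (L2 + x))%C /\
                    (Cexpo (- L2 + (y - ew)) * Cexpo (L1 + L2 + ew) = Cexpo (L1 + y))%C).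
  { intros x y. rewrite <- !Cexpo_plus. split; f_equal; ring. }
  split; [ | split ].
  - exists ew. split; [ clearbody ew; lra | exact HWv ].
  (* Division by the Wronskian turns [e^(L2)] into [e^(-L1)] and [e^(L1)] into [e^(-L2)], so the two
     errors change places and each is diminished by [ew]. *)
  - exists (e2 - ew)%C, (e1 - ew)%C. split; [ | split ]; [ apply Hbound; assumption .. | ].
    apply (Cmult_cancel_r _ _ (2 * Ci * Cexpo (L1 + L2 + ew))%C); [ exact HW0 | ].
    destruct (HE e2 e1) as [ HE1 HE2 ].
    rewrite Ef, F1, F2.
    transitivity (w * omi * l' * 2 * Ci * (Cexpo (- L1 + (e2 - ew)) * Cexpo (L1 + L2 + ew))
      - Ci * (w * om) * l' * 2 * Ci * (Cexpo (- L2 + (e1 - ew)) * Cexpo (L1 + L2 + ew)))%C; [ | ring ].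
    rewrite HE1, HE2.
    transitivity (2 * om * l' * w * Cexpo (L1 + e1)
      + (w * w') * (2 * w * omi * l' * Ci * Cexpo (L2 + e2)))%C; [ ring | ].
    transitivity (- (Ci * Ci) * (2 * om * l' * w * Cexpo (L1 + e1))
      + 2 * w * omi * l' * Ci * Cexpo (L2 + e2))%C; [ rewrite HCi, Hww | ]; ring.
  - exists (e2' - ew)%C, (e1' - ew)%C. split; [ | split ]; [ apply Hbound; assumption .. | ].
    apply (Cmult_cancel_r _ _ (2 * Ci * Cexpo (L1 + L2 + ew))%C); [ exact HW0 | ].
    destruct (HE e2' e1') as [ HE1 HE2 ].
    rewrite Efp, P1, P2.
    transitivity (w * omi * l * 2 * Ci * (Cexpo (- L1 + (e2' - ew)) * Cexpo (L1 + L2 + ew))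
      + Ci * (w * om) * l * 2 * Ci * (Cexpo (- L2 + (e1' - ew)) * Cexpo (L1 + L2 + ew)))%C; [ | ring ].
    rewrite HE1, HE2.
    transitivity (2 * omi * l * Ci * w * Cexpo (L2 + e2')
      - (w * w') * (2 * w * om * l * Cexpo (L1 + e1')))%C; [ ring | ].
    transitivity (2 * omi * l * Ci * w * Cexpo (L2 + e2')
      + (Ci * Ci) * (2 * w * om * l * Cexpo (L1 + e1')))%C; [ rewrite HCi, Hww | ]; ring.
Qed.
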